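(* Let $(Q,\mathbf n)$ be a quiver with multiplicities and let $\mathbb K=\mathbb F_q$ be a finite field. Let $\langle\bullet,\bullet\rangle$ be the Euler form of $(Q,\mathbf n)$. Then the following identity holds in $\mathcal V[[t_i,\ i\in Q_0]]$: $$\sum_{\mathbf r\in\mathbb Z_{\ge0}^{Q_0}}\frac{\sharp\,\mu_{(Q,\mathbf n),\mathbf r}^{-1}(0)}{\sharp\,\mathrm{GL}_{\mathbf n,\mathbf r}}\cdot q^{\langle\mathbf r,\mathbf r\rangle}\,t^{\mathbf r}=\mathrm{Exp}_{q,t}\left(\sum_{\mathbf r\in\mathbb Z_{\ge0}^{Q_0}\setminus\{0\}}\frac{A_{(Q,\mathbf n),\mathbf r}}{1-q^{-1}}\cdot t^{\mathbf r}\right).$$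
   Context: A quiver $Q=(Q_0,Q_1,s,t)$ has finite sets of vertices $Q_0$ and arrows $Q_1$, and source and target maps $s,t:Q_1\to Q_0$ (loops and parallel arrows allowed). A quiver with multiplicities is a pair $(Q,\mathbf n)$ with $\mathbf n\in\mathbb Z_{>0}^{Q_0}$; put $n_{ij}=\gcd(n_i,n_j)$. For a field $\mathbb K$ put $\mathbb K_n=\mathbb K[t]/(t^n)$; if $m\mid n$, $\mathbb K_n$ is a $\mathbb K_m$-algebra via $t\mapsto t^{n/m}$. A locally free representation of $(Q,\mathbf n)$ over $\mathbb K$ of rank vector $\mathbf r\in\mathbb Z_{\ge0}^{Q_0}$ consists of free $\mathbb K_{n_i}$-modules $M_i$ of rank $r_i$ ($i\in Q_0$) and $\mathbb K_{n_{ij}}$-linear maps $M_i\to M_j$ for each arrow $a:i\to j$; morphisms are tuples of $\mathbb K_{n_i}$-linear maps commuting with the structure maps. It is absolutely indecomposable if its base change to $\overline{\mathbb K}$ is indecomposable (nonzero and not a direct sum of two nonzero representations). Set $$R(Q,\mathbf n;\mathbf r)=\prod_{a:i\to j}\mathrm{Hom}_{\mathbb K_{n_{ij}}}(\mathbb K_{n_i}^{\oplus r_i},\mathbb K_{n_j}^{\oplus r_j}),\qquad \mathrm{GL}_{\mathbf n,\mathbf r}=\prod_{i\in Q_0}\mathrm{GL}_{r_i}(\mathbb K_{n_i}),$$ viewed as an affine space, resp. a linear algebraic group, over $\mathbb K$; $\mathrm{GL}_{\mathbf n,\mathbf r}$ acts by $(g\cdot x)_a=g_{t(a)}x_ag_{s(a)}^{-1}$.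 Let $\mathfrak{gl}_{\mathbf n,\mathbf r}$ be its Lie algebra. The moment map $\mu_{(Q,\mathbf n),\mathbf r}:R(Q,\mathbf n;\mathbf r)\times R(Q,\mathbf n;\mathbf r)^\vee\to\mathfrak{gl}_{\mathbf n,\mathbf r}^\vee$ is determined by $\langle\xi\cdot x,y\rangle=\langle\xi,\mu(x,y)\rangle$ for all $\xi\in\mathfrak{gl}_{\mathbf n,\mathbf r}$, where $\xi\cdot x$ is the infinitesimal action ($^\vee$ is the $\mathbb K$-linear dual). The Euler form is $\langle\mathbf r,\mathbf s\rangle=\sum_{i\in Q_0}n_ir_is_i-\sum_{a:i\to j}\frac{n_in_j}{n_{ij}}\,r_is_j$. Ring of volumes: $\mathcal V=\prod_{n\ge1}\mathbb Q$, with Adams operators $\psi_m((a_n)_n)=(a_{mn})_n$; $q$ denotes the element $(q^n)_{n\ge1}$, so $\mathbb Q(q)\subset\mathcal V$. For an $\mathbb F_q$-variety $X$, $\sharp X=(\sharp X(\mathbb F_{q^n}))_{n\ge1}\in\mathcal V$. $A_{(Q,\mathbf n),\mathbf r}\in\mathcal V$ is the element whose $n$-th component is the number of isomorphism classes of absolutely indecomposable locally free representations of $(Q,\mathbf n)$ of rank vector $\mathbf r$ over $\mathbb F_{q^n}$. On $\mathcal V[[t_i,i\in Q_0]]$ put $\psi_m(\sum_{\mathbf r} f_{\mathbf r}t^{\mathbf r})=\sum_{\mathbf r}\psi_m(f_{\mathbf r})t^{m\mathbf r}$, and for $F$ with zero constant term $\mathrm{Exp}_{q,t}(F)=\exp\left(\sum_{m\ge1}\psi_m(F)/m\right)$.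 *)

(* Defs.v *)
From HB Require Import structures.
From mathcomp Require Import all_boot all_order all_algebra all_field.
From mathcomp Require Import boolp classical_sets functions cardinality.

Set Implicit Arguments.
Unset Strict Implicit.
Unset Printing Implicit Defensive.

Import GRing.Theory.

Local Open Scope classical_set_scope.
Local Open Scope ring_scope.

(* Number of elements of a finite set; infinite sets get 0. *)
Definition ncard (T : Type) (A : set T) : nat := xget 0%N [set k | (A #= `I_k)%card].

Lemma ncardE (T : Type) (A : set T) (k : nat) : (A #= `I_k)%card -> ncard A = k.
Proof.
move=> Ak; rewrite /ncard; case: xgetP => [l _ /= Al|/(_ k)//].
by apply/card_eq_II; apply: card_eq_trans Ak; rewrite card_eq_sym.
Qed.

Record quiver := Quiver {
  vert : finType;
  arrow : finType;
  src : arrow -> vert;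
  tgt : arrow -> vert
}.

Record mquiver := MQuiver {
  mquiver_quiver :> quiver;
  mult : vert mquiver_quiver -> nat;
  mult_gt0 : forall i, (0 < mult i)%N
}.

(* K_n = K[t]/(t^n). For n = 0 the library quotients by 'X instead, so every
   use must come with n > 0. *)
Notation tpoly K n := {poly %/ ('X^n : {poly K})}.

Section TruncatedPolynomials.
Variable K : fieldType.

(* For m %| n, the structure map K_m -> K_n, t |-> t^(n/m). *)
Definition tpoly_ext (m n : nat) (c : tpoly K m) : tpoly K n :=
  in_qpoly 'X^n ((c : {poly K}) \Po 'X^(n %/ m)).

(* K_m-linearity, for m dividing n1 and n2. *)
Definition hom_linear (m n1 n2 r1 r2 : nat)
    (f : 'cV[tpoly K n1]_r1 -> 'cV[tpoly K n2]_r2) : Prop :=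
  forall (c : tpoly K m) u v,
    f (tpoly_ext n1 c *: u + v) = tpoly_ext n2 c *: f u + f v.

Lemma coef_in_qpolyXn n (p : {poly K}) k : (0 < n)%N ->
  (in_qpoly 'X^n p : {poly K})`_k = if (k < n)%N then p`_k else 0.
Proof.
move=> n_gt0; rewrite /= mk_monic_Xn prednK //.
rewrite -{1}(poly_take_drop n p) -Pdiv.IdomainMonic.modpE ?monicXn //.
rewrite modpD modp_mull addr0 modp_small ?coef_take_poly //.
by rewrite size_polyXn ltnS size_take_poly.
Qed.

Lemma coef_tpoly n (p : tpoly K n) k : (0 < n)%N -> (n <= k)%N ->
  (p : {poly K})`_k = 0.
Proof.
move=> n_gt0 le_nk; rewrite nth_default // (leq_trans _ le_nk) //.
have := size_mk_monic p; move: (polyn p) => {}p.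
by rewrite mk_monic_Xn prednK // size_polyXn ltnS.
Qed.

Lemma tpolyP n (p q : tpoly K n) : (0 < n)%N ->
  (forall k, (k < n)%N -> (p : {poly K})`_k = (q : {poly K})`_k) -> p = q.
Proof.
move=> n_gt0 epq; apply/val_inj/polyP => k.
by have [/epq//|le_nk] := ltnP k n; rewrite !coef_tpoly.
Qed.

Lemma tpoly_algE n (a : K) : (a%:A : tpoly K n) = in_qpoly 'X^n a%:P.
Proof. by rewrite -alg_polyC linearZ /= -[in_qpoly _ 1]/(in_qpoly _ 1) in_qpoly1. Qed.

Lemma coef_tpoly_alg n (a : K) (p : tpoly K n) k :
  (a%:A * p : {poly K})`_k = a * (p : {poly K})`_k.
Proof. by rewrite mulr_algl poly_of_qpolyZ coefZ. Qed.

Lemma coef_qXn n k l : (0 < n)%N -> (k < n)%N ->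
  (('qX ^+ l : tpoly K n) : {poly K})`_k = (k == l)%:R.
Proof. by move=> n0 lt_kn; rewrite -rmorphXn coef_in_qpolyXn // lt_kn coefXn. Qed.

Lemma tpoly_basis n (p : tpoly K n) : (0 < n)%N ->
  p = \sum_(k < n) ((p : {poly K})`_k)%:A * 'qX ^+ k.
Proof.
move=> n_gt0; apply: tpolyP => // l lt_ln.
rewrite poly_of_qpoly_sum coef_sum (bigD1 (Ordinal lt_ln)) //= big1 => [|k nkl].
  by rewrite coef_tpoly_alg coef_qXn // eqxx mulr1 addr0.
rewrite coef_tpoly_alg coef_qXn // -[l]/(val (Ordinal lt_ln)) (inj_eq val_inj).
by rewrite eq_sym (negPf nkl) mulr0.
Qed.

Lemma tpoly_ext_alg m n (a : K) : (0 < m)%N ->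
  tpoly_ext n (a%:A : tpoly K m) = a%:A.
Proof.
move=> m_gt0; rewrite !tpoly_algE /tpoly_ext.
suff -> : (in_qpoly 'X^m a%:P : {poly K}) = a%:P by rewrite comp_polyC.
apply: in_qpoly_small; rewrite mk_monic_Xn prednK // size_polyXn.
exact: leq_ltn_trans (size_polyC_leq1 _) _.
Qed.

Lemma tpoly_ext1 m n : tpoly_ext n (1 : tpoly K m) = 1.
Proof. by rewrite /tpoly_ext /= comp_polyC in_qpoly1. Qed.

End TruncatedPolynomials.

Section BaseChange.
Variables (K E : fieldType) (iota : {rmorphism K -> E}).

Definition tpoly_map n (c : tpoly K n) : tpoly E n :=
  in_qpoly 'X^n (map_poly iota c).

(* The E-linear extension of f, computed on the K-basis (t^k e_j) of K_n1^r1. *)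
Definition base_change_map n1 n2 r1 r2
    (f : 'cV[tpoly K n1]_r1 -> 'cV[tpoly K n2]_r2)
    (v : 'cV[tpoly E n1]_r1) : 'cV[tpoly E n2]_r2 :=
  \sum_(j < r1) \sum_(k < n1)
    ((v j 0 : {poly E})`_k)%:A *:
      map_mx (@tpoly_map n2) (f ('qX ^+ k *: delta_mx j 0)).

Lemma coef_tpoly_map n (c : tpoly K n) k : (0 < n)%N ->
  (tpoly_map c : {poly E})`_k = iota (c : {poly K})`_k.
Proof.
move=> n_gt0; rewrite coef_in_qpolyXn // coef_map.
by case: ltnP => // le_nk; rewrite coef_tpoly // rmorph0.
Qed.

Lemma tpoly_map_in n (p : {poly K}) : (0 < n)%N ->
  tpoly_map (in_qpoly 'X^n p) = in_qpoly 'X^n (map_poly iota p).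
Proof.
move=> n_gt0; apply: tpolyP => // k lt_kn.
by rewrite coef_tpoly_map // !coef_in_qpolyXn // lt_kn coef_map.
Qed.

Lemma tpoly_mapD n (c d : tpoly K n) :
  tpoly_map (c + d) = tpoly_map c + tpoly_map d.
Proof. by rewrite /tpoly_map -in_qpolyD -rmorphD. Qed.

Lemma tpoly_map0 n : tpoly_map (0 : tpoly K n) = 0.
Proof. by rewrite /tpoly_map rmorph0 in_qpoly0. Qed.

Lemma tpoly_mapM n (c d : tpoly K n) : (0 < n)%N ->
  tpoly_map (c * d) = tpoly_map c * tpoly_map d.
Proof.
move=> n_gt0; rewrite -[c * d]/(in_qpoly 'X^n ((c : {poly K}) * d)) tpoly_map_in //.
by rewrite rmorphM in_qpolyM.
Qed.

Lemma tpoly_mapA n a : (0 < n)%N -> tpoly_map (a%:A : tpoly K n) = (iota a)%:A.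
Proof. by move=> n_gt0; rewrite !tpoly_algE tpoly_map_in // map_polyC. Qed.

Lemma tpoly_map_ext m n (c : tpoly K m) : (0 < m)%N -> (0 < n)%N ->
  tpoly_map (tpoly_ext n c) = tpoly_ext n (tpoly_map c).
Proof.
move=> m_gt0 n_gt0; rewrite /tpoly_ext tpoly_map_in //; congr in_qpoly.
rewrite map_comp_poly map_polyXn; congr (_ \Po _).
by apply/polyP => k; rewrite coef_tpoly_map // coef_map.
Qed.

Lemma base_change_mapP m n1 n2 r1 r2
    (f : 'cV[tpoly K n1]_r1 -> 'cV[tpoly K n2]_r2) :
  (0 < m)%N -> (0 < n1)%N -> (0 < n2)%N ->
  hom_linear m f -> hom_linear m (base_change_map f).
Proof.
move=> m0 n10 n20 fP; pose bc := base_change_map f.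
have extD n (c d : tpoly E m) : tpoly_ext n (c + d) = tpoly_ext n c + tpoly_ext n d.
  by rewrite /tpoly_ext -in_qpolyD -rmorphD.
have extZ n a (c : tpoly E m) : tpoly_ext n (a%:A * c) = a%:A * tpoly_ext n c.
  by rewrite !mulr_algl /tpoly_ext -in_qpolyZ -linearZ.
have ext0 n : tpoly_ext n (0 : tpoly E m) = 0.
  by rewrite /tpoly_ext rmorph0 in_qpoly0.
have fD u v : f (u + v) = f u + f v.
  by have := fP 1 u v; rewrite !tpoly_ext1 !scale1r.
have f0 : f 0 = 0 by apply: (addIr (f 0)); rewrite -fD !add0r.
have fA a u : f (a%:A *: u) = a%:A *: f u.
  by have := fP a%:A u 0; rewrite !tpoly_ext_alg // f0 !addr0.
have bcD u v : bc (u + v) = bc u + bc v.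
  rewrite -big_split; apply: eq_bigr => j _; rewrite -big_split.
  by apply: eq_bigr => k _; rewrite !mxE coefD scalerDl scalerDl.
have bcA a u : bc (a%:A *: u) = a%:A *: bc u.
  rewrite scaler_sumr; apply: eq_bigr => j _; rewrite scaler_sumr.
  apply: eq_bigr => k _.
  by rewrite [RHS]scalerA !mxE coef_tpoly_alg mulr_algl scalerA.
have bc0 : bc 0 = 0 by apply: (addIr (bc 0)); rewrite -bcD !add0r.
pose mp n r (w : 'cV[tpoly K n]_r) := map_mx (@tpoly_map n) w.
have mpD n r : {morph @mp n r : u v / u + v}.
  by move=> u v; apply/matrixP => i j; rewrite !mxE tpoly_mapD.
have mp0 n r : @mp n r 0 = 0.
  by apply/matrixP => i j; rewrite !mxE tpoly_map0.
have mpZ n r c u : (0 < n)%N -> @mp n r (c *: u) = tpoly_map c *: mp n r u.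
  by move=> n_gt0; apply/matrixP => i j; rewrite !mxE tpoly_mapM.
have decomp (F : fieldType) (v : 'cV[tpoly F n1]_r1) :
  v = \sum_(j < r1) \sum_(k < n1) ((v j 0 : {poly F})`_k)%:A *: ('qX ^+ k *: delta_mx j 0).
  rewrite {1}[v]matrix_sum_delta; apply: eq_bigr => j _; rewrite big_ord1.
  rewrite {1}[v j 0]tpoly_basis // scaler_suml; apply: eq_bigr => k _.
  by rewrite scalerA.
have mapX n k : (0 < n)%N -> tpoly_map ('qX ^+ k : tpoly K n) = 'qX ^+ k.
  by move=> n_gt0; rewrite -!rmorphXn tpoly_map_in // map_polyXn.
have bcE v : bc (mp n1 r1 v) = mp n2 r2 (f v).
  rewrite [in RHS](decomp K v) (big_morph f fD f0) (big_morph _ (@mpD _ _) (@mp0 _ _)).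
  apply: eq_bigr => j _; rewrite (big_morph f fD f0) (big_morph _ (@mpD _ _) (@mp0 _ _)).
  by apply: eq_bigr => k _; rewrite fA mpZ // tpoly_mapA // !mxE coef_tpoly_map.
have bcZ1 (c : tpoly K m) v : bc (tpoly_ext n1 (tpoly_map c) *: mp n1 r1 v)
    = tpoly_ext n2 (tpoly_map c) *: bc (mp n1 r1 v).
  rewrite -!tpoly_map_ext // -mpZ // !bcE -mpZ //; congr (mp _ _ _).
  by have := fP c v 0; rewrite f0 !addr0.
have bcZ2 (c : tpoly E m) v : bc (tpoly_ext n1 c *: mp n1 r1 v)
    = tpoly_ext n2 c *: bc (mp n1 r1 v).
  rewrite {2}[c]tpoly_basis // {1}[c]tpoly_basis //.
  rewrite !(big_morph (@tpoly_ext E m _) (@extD _) (@ext0 _)) !scaler_suml.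
  rewrite (big_morph bc bcD bc0); apply: eq_bigr => k _.
  by rewrite !extZ -!scalerA bcA -mapX // bcZ1.
have bcZ (c : tpoly E m) u : bc (tpoly_ext n1 c *: u) = tpoly_ext n2 c *: bc u.
  rewrite [u]decomp (big_morph bc bcD bc0) !scaler_sumr (big_morph bc bcD bc0).
  apply: eq_bigr => j _; rewrite !(big_morph bc bcD bc0) !scaler_sumr !(big_morph bc bcD bc0).
  apply: eq_bigr => k _; rewrite scalerA mulrC -scalerA !bcA.
  have -> : 'qX ^+ k *: delta_mx j 0 = mp n1 r1 ('qX ^+ k *: delta_mx j 0).
    rewrite mpZ // mapX //; congr (_ *: _).
    apply/matrixP => a b; rewrite !mxE; case: andP => _; last by rewrite tpoly_map0.
    by have := tpoly_mapA 1 n10; rewrite rmorph1 !scale1r.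
  by rewrite bcZ2 !scalerA mulrC.
by move=> c u v; rewrite -/bc bcD bcZ.
Qed.
End BaseChange.

Section Representations.
Variables (Q : mquiver) (K : fieldType).
Implicit Types r s : vert Q -> nat.

Definition rmod r (i : vert Q) := 'cV[tpoly K (mult i)]_(r i).

(* A locally free representation of rank vector r, on the standard free modules
   M_i = K_{n_i}^{r_i}; this is a K-point of R(Q, n; r). *)
Record rep r := Rep {
  rep_map :> forall a : arrow Q, rmod r (src a) -> rmod r (tgt a);
  rep_mapP : forall a,
    hom_linear (gcdn (mult (src a)) (mult (tgt a))) (@rep_map a)
}.
Arguments rep_mapP {r} x a c u v : rename.
HB.instance Definition _ r := gen_eqMixin (rep r).
HB.instance Definition _ r := gen_choiceMixin (rep r).

Lemma rep_eq r (x y : rep r) : (forall a, x a =1 y a) -> x = y.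
Proof.
case: x y => [x xP] [y yP] /= exy.
have {}exy : x = y by apply: functional_extensionality_dep => a; apply: funext.
by case: _ / exy yP => yP; congr Rep; apply: Prop_irrelevance.
Qed.

Section RepLmodule.
Variable r : vert Q -> nat.
Implicit Types x y z : rep r.

Fact rep_zero_subproof a : hom_linear (gcdn (mult (src a)) (mult (tgt a)))
  ((fun=> 0) : rmod r (src a) -> rmod r (tgt a)).
Proof. by move=> c u v; rewrite scaler0 addr0. Qed.
Definition rep_zero := Rep rep_zero_subproof.

Fact rep_add_subproof x y a : hom_linear (gcdn (mult (src a)) (mult (tgt a)))
  (fun v => x a v + y a v).
Proof. by move=> c u v; rewrite !rep_mapP scalerDr addrACA. Qed.
Definition rep_add x y := Rep (rep_add_subproof x y).

Fact rep_opp_subproof x a : hom_linear (gcdn (mult (src a)) (mult (tgt a)))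
  (fun v => - x a v).
Proof. by move=> c u v; rewrite rep_mapP opprD scalerN. Qed.
Definition rep_opp x := Rep (rep_opp_subproof x).

Fact rep_scale_subproof (k : K) x a : hom_linear (gcdn (mult (src a)) (mult (tgt a)))
  (fun v => k%:A *: x a v).
Proof.
by move=> c u v; rewrite rep_mapP scalerDr !scalerA [_ * tpoly_ext _ _]mulrC.
Qed.
Definition rep_scale k x := Rep (rep_scale_subproof k x).

Fact rep_addA : associative rep_add.
Proof. by move=> x y z; apply: rep_eq => a v /=; rewrite addrA. Qed.
Fact rep_addC : commutative rep_add.
Proof. by move=> x y; apply: rep_eq => a v /=; rewrite addrC. Qed.
Fact rep_add0 : left_id rep_zero rep_add.
Proof. by move=> x; apply: rep_eq => a v /=; rewrite add0r. Qed.
Fact rep_addN : left_inverse rep_zero rep_opp rep_add.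
Proof. by move=> x; apply: rep_eq => a v /=; rewrite addNr. Qed.
HB.instance Definition _ :=
  GRing.isZmodule.Build (rep r) rep_addA rep_addC rep_add0 rep_addN.

Fact rep_scaleA k l x : rep_scale k (rep_scale l x) = rep_scale (k * l) x.
Proof.
by apply: rep_eq => a v /=; rewrite scalerA mulr_algl (scalerA k l (1 : tpoly K _)).
Qed.
Fact rep_scale1 : left_id 1 rep_scale.
Proof. by move=> x; apply: rep_eq => a v /=; rewrite !scale1r. Qed.
Fact rep_scaleDr : right_distributive rep_scale +%R.
Proof. by move=> k x y; apply: rep_eq => a v /=; rewrite scalerDr. Qed.
Fact rep_scaleDl x : {morph rep_scale^~ x : k l / k + l}.
Proof. by move=> k l; apply: rep_eq => a v /=; rewrite !scalerDl. Qed.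
HB.instance Definition _ := GRing.Zmodule_isLmodule.Build K (rep r)
  rep_scaleA rep_scale1 rep_scaleDr rep_scaleDl.

End RepLmodule.

Definition gl r : Type := forall i : vert Q, 'M[tpoly K (mult i)]_(r i).
HB.instance Definition _ r := gen_eqMixin (gl r).
HB.instance Definition _ r := gen_choiceMixin (gl r).

Section GlLmodule.
Variable r : vert Q -> nat.
Implicit Types x y z : gl r.

Let gl_eq x y : (forall i, x i = y i) -> x = y.
Proof. exact: functional_extensionality_dep. Qed.

Definition gl_zero : gl r := fun i => 0.
Definition gl_add x y : gl r := fun i => x i + y i.
Definition gl_opp x : gl r := fun i => - x i.
Definition gl_scale (k : K) x : gl r := fun i => k%:A *: x i.

Fact gl_addA : associative gl_add.
Proof. by move=> x y z; apply: gl_eq => i; apply: addrA. Qed.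
Fact gl_addC : commutative gl_add.
Proof. by move=> x y; apply: gl_eq => i; apply: addrC. Qed.
Fact gl_add0 : left_id gl_zero gl_add.
Proof. by move=> x; apply: gl_eq => i; apply: add0r. Qed.
Fact gl_addN : left_inverse gl_zero gl_opp gl_add.
Proof. by move=> x; apply: gl_eq => i; apply: addNr. Qed.
HB.instance Definition _ :=
  GRing.isZmodule.Build (gl r) gl_addA gl_addC gl_add0 gl_addN.

Fact gl_scaleA k l x : gl_scale k (gl_scale l x) = gl_scale (k * l) x.
Proof.
by apply: gl_eq => i; rewrite /gl_scale scalerA mulr_algl (scalerA k l (1 : tpoly K _)).
Qed.
Fact gl_scale1 : left_id 1 gl_scale.
Proof. by move=> x; apply: gl_eq => i; rewrite /gl_scale !scale1r. Qed.
Fact gl_scaleDr : right_distributive gl_scale +%R.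
Proof. by move=> k x y; apply: gl_eq => i; apply: scalerDr. Qed.
Fact gl_scaleDl x : {morph gl_scale^~ x : k l / k + l}.
Proof. by move=> k l; apply: gl_eq => i; rewrite /gl_scale !scalerDl. Qed.
HB.instance Definition _ := GRing.Zmodule_isLmodule.Build K (gl r)
  gl_scaleA gl_scale1 gl_scaleDr gl_scaleDl.

End GlLmodule.

(* K-points of the group GL_{n,r}, inside the Lie algebra. *)
Definition GL r : set (gl r) := [set g | forall i, g i \in unitmx].

(* Derivative at the identity of (g . x)_a = g_{t(a)} x_a g_{s(a)}^-1. *)
Fact inf_act_subproof r (x : rep r) (xi : gl r) (a : arrow Q) :
  hom_linear (gcdn (mult (src a)) (mult (tgt a)))
    (fun v => xi (tgt a) *m x a v - x a (xi (src a) *m v)).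
Proof.
move=> c u v; rewrite !mulmxDr -!scalemxAr !rep_mapP mulmxDr -!scalemxAr.
by rewrite opprD addrACA scalerBr.
Qed.
Definition inf_act r (x : rep r) (xi : gl r) : rep r := Rep (inf_act_subproof x xi).

Lemma rep_mapD r (x : rep r) a : {morph x a : u v / u + v}.
Proof.
move=> u v; have := rep_mapP x a 1 u v.
by rewrite !tpoly_ext1 !scale1r.
Qed.

Lemma rep_map0 r (x : rep r) a : x a 0 = 0.
Proof. by apply: (addIr (x a 0)); rewrite -rep_mapD !add0r. Qed.

Lemma rep_mapN r (x : rep r) a : {morph x a : u / - u}.
Proof. by move=> u; apply: (addIr (x a u)); rewrite -rep_mapD !addNr rep_map0. Qed.

Lemma rep_mapZ r (x : rep r) a (k : K) u : x a (k%:A *: u) = k%:A *: x a u.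
Proof.
have := rep_mapP x a k%:A u 0.
by rewrite rep_map0 !addr0 !tpoly_ext_alg // gcdn_gt0 mult_gt0.
Qed.

Fact inf_act_linear r (x : rep r) : linear (inf_act x).
Proof.
move=> k xi zeta; apply: rep_eq => a v /=.
rewrite /= !mulmxDl -!scalemxAl rep_mapD rep_mapZ.
by rewrite scalerBr opprD addrACA.
Qed.
HB.instance Definition _ r (x : rep r) :=
  GRing.isLinear.Build K (gl r) (rep r) _ (inf_act x) (inf_act_linear x).

Definition dual (V : lmodType K) := {linear V -> K^o}.

Definition moment_map r (x : rep r) (y : dual (rep r)) : dual (gl r) :=
  y \o inf_act x.

Definition moment_zero r : set (rep r * dual (rep r)) :=
  [set xy | moment_map xy.1 xy.2 =1 cst 0].

Definition rep_iso r s (x : rep r) (y : rep s) : Prop :=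
  exists g : forall i, {linear rmod r i -> rmod s i},
    (forall i, bijective (g i)) /\
    (forall a v, g (tgt a) (x a v) = y a (g (src a) v)).

Fact dsum_subproof r s (x : rep r) (y : rep s) (a : arrow Q) :
  hom_linear (gcdn (mult (src a)) (mult (tgt a)))
    (fun v : rmod (fun i => r i + s i)%N (src a) =>
       col_mx (x a (usubmx v)) (y a (dsubmx v))).
Proof.
move=> c u v; rewrite !linearP !rep_mapP -add_col_mx -scale_col_mx //.
Qed.
Definition dsum r s (x : rep r) (y : rep s) : rep (fun i => r i + s i)%N :=
  Rep (dsum_subproof x y).

Definition nonzero_rank r : Prop := exists i, (0 < r i)%N.

(* K_{n_i} being local, direct summands of a locally free representation are
   locally free. *)
Definition indecomposable r (x : rep r) : Prop :=
  nonzero_rank r /\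
  ~ exists r1 r2 (x1 : rep r1) (x2 : rep r2),
      [/\ nonzero_rank r1, nonzero_rank r2 & rep_iso x (dsum x1 x2)].

End Representations.
Arguments rep_mapP {Q K r} x a c u v : rename.

Definition base_change (Q : mquiver) (K E : fieldType) (iota : {rmorphism K -> E})
    (r : vert Q -> nat) (x : rep K r) : rep E r :=
  @Rep Q E r (fun a => base_change_map iota (x a))
    (fun a => base_change_mapP iota
       (etrans (gcdn_gt0 _ _) (introT orP (or_introl (mult_gt0 _))))
       (mult_gt0 _) (mult_gt0 _) (rep_mapP x a)).

Definition alg_closure (K : countFieldType) : countClosedFieldType :=
  projT1 (countable_algebraic_closure K).
Definition to_alg_closure (K : countFieldType) : {rmorphism K -> alg_closure K} :=
  sval (projT2 (countable_algebraic_closure K)).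

Definition abs_indecomposable (Q : mquiver) (K : countFieldType)
    (r : vert Q -> nat) (x : rep K r) : Prop :=
  indecomposable (base_change (to_alg_closure K) x).

Definition abs_indec_classes (Q : mquiver) (K : countFieldType)
    (r : vert Q -> nat) : set (set (rep K r)) :=
  (fun x : rep K r => [set y | rep_iso x y]) @` [set x | abs_indecomposable x].

Definition euler (Q : mquiver) (r s : vert Q -> nat) : int :=
  \sum_(i : vert Q) (mult i * r i * s i)%N%:Z
  - \sum_(a : arrow Q)
      ((mult (src a) * mult (tgt a)) %/ gcdn (mult (src a)) (mult (tgt a))
       * r (src a) * s (tgt a))%N%:Z.

Definition posnat : Type := {k : nat | (0 < k)%N}.

Definition posS (k : nat) : posnat := exist _ k.+1 isT.
Definition posM (k l : posnat) : posnat :=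
  exist _ (val k * val l)%N (etrans (muln_gt0 _ _) (introT andP (conj (valP k) (valP l)))).

(* Units are the families with all components nonzero; their inverse is
   componentwise. *)
Definition volume : Type := posnat -> rat.

HB.instance Definition _ := GRing.ComPzRing.copy volume (posnat -> rat).

Fact volume_oner_neq0 : (1 : volume) != 0.
Proof. by apply/eqP => /(congr1 (@^~ (posS 0))) /eqP; rewrite oner_eq0. Qed.
HB.instance Definition _ := GRing.PzSemiRing_isNonZero.Build volume volume_oner_neq0.

Definition volume_unit : {pred volume} := fun a => `[< forall k, a k != 0 >].
Definition volume_inv (a : volume) : volume :=
  if a \in volume_unit then fun k => (a k)^-1 else a.

Fact volume_mulVr : {in volume_unit, left_inverse 1 volume_inv *%R}.
Proof.
move=> a ua; rewrite /volume_inv ua; apply: funext => k.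
by move: ua => /asboolP ua; apply: mulVf.
Qed.
Fact volume_unitP (a b : volume) : b * a = 1 -> a \in volume_unit.
Proof.
move=> ba1; apply/asboolP => k; apply/eqP => ak0.
have /eqP := congr1 (@^~ k) ba1; rewrite -[(b * a) k]/(b k * a k) ak0 mulr0.
by rewrite eq_sym oner_eq0.
Qed.
Fact volume_inv_out : {in [predC volume_unit], volume_inv =1 id}.
Proof. by move=> a; rewrite inE /= /volume_inv => /negPf ->. Qed.
HB.instance Definition _ := GRing.ComNzRing_hasMulInverse.Build volume
  volume_mulVr volume_unitP volume_inv_out.

Definition adams (m : posnat) (a : volume) : volume := fun k => a (posM m k).

Definition volq (q : nat) : volume := fun k => (q ^ val k)%:R.

(* F k is meant to be a field with q^k elements, and X L the number of points
   over the field L. *)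
Definition volume_of (F : posnat -> finFieldType) (X : finFieldType -> nat) : volume :=
  fun k => (X (F k))%:R.

Section Series.
Variable I : finType.

(* A power series in the t_i, as the family of its coefficients. *)
Definition series : Type := {ffun I -> nat} -> volume.
Implicit Types (F G : series) (r : {ffun I -> nat}).

Definition tdeg r : nat := \sum_(i : I) r i.

Definition series1 : series := fun r => (r == [ffun=> 0%N])%:R.

Definition series_mul F G : series := fun r =>
  \sum_(s : {dffun forall i : I, 'I_(r i).+1})
    F [ffun i => s i : nat] * G [ffun i => (r i - s i)%N].

Definition series_exp F (k : nat) : series := iter k (series_mul F) series1.

Definition series_adams (m : posnat) F : series := fun r =>
  if [forall i, (val m %| r i)%N] then adams m (F [ffun i => (r i %/ val m)%N]) else 0.

(* exp and Exp are meant for series with zero constant term: then the powers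
   G^k with k > tdeg r and the psi_m(F) with m > tdeg r do not contribute to
   the coefficient of t^r (lemmas below), so that the sums below are the full
   ones. *)
Definition exp_series G : series := fun r =>
  \sum_(0 <= k < (tdeg r).+1) (k`!%:R)^-1 * series_exp G k r.

Definition Exp_series F : series :=
  exp_series (fun r =>
    \sum_(0 <= m < tdeg r) (m.+1%:R)^-1 * series_adams (posS m) F r).

Lemma series_exp_small G k r :
  G [ffun=> 0%N] = 0 -> (tdeg r < k)%N -> series_exp G k r = 0.
Proof.
move=> G0; elim: k r => [//|k IHk] r; rewrite ltnS => le_rk /=.
apply: big1 => s _.
have [s0|s_neq0] := eqVneq [ffun i => s i : nat] [ffun=> 0%N].
  by rewrite s0 G0 mul0r.
rewrite IHk ?mulr0 //; apply: leq_trans le_rk.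
have [i si] : exists i, (0 < s i)%N.
  apply/existsP; apply: contraNT s_neq0 => /existsPn s0; apply/eqP/ffunP => i.
  by rewrite !ffunE; apply/eqP; rewrite -leqn0 leqNgt s0.
have le_s j : (s j <= r j)%N by rewrite -ltnS ltn_ord.
rewrite /tdeg (bigD1 i) //= [X in (_ < X)%N](bigD1 i) //= -addSn leq_add //.
  by rewrite ffunE ltn_subrL si (leq_trans si).
by apply: leq_sum => j _; rewrite ffunE leq_subr.
Qed.

Lemma series_adams_small F (m : posnat) r :
  F [ffun=> 0%N] = 0 -> (tdeg r < val m)%N -> series_adams m F r = 0.
Proof.
move=> F0 lt_rm; rewrite /series_adams; case: forallP => // m_dvd.
have r0 i : r i = 0%N.
  apply/eqP; rewrite -leqn0 leqNgt; apply/negP => ri.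
  have := leq_ltn_trans (dvdn_leq ri (m_dvd i)).
  suff le_ri : (r i <= tdeg r)%N by move=> /(_ _ (leq_ltn_trans le_ri lt_rm)); rewrite ltnn.
  by rewrite /tdeg (bigD1 i) //= leq_addr.
suff -> : [ffun i => (r i %/ val m)%N] = [ffun=> 0%N] :> {ffun I -> nat}.
  by rewrite F0.
by apply/ffunP => i; rewrite !ffunE r0 div0n.
Qed.

End Series.

(* Main.v *)
(* A locally free representation of rank vector r is a family of operators (vertex
   projections, t, arrows) on K^D, D = sum_i n_i r_i, and base change is the base
   change of matrices.

   The fibre of mu^-1(0) above x is the annihilator of the image of xi |-> xi.x, whose
   kernel is End(x). Hence the coefficient of t^r on the left is the sum of
   #End(M)/#Aut(M) over the isomorphism classes M of rank vector r. Since End(X) is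
   local for X indecomposable, with residue field of some cardinal Q, Krull-Schmidt
   factors this series into prod_X prod_(m >= 0) 1/(1 - Q^-m t^(rk X)), that is,
     exp(sum_X sum_(m >= 1) t^(m rk X) / (m (1 - Q^-m))).
   An indecomposable X with residue field F_(q^d) splits over F_(q^N), d | N, into d
   pairwise non-isomorphic absolutely indecomposable summands of rank vector rk X / d,
   and every absolutely indecomposable representation over F_(q^N) arises in this way
   from exactly one X; so the exponent is the sum of psi_N(A/(1 - q^-1))/N. Both sides
   are compared through the recursions that their logarithmic derivatives satisfy. *)

Require Import Defs.
From HB Require Import structures.
From mathcomp Require Import all_boot all_order all_fingroup all_solvable all_algebra all_field.
From mathcomp Require Import mxabelem.
From mathcomp Require Import boolp.
From mathcomp Require Import ring.

Set Implicit Arguments.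
Unset Strict Implicit.
Unset Printing Implicit Defensive.

Import Order.TTheory GRing.Theory Num.Theory.

Local Open Scope ring_scope.

(* Families of operators on the row space K^D; a morphism acts on the right. *)
Notation md G K D := {ffun G -> 'M[K]_D}.

(** * Families of operators and their summands *)

Section Modules.
Variables (G : finType) (K : fieldType).

(** Krull-Schmidt enters only through numbers. The multiplicity of [X] in [T] is read off from
    #Hom(X, T) / #rad(X, T), and the weight #End / #GL_D is summed over all families of matrices on
    K^D rather than over classes, so that splitting off one copy of [X] becomes a double count over
    changes of basis. Each copy removed costs a factor 1 - Q^-m, m being the multiplicity.

    Over an extension E of L the obstacle is that End(X) is not its residue field. A Teichmueller
    lift [th] in End(X), fixed by the Q-th power, gives End(X) = L[th] + rad. When E contains the
    residue field, [th] is diagonalizable over E; its eigenspaces are the absolutely indecomposable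
    summands, and the Frobenius of E over L permutes them transitively, which makes their rank
    vectors equal. That every absolutely indecomposable [Y] over E arises follows from restriction
    of scalars: [Y] is a summand of the base change of its restriction to L. The fields of the
    statement are given only by their cardinals, so embeddings between them are constructed as
    well. *)

Definition mhom D1 D2 (T1 : md G K D1) (T2 : md G K D2) (A : 'M[K]_(D1, D2)) : bool :=
  [forall g, T1 g *m A == A *m T2 g].

Lemma mhomP D1 D2 (T1 : md G K D1) (T2 : md G K D2) A :
  reflect (forall g, T1 g *m A = A *m T2 g) (mhom T1 T2 A).
Proof. by apply: (iffP forallP) => h g; apply/eqP. Qed.

Lemma mhom0 D1 D2 (T1 : md G K D1) (T2 : md G K D2) : mhom T1 T2 0.
Proof. by apply/mhomP => g; rewrite mulmx0 mul0mx. Qed.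

Lemma mhom1 D (T : md G K D) : mhom T T 1%:M.
Proof. by apply/mhomP => g; rewrite mulmx1 mul1mx. Qed.

Lemma mhomD D1 D2 (T1 : md G K D1) (T2 : md G K D2) A B :
  mhom T1 T2 A -> mhom T1 T2 B -> mhom T1 T2 (A + B).
Proof. by move=> /mhomP hA /mhomP hB; apply/mhomP => g; rewrite mulmxDr mulmxDl hA hB. Qed.

Lemma mhomZ D1 D2 (T1 : md G K D1) (T2 : md G K D2) c A :
  mhom T1 T2 A -> mhom T1 T2 (c *: A).
Proof. by move=> /mhomP hA; apply/mhomP => g; rewrite -scalemxAr -scalemxAl hA. Qed.

Lemma mhomN D1 D2 (T1 : md G K D1) (T2 : md G K D2) A :
  mhom T1 T2 A -> mhom T1 T2 (- A).
Proof. by move=> hA; rewrite -scaleN1r mhomZ. Qed.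

Lemma mhomB D1 D2 (T1 : md G K D1) (T2 : md G K D2) A B :
  mhom T1 T2 A -> mhom T1 T2 B -> mhom T1 T2 (A - B).
Proof. by move=> hA hB; rewrite mhomD // mhomN. Qed.

Lemma mhom_scalar D (T : md G K D) c : mhom T T c%:M.
Proof. by rewrite -scalemx1 mhomZ // mhom1. Qed.

Lemma mhomM D1 D2 D3 (T1 : md G K D1) (T2 : md G K D2) (T3 : md G K D3) A B :
  mhom T1 T2 A -> mhom T2 T3 B -> mhom T1 T3 (A *m B).
Proof.
by move=> /mhomP hA /mhomP hB; apply/mhomP => g; rewrite mulmxA hA -!mulmxA hB.
Qed.

Lemma mhomX D (T : md G K D) A k : mhom T T A -> mhom T T (A ^+ k).
Proof.
by move=> hA; elim: k => [|k IHk]; [exact: mhom1 T|rewrite exprS -mulmxE (mhomM hA)].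
Qed.

Lemma mhom_sum D1 D2 (T1 : md G K D1) (T2 : md G K D2) (I : Type) (r : seq I)
    (P : pred I) (F : I -> 'M[K]_(D1, D2)) :
  (forall i, P i -> mhom T1 T2 (F i)) -> mhom T1 T2 (\sum_(i <- r | P i) F i).
Proof. by move=> hF; apply: (big_ind (mhom T1 T2)) => //; [apply: mhom0|apply: mhomD]. Qed.

Lemma mhom_horner D (T : md G K D.+1) A (p : {poly K}) :
  mhom T T A -> mhom T T (horner_mx A p).
Proof.
move=> hA; rewrite -[p]coefK poly_def rmorph_sum; apply: mhom_sum => i _ /=.
by rewrite linearZ /= rmorphXn /= horner_mx_X mhomZ // mhomX.
Qed.

Lemma mhom_inv D1 D2 (T1 : md G K D1) (T2 : md G K D2) A B :
  mhom T1 T2 A -> A *m B = 1%:M -> B *m A = 1%:M -> mhom T2 T1 B.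
Proof.
move=> /mhomP hA AB BA; apply/mhomP => g.
by rewrite -[LHS]mul1mx -BA -!mulmxA [A *m _]mulmxA -hA -!mulmxA AB mulmx1.
Qed.

Lemma mhom_invmx D (T1 T2 : md G K D) A :
  A \in unitmx -> mhom T1 T2 A -> mhom T2 T1 (invmx A).
Proof. by move=> uA hA; apply: mhom_inv hA _ _; rewrite ?mulmxV ?mulVmx. Qed.

Definition miso D1 D2 (T1 : md G K D1) (T2 : md G K D2) : Prop :=
  exists A B, [/\ mhom T1 T2 A, mhom T2 T1 B, A *m B = 1%:M & B *m A = 1%:M].

Lemma miso_refl D (T : md G K D) : miso T T.
Proof. by exists 1%:M, 1%:M; rewrite mhom1 mulmx1. Qed.

Lemma miso_sym D1 D2 (T1 : md G K D1) (T2 : md G K D2) : miso T1 T2 -> miso T2 T1.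
Proof. by move=> [A [B [? ? ? ?]]]; exists B, A. Qed.

Lemma miso_trans D1 D2 D3 (T1 : md G K D1) (T2 : md G K D2) (T3 : md G K D3) :
  miso T1 T2 -> miso T2 T3 -> miso T1 T3.
Proof.
move=> [A [B [hA hB AB BA]]] [A' [B' [hA' hB' AB' BA']]].
exists (A *m A'), (B' *m B); split; rewrite ?(mhomM hA) ?(mhomM hB') //.
  by rewrite mulmxA -(mulmxA A) AB' mulmx1.
by rewrite mulmxA -(mulmxA B') BA mulmx1.
Qed.

Lemma mulmx1_dim m n (A : 'M[K]_(m, n)) (B : 'M[K]_(n, m)) :
  A *m B = 1%:M -> (m <= n)%N.
Proof.
move=> AB; rewrite -{1}(mxrank1 K m) -AB.
exact: leq_trans (mxrankM_maxl _ _) (rank_leq_col _).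
Qed.

Lemma miso_dim D1 D2 (T1 : md G K D1) (T2 : md G K D2) : miso T1 T2 -> D1 = D2.
Proof.
by move=> [A [B [_ _ AB BA]]]; apply/eqP; rewrite eqn_leq (mulmx1_dim AB) (mulmx1_dim BA).
Qed.

Lemma misoP D (T1 T2 : md G K D) :
  miso T1 T2 <-> exists2 A, A \in unitmx & mhom T1 T2 A.
Proof.
split=> [[A [B [hA hB AB BA]]]|[A uA hA]]; first by exists A => //; case: (mulmx1_unit AB).
by exists A, (invmx A); rewrite mhom_invmx // mulmxV // mulVmx.
Qed.

Definition osum D1 D2 (T1 : md G K D1) (T2 : md G K D2) : md G K (D1 + D2) :=
  [ffun g => block_mx (T1 g) 0 0 (T2 g)].

Lemma mhom_row D D1 D2 (T : md G K D) (T1 : md G K D1) (T2 : md G K D2) A1 A2 :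
  mhom T (osum T1 T2) (row_mx A1 A2) = mhom T T1 A1 && mhom T T2 A2.
Proof.
apply/mhomP/andP => [h|[/mhomP h1 /mhomP h2] g]; last first.
  by rewrite ffunE mul_row_block mul_mx_row !mulmx0 addr0 add0r h1 h2.
split; apply/mhomP => g; have := h g;
  by rewrite ffunE mul_row_block mul_mx_row !mulmx0 addr0 add0r => /eq_row_mx [].
Qed.

Lemma mhom_col D D1 D2 (T : md G K D) (T1 : md G K D1) (T2 : md G K D2) A1 A2 :
  mhom (osum T1 T2) T (col_mx A1 A2) = mhom T1 T A1 && mhom T2 T A2.
Proof.
apply/mhomP/andP => [h|[/mhomP h1 /mhomP h2] g]; last first.
  by rewrite ffunE mul_block_col mul_col_mx !mul0mx addr0 add0r h1 h2.
split; apply/mhomP => g; have := h g;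
  by rewrite ffunE mul_block_col mul_col_mx !mul0mx addr0 add0r => /eq_col_mx [].
Qed.

Lemma miso_osum D1 D2 D1' D2' (T1 : md G K D1) (T2 : md G K D2)
    (T1' : md G K D1') (T2' : md G K D2') :
  miso T1 T1' -> miso T2 T2' -> miso (osum T1 T2) (osum T1' T2').
Proof.
move=> [A [B [hA hB AB BA]]] [A' [B' [hA' hB' AB' BA']]].
exists (block_mx A 0 0 A'), (block_mx B 0 0 B').
split; rewrite ?block_mxEv ?mhom_col ?mhom_row ?hA ?hA' ?hB ?hB' ?mhom0 //.
  by rewrite -!block_mxEv mulmx_block !mulmx0 !mul0mx !addr0 !add0r AB AB' -scalar_mx_block.
by rewrite -!block_mxEv mulmx_block !mulmx0 !mul0mx !addr0 !add0r BA BA' -scalar_mx_block.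
Qed.

Lemma miso_osumC D1 D2 (T1 : md G K D1) (T2 : md G K D2) :
  miso (osum T1 T2) (osum T2 T1).
Proof.
exists (block_mx 0 1%:M 1%:M 0), (block_mx 0 1%:M 1%:M 0).
split; rewrite ?block_mxEv ?mhom_col ?mhom_row ?mhom1 ?mhom0 //;
by rewrite -!block_mxEv mulmx_block !mulmx0 !mul0mx !mulmx1 !addr0 !add0r -scalar_mx_block.
Qed.

(** [Y] is isomorphic to a direct summand of [T]: [i] embeds and [p] retracts. Maps act on row
    vectors, so composites read from left to right. *)
Definition mdvd D1 D2 (Y : md G K D1) (T : md G K D2) : Prop :=
  exists i p, [/\ mhom Y T i, mhom T Y p & i *m p = 1%:M].

Lemma mdvd_unit D1 D2 (Y : md G K D1) (T : md G K D2) i p :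
  mhom Y T i -> mhom T Y p -> i *m p \in unitmx -> mdvd Y T.
Proof.
move=> hi hp u; exists i, (p *m invmx (i *m p)); rewrite mulmxA mulmxV //.
by rewrite (mhomM hp) // mhom_invmx // (mhomM hi).
Qed.

Lemma miso_mdvd D1 D2 (Y : md G K D1) (T : md G K D2) : miso Y T -> mdvd Y T.
Proof. by move=> [A [B [? ? ? ?]]]; exists A, B. Qed.

Lemma mdvd_trans D1 D2 D3 (T1 : md G K D1) (T2 : md G K D2) (T3 : md G K D3) :
  mdvd T1 T2 -> mdvd T2 T3 -> mdvd T1 T3.
Proof.
move=> [i [p [hi hp ip]]] [i' [p' [hi' hp' ip']]].
exists (i *m i'), (p' *m p); rewrite (mhomM hi) // (mhomM hp') //.
by rewrite mulmxA -(mulmxA i) ip' mulmx1.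
Qed.

Lemma mdvd_suml D1 D2 (T1 : md G K D1) (T2 : md G K D2) : mdvd T1 (osum T1 T2).
Proof.
exists (row_mx 1%:M 0), (col_mx 1%:M 0).
by rewrite mhom_row mhom_col mhom1 !mhom0 mul_row_col mulmx0 addr0 mulmx1.
Qed.

Lemma mdvd_sumr D1 D2 (T1 : md G K D1) (T2 : md G K D2) : mdvd T2 (osum T1 T2).
Proof.
exact: mdvd_trans (mdvd_suml T2 T1) (miso_mdvd (miso_osumC T2 T1)).
Qed.

Lemma mdvd_dim D1 D2 (Y : md G K D1) (T : md G K D2) : mdvd Y T -> (D1 <= D2)%N.
Proof. by move=> [i [p [_ _ /mulmx1_dim]]]. Qed.

(** In a rank factorization [e = c k], cancelling the full-rank factors in [c k c k = c k] leaves
    [k c = 1]. The image of an idempotent thus becomes a row space of its own. *)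
Lemma idem_factor D (e : 'M[K]_D) : e *m e = e ->
  exists r (c : 'M_(D, r)) (k : 'M_(r, D)), [/\ r = \rank e, c *m k = e & k *m c = 1%:M].
Proof.
move=> ee; exists (\rank e), (col_base e), (row_base e).
have [l] : exists l, l *m col_base e = 1%:M.
  by apply/row_fullP; apply: col_base_full.
have := row_free_inj (row_base_free e); have := mulmx_base e.
move: (col_base e) (row_base e) => c k ck /(_ _) kI lc; split=> //; apply: kI.
have H : c *m (k *m c *m k) = c *m k by rewrite -mulmxA ck mulmxA ck ee.
by have := congr1 (mulmx l) H; rewrite !mulmxA lc !mul1mx.
Qed.

Lemma split_complement D1 D2 (Y : md G K D1) (T : md G K D2) i p :
    mhom Y T i -> mhom T Y p -> i *m p = 1%:M ->
  exists D' (S : md G K D') k c, [/\ mhom S T k, mhom T S c &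
    [/\ k *m c = 1%:M, i *m c = 0, k *m p = 0 & p *m i + c *m k = 1%:M]].
Proof.
move=> hi hp ip; pose e := 1%:M - p *m i.
have ee : e *m e = e.
  rewrite mulmxBl mul1mx mulmxBr mulmx1 mulmxA -(mulmxA p) ip mulmx1 subrr subr0 //.
have he : mhom T T e by rewrite mhomB ?mhom1 // (mhomM hp).
have [r [c [k [rE ck kc]]]] := idem_factor ee.
have ie : i *m e = 0 by rewrite mulmxBr mulmx1 mulmxA ip mul1mx subrr.
have ep : e *m p = 0 by rewrite mulmxBl mul1mx -mulmxA ip mulmx1 subrr.
have ke : k *m e = k by rewrite -ck mulmxA kc mul1mx.
have ec : e *m c = c by rewrite -ck -mulmxA kc mulmx1.
exists r, [ffun g => k *m T g *m c], k, c; split.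
- apply/mhomP => g; rewrite ffunE -mulmxA ck -mulmxA.
  by move/mhomP: he => ->; rewrite mulmxA ke.
- apply/mhomP => g; rewrite ffunE !mulmxA ck.
  by move/mhomP: he => <-; rewrite -mulmxA ec.
- split=> //; last by rewrite ck addrC subrK.
    by rewrite -ec mulmxA ie mul0mx.
  by rewrite -ke -mulmxA ep mulmx0.
Qed.

Lemma mdvd_complement D1 D2 (Y : md G K D1) (T : md G K D2) :
  mdvd Y T -> exists D' (S : md G K D'), miso T (osum Y S).
Proof.
move=> [i [p [hi hp ip]]].
have [D' [S [k [c [hk hc [kc ic kp E]]]]]] := split_complement hi hp ip.
exists D', S; exists (row_mx p c), (col_mx i k).
rewrite mhom_row mhom_col hi hp hk hc mul_row_col E mul_col_row ip ic kp kc.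
by rewrite -scalar_mx_block.
Qed.

Definition mindec D (T : md G K D) : Prop :=
  (0 < D)%N /\ forall e, mhom T T e -> e *m e = e -> e = 0 \/ e = 1%:M.

(** Fitting's lemma through the characteristic polynomial X^k g with g(0) nonzero. If u X^k + v g =
    1, then e = u(A) A^k is idempotent by Cayley-Hamilton. For e = 0 the power A^k vanishes; for e =
    1 the matrix [A] is invertible, also when k = 0, since 0 is then not an eigenvalue. *)
Lemma mindec_fitting D (T : md G K D) A : mindec T -> mhom T T A ->
  A \notin unitmx -> exists k, A ^+ k = 0.
Proof.
case: D T A => [|D] T A [// _ indT] hA nuA.
have [k [g + pE]] := multiplicity_XsubC (char_poly A) 0.
rewrite monic_neq0 ?char_poly_monic //= => g0; move: pE; rewrite subr0 => pE.
have /Bezout_eq1_coprimepP [[u v] /= uv1] : coprimep ('X ^+ k) g.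
  by rewrite coprimep_expl // coprimep_sym -['X]subr0 coprimep_XsubC.
pose h := horner_mx A.
have hM p q : h (p * q) = h p *m h q by rewrite /h rmorphM -mulmxE.
have hD p q : h (p + q) = h p + h q by rewrite /h rmorphD.
have hp : h (char_poly A) = 0 by apply: Cayley_Hamilton.
have hX : h ('X ^+ k) = A ^+ k by rewrite /h rmorphXn /= horner_mx_X.
pose e := h (u * 'X ^+ k).
have fE : 1%:M - e = h (v * g).
  have <- : h 1 = 1%:M by apply: (rmorph1 (horner_mx A)).
  by rewrite -uv1 hD addrAC subrr add0r.
have ef : e *m (1%:M - e) = 0.
  have E : u * 'X ^+ k * (v * g) = u * v * char_poly A by rewrite pE; ring.
  by rewrite fE -hM E hM hp mulmx0.
have ee : e *m e = e by apply/esym/eqP; rewrite -subr_eq0 -{1}[e]mulmx1 -mulmxBr ef.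
have [e0|e1] := indT e (mhom_horner _ hA) ee.
  exists k; have E : 'X ^+ k = 'X ^+ k * (u * 'X ^+ k) + v * char_poly A.
    by rewrite -{1}['X ^+ k]mulr1 -uv1 pE; ring.
  by rewrite -hX E hD (hM v) (hM _ (u * _)) hp -/e e0 !mulmx0 addr0.
case: k pE uv1 hX @e fE ef ee e1 => [|k] pE uv1 hX e fE ef ee e1.
  case/negP: nuA; have : root (char_poly A) 0 = false by rewrite pE expr0 mulr1 (negPf g0).
  rewrite -eigenvalue_root_char /eigenvalue /eigenspace raddf0 subr0.
  by rewrite kermx_eq0 row_free_unit => /negbFE.
case/negP: nuA; move: e1; rewrite /e hM hX exprSr -mulmxE mulmxA.
by move=> /mulmx1_unit [].
Qed.

Lemma mindec_iso D1 D2 (T1 : md G K D1) (T2 : md G K D2) :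
  miso T1 T2 -> mindec T1 -> mindec T2.
Proof.
move=> iso12 [D0 h]; have eD := miso_dim iso12; move: iso12; subst D2.
move=> [A [B [hA hB AB BA]]]; split=> // e he ee.
have := h (A *m e *m B); rewrite (mhomM _ hB) ?(mhomM hA) // => /(_ isT).
rewrite !mulmxA -(mulmxA (A *m e)) BA mulmx1 -(mulmxA A) ee => /(_ erefl) E.
have {E} eE : e = B *m (A *m e *m B) *m A.
  by rewrite !mulmxA BA mul1mx -mulmxA BA mulmx1.
have := h (A *m e *m B); rewrite (mhomM _ hB) ?(mhomM hA) // => /(_ isT).
rewrite !mulmxA -(mulmxA (A *m e)) BA mulmx1 -(mulmxA A) ee => /(_ erefl) [] E.
  by left; rewrite eE E mulmx0 mul0mx.
by right; rewrite eE E mulmx1 BA.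
Qed.

Lemma mdvd_indec D1 D2 (Y : md G K D1) (T : md G K D2) :
  (0 < D1)%N -> mindec T -> mdvd Y T -> miso Y T.
Proof.
move=> D10 [_ indT] [i [p [hi hp ip]]]; exists i, p; split=> //.
have pp : p *m i *m (p *m i) = p *m i by rewrite mulmxA -(mulmxA p) ip mulmx1.
have [pi0|//] := indT _ (mhomM hp hi) pp; exfalso.
have := congr1 (mulmx i) pi0; rewrite mulmxA ip mul1mx mulmx0 => i0.
move: ip; rewrite i0 mul0mx; case: (D1) D10 => // n _ /matrixP /(_ ord0 ord0).
by rewrite !mxE eqxx => /eqP; rewrite eq_sym oner_eq0.
Qed.

Lemma mdecompose D (T : md G K D) : (0 < D)%N -> ~ mindec T ->
  exists D1 D2 (T1 : md G K D1) (T2 : md G K D2),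
    [/\ miso T (osum T1 T2), (0 < D1)%N & (0 < D2)%N].
Proof.
move=> D0 /not_andP [//|/existsNP [e /not_implyP [he /not_implyP [ee /not_orP [e0 e1]]]]].
have [r [c [k [rE ck kc]]]] := idem_factor ee.
have ke : k *m e = k by rewrite -ck mulmxA kc mul1mx.
have ec : e *m c = c by rewrite -ck -mulmxA kc mulmx1.
pose Y : md G K r := [ffun g => k *m T g *m c].
have hk : mhom Y T k.
  apply/mhomP => g; rewrite ffunE -mulmxA ck -mulmxA.
  by move/mhomP: he => ->; rewrite mulmxA ke.
have hc : mhom T Y c.
  apply/mhomP => g; rewrite ffunE !mulmxA ck.
  by move/mhomP: he => <-; rewrite -mulmxA ec.
have [D' [S iS]] := mdvd_complement (ex_intro _ k (ex_intro _ c (And3 hk hc kc))).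
exists r, D', Y, S; split=> //.
  by rewrite lt0n rE mxrank_eq0; apply/eqP.
rewrite lt0n; apply/eqP => D'0; apply: e1.
have /eqP := miso_dim iS; rewrite D'0 addn0 => /eqP eD.
have : row_full e by rewrite /row_full -rE -eD.
by rewrite row_full_unit => ue; rewrite -[e]mul1mx -(mulVmx ue) -mulmxA ee.
Qed.

(** Induction along decompositions into indecomposables. The last clause admits every [T] isomorphic
    to the sum, because the dimension of [T] equals [D1 + D2] only up to a proof. *)
Lemma mdecomp_ind (P : forall D, md G K D -> Prop) :
    (forall D (T : md G K D), D = 0%N -> P D T) ->
    (forall D (T : md G K D), mindec T -> P D T) ->
    (forall D1 D2 (T1 : md G K D1) (T2 : md G K D2) D (T : md G K D),
       miso T (osum T1 T2) -> P D1 T1 -> P D2 T2 -> P D T) ->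
  forall D (T : md G K D), P D T.
Proof.
move=> P0 Pi Ps D; elim/ltn_ind: D => D IH T.
have [/P0 //|D0] := posnP D.
have [/Pi //|/(mdecompose D0) [D1 [D2 [T1 [T2 [iT D1_gt0 D2_gt0]]]]]] := pselect (mindec T).
apply: (Ps D1 D2 T1 T2) => //; apply: IH; rewrite (miso_dim iT).
  by rewrite -[ltnLHS]addn0 ltn_add2l.
by rewrite -[ltnLHS]add0n ltn_add2r.
Qed.

Lemma mdvd_sum_split D D1 D2 (T : md G K D) (T1 : md G K D1) (T2 : md G K D2) :
  mdvd T (osum T1 T2) <-> exists f1 f2 p1 p2,
    [/\ mhom T T1 f1, mhom T T2 f2, mhom T1 T p1, mhom T2 T p2 &
      f1 *m p1 + f2 *m p2 = 1%:M].
Proof.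
split=> [[i [p []]]|[f1 [f2 [p1 [p2 [hf1 hf2 hp1 hp2 E]]]]]].
  rewrite -[i]hsubmxK -[p]vsubmxK mhom_row mhom_col => /andP [? ?] /andP [? ?].
  by rewrite mul_row_col => ?; exists (lsubmx i), (rsubmx i), (usubmx p), (dsubmx p).
exists (row_mx f1 f2), (col_mx p1 p2).
by rewrite mhom_row mhom_col hf1 hf2 hp1 hp2 mul_row_col E.
Qed.

End Modules.

Definition mbase (G : finType) (K E : fieldType) (iota : {rmorphism K -> E}) D
  (T : md G K D) : md G E D := [ffun g => map_mx iota (T g)].

Lemma unitmx_gt0 (K : fieldType) D (A : 'M[K]_D) :
  (0 < D)%N -> A \in unitmx -> A != 0.
Proof.
by case: D A => // D A _ uA; apply: contraTneq uA => ->; rewrite unitmxE det0 unitr0.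
Qed.

Lemma nil_nonunit (K : fieldType) D (A : 'M[K]_D) k :
  (0 < D)%N -> A ^+ k = 0 -> A \notin unitmx.
Proof.
move=> D0 Ak; apply/negP => uA.
have : A ^+ k \in unitmx.
  elim: k {Ak} => [|k IH]; first exact: unitmx1.
  by rewrite exprS -mulmxE unitmx_mul uA.
by move/(unitmx_gt0 D0); rewrite Ak eqxx.
Qed.

Lemma nil_sub_unit (K : fieldType) D (A : 'M[K]_D) k :
  A ^+ k = 0 -> 1%:M - A \in unitmx.
Proof.
move=> Ak.
have E : (1%:M - A) *m (\sum_(i < k) A ^+ i) = 1%:M.
  by rewrite mulmxE -[1%:M]/(1 : 'M_D) -opprB mulNr -subrX1 Ak sub0r opprK.
by case: (mulmx1_unit E).
Qed.

(** * Radicals and residue fields over a finite field *)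

Section FiniteModules.
Variables (G : finType) (L : finFieldType).

Section Indecomposable.
Variables (d : nat) (X : md G L d).
Hypothesis indX : mindec X.

Lemma indec_nil A : mhom X X A -> A \notin unitmx -> exists k, A ^+ k = 0.
Proof. exact: mindec_fitting. Qed.

Lemma nonunit_mull (A B : 'M[L]_d) : A \notin unitmx -> A *m B \notin unitmx.
Proof. by rewrite unitmx_mul => /negPf ->. Qed.

Lemma nonunit_mulr (A B : 'M[L]_d) : B \notin unitmx -> A *m B \notin unitmx.
Proof. by rewrite unitmx_mul => /negPf ->; rewrite andbF. Qed.

(** End(X) is local: if U = A + B were invertible, A U^-1 would be a nonunit, hence nilpotent, and B
    U^-1 = 1 - A U^-1 would be invertible. *)
Lemma nonunitD A B : mhom X X A -> mhom X X B ->
  A \notin unitmx -> B \notin unitmx -> A + B \notin unitmx.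
Proof.
move=> hA hB nA nB; apply/negP => uAB; set U := A + B in uAB.
have hU : mhom X X (invmx U) by rewrite mhom_invmx // mhomD.
have [k Ak] := indec_nil (mhomM hA hU) (nonunit_mull _ nA).
have := nil_sub_unit Ak; rewrite -(mulmxV uAB) -mulmxBl /U addrAC subrr add0r.
by apply/negP; apply: nonunit_mull.
Qed.

(** The categorical radical of Hom(X, T): the maps that are not split embeddings. For T = X it is
    the maximal ideal of End(X). *)
Definition mrad D (T : md G L D) (f : 'M[L]_(d, D)) : bool :=
  mhom X T f && [forall p : 'M[L]_(D, d), mhom T X p ==> (f *m p \notin unitmx)].

Lemma mradP D (T : md G L D) f :
  reflect (mhom X T f /\ forall p, mhom T X p -> f *m p \notin unitmx) (mrad T f).
Proof.
apply: (iffP andP) => [[hf /forallP h]|[hf h]]; split=> //.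
  by move=> p; apply/implyP.
by apply/forallP => p; apply/implyP => /h.
Qed.

Lemma mrad0 D (T : md G L D) : mrad T 0.
Proof.
apply/mradP; split=> [|p _]; first exact: mhom0.
by rewrite mul0mx; apply: (@nil_nonunit _ _ _ 1) => //; case: indX.
Qed.

Lemma mradD D (T : md G L D) f g : mrad T f -> mrad T g -> mrad T (f + g).
Proof.
move=> /mradP [hf rf] /mradP [hg rg]; apply/mradP; split=> [|p hp]; first exact: mhomD.
by rewrite mulmxDl nonunitD ?rf ?rg // (mhomM _ hp).
Qed.

Lemma mradXX A : mrad X A = mhom X X A && (A \notin unitmx).
Proof.
apply/mradP/andP => [[hA /(_ _ (mhom1 X))]|[hA nA]]; first by rewrite mulmx1.
by split=> // p _; apply: nonunit_mull.
Qed.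

Lemma mrad_dvd D (T : md G L D) f : mhom X T f -> ~~ mrad T f -> mdvd X T.
Proof.
move=> hf; rewrite /mrad hf /= negb_forall => /existsP [p].
by rewrite negb_imply negbK => /andP [hp]; apply: mdvd_unit.
Qed.

Definition nhom D1 D2 (T1 : md G L D1) (T2 : md G L D2) : nat := #|[set A | mhom T1 T2 A]|.
Definition nrad D (T : md G L D) : nat := #|[set A | mrad T A]|.
(** The cardinal of the residue field End(X)/rad; the division is exact by Lagrange's theorem
    ([nhomXX]). *)
Definition qres : nat := (nhom X X %/ nrad X)%N.

Lemma nhom_gt0 D1 D2 (T1 : md G L D1) (T2 : md G L D2) : (0 < nhom T1 T2)%N.
Proof. by apply/card_gt0P; exists 0; rewrite inE mhom0. Qed.

Lemma nrad_gt0 D (T : md G L D) : (0 < nrad T)%N.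
Proof. by apply/card_gt0P; exists 0; rewrite inE mrad0. Qed.

Lemma nhomXX : nhom X X = (nrad X * qres)%N.
Proof.
have gH : group_set [set A | mhom X X A].
  by apply/group_setP; split=> [|A B]; rewrite !inE ?mhom0 //; apply: mhomD.
have gR : group_set [set A | mrad X A].
  by apply/group_setP; split=> [|A B]; rewrite !inE ?mrad0 //; apply: mradD.
rewrite /qres mulnC divnK //.
have sRH : [set A | mrad X A] \subset [set A | mhom X X A].
  by apply/subsetP => A; rewrite !inE => /andP [].
exact: (@cardSg _ (Group gH) (Group gR) sRH).
Qed.

Lemma qres_gt1 : (1 < qres)%N.
Proof.
rewrite -(ltn_pmul2l (nrad_gt0 X)) muln1 -nhomXX; apply: proper_card.
apply/properP; split; first by apply/subsetP => A; rewrite !inE => /andP [].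
by exists 1%:M; rewrite inE ?mhom1 // mradXX unitmx1 andbF.
Qed.

Lemma nhom_sumr D1 D2 (T1 : md G L D1) (T2 : md G L D2) D0 (T : md G L D0) :
  nhom T (osum T1 T2) = (nhom T T1 * nhom T T2)%N.
Proof.
rewrite /nhom -cardsX.
have inj : injective (fun A : 'M[L]_(D0, D1 + D2) => (lsubmx A, rsubmx A)).
  by move=> A B [e1 e2]; rewrite -[A]hsubmxK -[B]hsubmxK e1 e2.
rewrite -(card_imset _ inj).
apply: eq_card => -[A1 A2]; rewrite !inE /=; apply/imsetP/andP => [[A]|[h1 h2]].
  by rewrite inE -{1}[A]hsubmxK mhom_row => /andP [h1 h2] [-> ->].
by exists (row_mx A1 A2); rewrite ?inE ?mhom_row ?h1 // row_mxKl row_mxKr.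
Qed.

Lemma nhom_suml D1 D2 (T1 : md G L D1) (T2 : md G L D2) D0 (T : md G L D0) :
  nhom (osum T1 T2) T = (nhom T1 T * nhom T2 T)%N.
Proof.
rewrite /nhom -cardsX.
have inj : injective (fun A : 'M[L]_(D1 + D2, D0) => (usubmx A, dsubmx A)).
  by move=> A B [e1 e2]; rewrite -[A]vsubmxK -[B]vsubmxK e1 e2.
rewrite -(card_imset _ inj).
apply: eq_card => -[A1 A2]; rewrite !inE /=; apply/imsetP/andP => [[A]|[h1 h2]].
  by rewrite inE -{1}[A]vsubmxK mhom_col => /andP [h1 h2] [-> ->].
by exists (col_mx A1 A2); rewrite ?inE ?mhom_col ?h1 // col_mxKu col_mxKd.
Qed.

Lemma mrad_row D1 D2 (T1 : md G L D1) (T2 : md G L D2) f1 f2 :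
  mrad (osum T1 T2) (row_mx f1 f2) = mrad T1 f1 && mrad T2 f2.
Proof.
apply/mradP/andP => [[]|[/mradP [h1 r1] /mradP [h2 r2]]].
  rewrite mhom_row => /andP [h1 h2] r; split; apply/mradP; split=> // p hp.
    by have := r (col_mx p 0); rewrite mhom_col hp mhom0 mul_row_col mulmx0 addr0; apply.
  by have := r (col_mx 0 p); rewrite mhom_col hp mhom0 mul_row_col mulmx0 add0r; apply.
split=> [|p]; first by rewrite mhom_row h1 h2.
rewrite -[p]vsubmxK mhom_col mul_row_col => /andP [hp1 hp2].
by rewrite nonunitD ?r1 ?r2 // ?(mhomM _ hp1) ?(mhomM _ hp2).
Qed.

Lemma nrad_sum D1 D2 (T1 : md G L D1) (T2 : md G L D2) :
  nrad (osum T1 T2) = (nrad T1 * nrad T2)%N.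
Proof.
rewrite /nrad -cardsX.
have inj : injective (fun A : 'M[L]_(d, D1 + D2) => (lsubmx A, rsubmx A)).
  by move=> A B [e1 e2]; rewrite -[A]hsubmxK -[B]hsubmxK e1 e2.
rewrite -(card_imset _ inj).
apply: eq_card => -[A1 A2]; rewrite !inE /=; apply/imsetP/andP => [[A]|[h1 h2]].
  by rewrite inE -{1}[A]hsubmxK mrad_row => /andP [h1 h2] [-> ->].
by exists (row_mx A1 A2); rewrite ?inE ?mrad_row ?h1 // row_mxKl row_mxKr.
Qed.

Lemma nhom_isor D1 D2 D3 (T1 : md G L D1) (T2 : md G L D2) (T : md G L D3) :
  miso T1 T2 -> nhom T T1 = nhom T T2.
Proof.
move=> iT; have eD := miso_dim iT; subst D2; move/misoP: iT => [A uA hA].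
have inj : injective (fun f : 'M[L]_(D3, D1) => f *m A).
  by move=> f g /(congr1 (mulmx^~ (invmx A))); rewrite -!mulmxA mulmxV // !mulmx1.
rewrite /nhom -(card_imset _ inj); apply: eq_card => f; rewrite !inE.
apply/imsetP/idP => [[g]|hf]; first by rewrite inE => hg ->; apply: mhomM hA.
by exists (f *m invmx A); rewrite ?mulmxKV // inE (mhomM hf) // mhom_invmx.
Qed.

Lemma nhom_isol D1 D2 D3 (T1 : md G L D1) (T2 : md G L D2) (T : md G L D3) :
  miso T1 T2 -> nhom T1 T = nhom T2 T.
Proof.
move=> iT; have eD := miso_dim iT; subst D2; move/misoP: iT => [A uA hA].
have inj : injective (fun f : 'M[L]_(D1, D3) => A *m f).
  by move=> f g /(congr1 (mulmx (invmx A))); rewrite !mulmxA mulVmx // !mul1mx.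
rewrite /nhom -[in RHS](card_imset _ inj); apply: eq_card => f; rewrite !inE.
apply/idP/imsetP => [hf|[g]]; last by rewrite inE => hg ->; apply: mhomM hA hg.
by exists (invmx A *m f); rewrite ?mulmxA ?mulmxV ?mul1mx // inE (mhomM _ hf) // mhom_invmx.
Qed.

Lemma nrad_iso D1 D2 (T1 : md G L D1) (T2 : md G L D2) :
  miso T1 T2 -> nrad T1 = nrad T2.
Proof.
move=> iT; have eD := miso_dim iT; subst D2; move/misoP: iT => [A uA hA].
have hA' := mhom_invmx uA hA.
have inj : injective (fun f : 'M[L]_(d, D1) => f *m A).
  by move=> f g /(congr1 (mulmx^~ (invmx A))); rewrite -!mulmxA mulmxV // !mulmx1.
rewrite /nrad -(card_imset _ inj); apply: eq_card => f; rewrite !inE.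
apply/imsetP/idP => [[g]|/mradP [hf rf]].
  rewrite inE => /mradP [hg rg] ->; apply/mradP; split; first exact: mhomM hA.
  by move=> p hp; rewrite -mulmxA rg // (mhomM hA).
exists (f *m invmx A); rewrite ?mulmxKV // inE; apply/mradP.
by split=> [|p hp]; rewrite ?(mhomM hf) // -mulmxA rf // (mhomM hA').
Qed.

(** Modulo radicals, Hom(X, T) is additive in [T], has [qres X] elements when [T] is isomorphic to
    [X], and is trivial for any other indecomposable [T]. The exponent is the number of copies of
    [X] in a decomposition of [T]. *)
Lemma nhom_rad_exists D (T : md G L D) : exists m, nhom X T = (nrad T * qres ^ m)%N.
Proof.
elim/mdecomp_ind: D / T => [D T D0|D T indT|D1 D2 T1 T2 D T iT [m1 IH1] [m2 IH2]].
- exists 0%N; subst D; rewrite muln1; apply: eq_card => A.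
  by rewrite !inE [A]thinmx0 mhom0 mrad0.
- have [/existsP [f /andP [hf nf]]|/existsPn h] :=
    boolP [exists f, mhom X T f && ~~ mrad T f].
    exists 1%N; have iT := mdvd_indec indX.1 indT (mrad_dvd hf nf).
    by rewrite -(nhom_isor X iT) -(nrad_iso iT) expn1 nhomXX.
  exists 0%N; rewrite muln1; apply: eq_card => f; rewrite !inE.
  apply/idP/idP => [hf|/andP [] //].
  by have := h f; rewrite hf negbK.
- exists (m1 + m2)%N.
  by rewrite (nhom_isor _ iT) (nrad_iso iT) nhom_sumr nrad_sum IH1 IH2 expnD mulnACA.
Qed.

End Indecomposable.
End FiniteModules.

(** * Counting the ways to split off a given summand *)

Section Counting.
Variables (G : finType) (L : finFieldType).

Definition nGL D : nat := #|[set A : 'M[L]_D | A \in unitmx]|.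

Lemma nGL_gt0 D : (0 < nGL D)%N.
Proof. by apply/card_gt0P; exists 1%:M; rewrite inE unitmx1. Qed.

Definition mconj D (g : 'M[L]_D) (T : md G L D) : md G L D :=
  [ffun x => invmx g *m T x *m g].

Lemma mconj_hom D (g : 'M[L]_D) (T T' : md G L D) : g \in unitmx ->
  (mconj g T == T') = mhom T T' g.
Proof.
move=> ug; apply/eqP/mhomP => [<- x|h]; first by rewrite ffunE !mulmxA mulmxV // mul1mx.
by apply/ffunP => x; rewrite ffunE -mulmxA h mulmxA mulVmx // mul1mx.
Qed.

Definition split_pairs d D (X : md G L d) (T : md G L D) :=
  [set ip : 'M[L]_(d, D) * 'M[L]_(D, d) |
    [&& mhom X T ip.1, mhom T X ip.2 & ip.1 *m ip.2 == 1%:M]].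

Lemma split_pairsP d D (X : md G L d) (T : md G L D) i p :
  reflect [/\ mhom X T i, mhom T X p & i *m p = 1%:M] ((i, p) \in split_pairs X T).
Proof. by rewrite inE /=; apply: (iffP and3P) => -[? ? /eqP ?]; split=> //; apply/eqP. Qed.

(** Once a complement (k, c) of (i, p) in [T] is fixed, every such change of basis is
    [col_mx i (h *m k)] with [h] in GL_D, and [h] determines the complementary family: the fibre is
    a torsor under GL_D. *)
Lemma splits_fibre d D (X : md G L d) (T : md G L (d + D)) i p :
    (i, p) \in split_pairs X T ->
  #|[set Sg : md G L D * 'M[L]_(d + D) | [&& Sg.2 \in unitmx,
       mconj Sg.2 (osum X Sg.1) == T, usubmx Sg.2 == i & lsubmx (invmx Sg.2) == p]]|
    = nGL D.
Proof.
move=> /split_pairsP [hi hp ip].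
have [D' [S0 [k [c [hk hc [kc ic kp E]]]]]] := split_complement hi hp ip.
have eD : D' = D.
  apply/eqP; rewrite -(eqn_add2l d) eqn_leq.
  by rewrite (@mulmx1_dim _ _ _ (col_mx i k) (row_mx p c)) ?(@mulmx1_dim _ _ _ (row_mx p c) (col_mx i k)) //
     ?mul_row_col // mul_col_row ip ic kp kc -scalar_mx_block.
subst D'.
pose f (h : 'M[L]_D) : md G L D * 'M[L]_(d + D) :=
  ([ffun x => h *m S0 x *m invmx h], col_mx i (h *m k)).
have finj : injective f.
  move=> h1 h2 [_ /eq_col_mx [_ /(congr1 (mulmx^~ c))]].
  by rewrite -!mulmxA kc !mulmx1.
have finv h : h \in unitmx -> (f h).2 *m row_mx p (c *m invmx h) = 1%:M.
  move=> uh; rewrite mul_col_row ip -!mulmxA kp mulmx0 !mulmxA ic mul0mx.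
  by rewrite -(mulmxA h) kc mulmx1 mulmxV // -scalar_mx_block.
rewrite /nGL -(card_imset _ finj); apply: eq_card => -[S g]; rewrite inE /=.
apply/idP/imsetP => [/and4P [ug /eqP gT /eqP gi /eqP gp]|[h]].
  have hg : mhom (osum X S) T g by rewrite -mconj_hom // gT.
  have g2p : dsubmx g *m p = 0.
    rewrite -gp -[LHS]/(dsubmx g *m lsubmx (invmx g)).
    have := mulmxV ug; rewrite -{1}[g]vsubmxK -{1}[invmx g]hsubmxK mul_col_row.
    by rewrite scalar_mx_block => /eq_block_mx [].
  pose h := dsubmx g *m c.
  have g2 : dsubmx g = h *m k.
    by rewrite -[LHS]mulmx1 -E mulmxDr !mulmxA g2p mul0mx add0r.
  have gE : g = block_mx 1%:M 0 0 h *m col_mx i k.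
    by rewrite mul_block_col mul1mx !mul0mx addr0 add0r -g2 -gi vsubmxK.
  have uh : h \in unitmx.
    move: ug; rewrite gE unitmx_mul => /andP [+ _].
    by rewrite !unitmxE det_ublock det1 mul1r.
  exists h; rewrite ?inE // /f -g2 -gi vsubmxK; congr pair.
  move: hg; rewrite -[g]vsubmxK mhom_col => /andP [_ /mhomP hS].
  have E2 x : S x *m h = h *m S0 x.
    by rewrite /h mulmxA hS -!mulmxA (mhomP _ _ _ hc).
  by apply/ffunP => x; rewrite ffunE -E2 mulmxK.
rewrite inE => uh [-> ->].
have [ug _] := mulmx1_unit (finv h uh).
have gi : invmx (f h).2 = row_mx p (c *m invmx h).
  by rewrite -[RHS]mul1mx -(mulVmx ug) -mulmxA finv // mulmx1.
move: gi ug; rewrite /f /= => -> ug; rewrite ug col_mxKu row_mxKl !eqxx !andbT /=.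
rewrite mconj_hom // mhom_col hi /=; apply/mhomP => x.
by rewrite ffunE !mulmxA mulmxKV // -!mulmxA (mhomP _ _ _ hk).
Qed.

(** Both sides sum [F] of the conjugate of X + S by g over all pairs (S, g). On the right the pairs
    are grouped by the conjugate [T] and by the splitting of [X] from [T] that g induces; each fibre
    has #GL_D elements. *)
Lemma split_count d D (X : md G L d) (F : md G L (d + D) -> rat) :
    (forall g T, g \in unitmx -> F (mconj g T) = F T) ->
  \sum_(S : md G L D) (nGL (d + D))%:R * F (osum X S) =
  (nGL D)%:R * \sum_(T : md G L (d + D)) #|split_pairs X T|%:R * F T.
Proof.
move=> Fconj.
pose P (Sg : md G L D * 'M[L]_(d + D)) := Sg.2 \in unitmx.
transitivity (\sum_(Sg | P Sg) F (mconj Sg.2 (osum X Sg.1))).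
  rewrite (eq_bigl (fun Sg => xpredT Sg.1 && (Sg.2 \in unitmx))) //.
  rewrite -(pair_big xpredT (fun g => g \in unitmx) (fun S g => F (mconj g (osum X S)))) /=.
  apply: eq_bigr => S _; rewrite (eq_bigr (fun=> F (osum X S))) => [|g ug]; last exact: Fconj.
  by rewrite sumr_const /nGL cardsE mulr_natl.
pose h (Sg : md G L D * 'M[L]_(d + D)) :=
  (mconj Sg.2 (osum X Sg.1), (usubmx Sg.2, lsubmx (invmx Sg.2))).
rewrite (partition_big h (fun t => t.2 \in split_pairs X t.1)); last first.
  move=> [S g] /= ug; apply/split_pairsP.
  have hg : mhom (osum X S) (mconj g (osum X S)) g by rewrite -mconj_hom.
  have hg' := mhom_invmx ug hg.
  move: hg; rewrite -[X in mhom _ _ X]vsubmxK mhom_col => /andP [h1 _].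
  move: hg'; rewrite -[X in mhom _ _ X]hsubmxK mhom_row => /andP [h2 _]; split=> //.
  have := mulmxV ug; rewrite -{1}[g]vsubmxK -{1}[invmx g]hsubmxK mul_col_row.
  by rewrite scalar_mx_block => /eq_block_mx [].
rewrite mulr_sumr.
rewrite (eq_bigl (fun t => xpredT t.1 && (t.2 \in split_pairs X t.1))) //.
rewrite (eq_bigr (fun t => (nGL D)%:R * F t.1)); last first.
  move=> [T [i p]] /= ipT; rewrite -(splits_fibre ipT).
  rewrite (eq_bigr (fun=> F T)) => [|Sg /andP [_ /eqP [-> _]] //].
  rewrite sumr_const [RHS]mulr_natl; congr (_ *+ _).
  apply: eq_card => -[S g].
  by rewrite !inE.
rewrite -(pair_big_dep xpredT (fun T ip => ip \in split_pairs X T) (fun T ip => (nGL D)%:R * F T)) /=.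
by apply: eq_bigr => T _; rewrite sumr_const mulrCA [RHS]mulr_natl.
Qed.

End Counting.

(** * Multiplicity of an indecomposable, and the removal of one copy *)

Section Multiplicity.
Variables (G : finType) (L : finFieldType) (d : nat) (X : md G L d).
Hypothesis indX : mindec X.

Definition mmult D (T : md G L D) : nat := trunc_log (qres X) (nhom X T %/ nrad X T).

Lemma nhom_mmult D (T : md G L D) : nhom X T = (nrad X T * qres X ^ mmult T)%N.
Proof.
have [m E] := nhom_rad_exists indX T.
by rewrite /mmult E mulKn ?nrad_gt0 // trunc_expnK // (qres_gt1 indX).
Qed.

Lemma mmult_unique D (T : md G L D) m :
  nhom X T = (nrad X T * qres X ^ m)%N -> mmult T = m.
Proof.
move/eqP; rewrite nhom_mmult eqn_pmul2l ?nrad_gt0 // eqn_exp2l ?(qres_gt1 indX) //.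
by move/eqP.
Qed.

Lemma mmult_iso D1 D2 (T1 : md G L D1) (T2 : md G L D2) :
  miso T1 T2 -> mmult T1 = mmult T2.
Proof. by move=> iT; rewrite /mmult (nhom_isor X iT) (nrad_iso X iT). Qed.

Lemma mmult_sum D1 D2 (T1 : md G L D1) (T2 : md G L D2) :
  mmult (osum T1 T2) = (mmult T1 + mmult T2)%N.
Proof.
apply: mmult_unique.
by rewrite nhom_sumr nrad_sum // !nhom_mmult expnD mulnACA.
Qed.

Lemma mmultXX : mmult X = 1%N.
Proof. by apply: mmult_unique; rewrite expn1 -nhomXX. Qed.

Lemma mmult_gt0 D (T : md G L D) : (0 < mmult T)%N -> mdvd X T.
Proof.
move=> m0; have : ~~ [forall f, mhom X T f ==> mrad X T f].
  apply: contraTN m0 => /forallP h; rewrite -eqn0Ngt; apply/eqP/mmult_unique.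
  rewrite muln1; apply: eq_card => f; rewrite !inE; apply/idP/idP => [hf|/andP [] //].
  by have := h f; rewrite hf.
by rewrite negb_forall => /existsP [f]; rewrite negb_imply => /andP [hf]; apply: mrad_dvd.
Qed.

Lemma mmult_indec D (Y : md G L D) : mindec Y -> ~ miso X Y -> mmult Y = 0%N.
Proof.
move=> indY nXY; apply/eqP; rewrite eqn0Ngt; apply/negP => /mmult_gt0 dXY.
by apply: nXY; apply: mdvd_indec dXY => //; case: indX.
Qed.

Lemma mmult0 (T : md G L 0) : mmult T = 0%N.
Proof.
by apply: mmult_unique; rewrite muln1; apply: eq_card => A; rewrite !inE [A]thinmx0 mhom0 mrad0.
Qed.

Lemma card_hom_mmult D (T : md G L D) :
  (1 - (qres X)%:R^-1 ^+ mmult T) * (nhom X T)%:R = (nhom X T - nrad X T)%:R :> rat.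
Proof.
have q0 : (qres X)%:R != 0 :> rat by rewrite pnatr_eq0 -lt0n (ltn_trans _ (qres_gt1 indX)).
rewrite natrB; last by rewrite nhom_mmult leq_pmulr // expn_gt0 (ltn_trans _ (qres_gt1 indX)).
rewrite mulrBl mul1r; congr (_ - _).
by rewrite nhom_mmult natrM natrX mulrC -mulrA -exprMn divff // expr1n mulr1.
Qed.

(** For each split embedding [f] with one retraction [p0], the map (p, A) |-> p - p0 + p0 A is a
    bijection from pairs of a retraction and an endomorphism of [X] onto Hom(T, X), with A recovered
    as [f] times the image. So the number of retractions, times #End(X), is #Hom(T, X) for every
    such [f]. *)
Lemma card_splits_hom D (T : md G L D) :
  (#|split_pairs X T| * nhom X X = (nhom X T - nrad X T) * nhom T X)%N.
Proof.
have -> : (nhom X T - nrad X T = #|[set f | mhom X T f && ~~ mrad X T f]|)%N.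
  have sub : [set f | mrad X T f] \subset [set f | mhom X T f].
    by apply/subsetP => f; rewrite !inE => /andP [].
  rewrite /nhom /nrad -(setIidPr sub) -cardsD; apply: eq_card => f.
  by rewrite !inE andbC.
have -> : #|split_pairs X T| = (\sum_(f | mhom X T f && ~~ mrad X T f)
    #|[set p | mhom T X p && (f *m p == 1%:M)]|)%N.
  rewrite -sum1_card; under [RHS]eq_bigr do rewrite -sum1_card.
  rewrite pair_big_dep /=; apply: eq_bigl => -[f p]; rewrite !inE /=.
  apply/idP/idP => [/and3P [hf hp /eqP fp]|/andP [/andP [-> _] /andP [-> ->]] //].
  rewrite hf hp fp eqxx !andbT /=; apply/negP => /mradP [_ /(_ p hp)].
  by rewrite fp unitmx1.
rewrite big_distrl /= -sum1_card big_distrl /=.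
rewrite [RHS](eq_bigl (fun f => mhom X T f && ~~ mrad X T f)) => [|f]; last by rewrite inE.
apply: eq_bigr => f /andP [hf nf]; rewrite mul1n.
have [p0 [hp0 fp0]] : exists p0, mhom T X p0 /\ f *m p0 = 1%:M.
  move: nf; rewrite /mrad hf /= negb_forall => /existsP [p].
  rewrite negb_imply negbK => /andP [hp u].
  exists (p *m invmx (f *m p)); rewrite mulmxA mulmxV //; split=> //.
  by rewrite (mhomM hp) // mhom_invmx // (mhomM hf).
rewrite /nhom -cardsX.
pose phi (u : 'M[L]_(D, d) * 'M[L]_d) := u.1 - p0 + p0 *m u.2.
pose psi p := (p - p0 *m (f *m p) + p0, f *m p).
rewrite -(@card_in_imset _ _ phi); last first.
  move=> [p A] [p' A']; rewrite !inE /= => /andP [/andP [_ /eqP fp] _] /andP [/andP [_ /eqP fp'] _].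
  rewrite /phi /= => E; have := congr1 (mulmx f) E.
  rewrite !mulmxDr !mulmxN !mulmxA fp fp' fp0 subrr !add0r !mul1mx => EA.
  by move: E; rewrite EA => /addIr /addIr ->.
apply: eq_card => p; rewrite inE; apply/imsetP/idP => [[[p' A]]|hp].
  rewrite !inE /= => /andP [/andP [hp' _] hA] ->.
  by rewrite /phi mhomD ?mhomB // (mhomM hp0).
exists (psi p); last by rewrite /phi /psi /= addrK subrK.
rewrite !inE /psi /= !mulmxDr mulmxN !mulmxA fp0 mul1mx subrr add0r eqxx andbT.
by rewrite (mhomM hf hp) andbT mhomD // mhomB // -mulmxA (mhomM hp0) // (mhomM hf hp).
Qed.

Lemma card_splits D (S : md G L D) (T := osum X S) :
  #|split_pairs X T|%:R * (nhom S S)%:R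
    = (1 - (qres X)%:R^-1 ^+ mmult T) * (nhom T T)%:R :> rat.
Proof.
have n0 : (nhom X X)%:R != 0 :> rat by rewrite pnatr_eq0 -lt0n nhom_gt0.
apply: (mulIf n0); rewrite mulrAC -natrM card_splits_hom natrM -card_hom_mmult.
rewrite /T !nhom_sumr !nhom_suml !natrM.
by rewrite -!mulrA; congr (_ * _); rewrite -!natrM; congr _%:R; ring.
Qed.

Definition mwt D (T : md G L D) : rat := (nhom T T)%:R / (nGL L D)%:R.

(** This is [split_count] for the function c h(m) (1 - Q^-m) #End / #splits, with m the multiplicity
    of [X]. On T = X + S, [card_splits] reduces it to h(m(S) + 1) #End(S); on the other side #splits
    cancels. *)
Lemma peel D (c : pred (md G L (d + D))) (h : nat -> rat) :
    (forall g T, g \in unitmx -> c (mconj g T) = c T) ->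
  \sum_(S : md G L D | c (osum X S)) h (mmult S).+1 * mwt S =
  \sum_(T : md G L (d + D) | c T) h (mmult T) * (1 - (qres X)%:R^-1 ^+ mmult T) * mwt T.
Proof.
move=> cconj.
have nGL0 n : (nGL L n)%:R != 0 :> rat by rewrite pnatr_eq0 -lt0n nGL_gt0.
pose F (T : md G L (d + D)) : rat := (c T)%:R * (h (mmult T) *
  (1 - (qres X)%:R^-1 ^+ mmult T) * (nhom T T)%:R / #|split_pairs X T|%:R).
have Fc g T : g \in unitmx -> F (mconj g T) = F T.
  move=> ug; have hg : mhom T (mconj g T) g by rewrite -mconj_hom.
  have iT : miso T (mconj g T) by apply/misoP; exists g.
  rewrite /F cconj // -(mmult_iso iT) -(nhom_isol (mconj g T) iT) -(nhom_isor T iT).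
  congr (_ * (_ / _%:R)).
  have gI : injective (fun u : 'M[L]_(d, d + D) * 'M[L]_(d + D, d) => (u.1 *m g, invmx g *m u.2)).
    move=> [i p] [i' p'] [/(congr1 (mulmx^~ (invmx g))) + /(congr1 (mulmx g))].
    by rewrite !mulmxK // !mulKVmx // => -> ->.
  rewrite -[in RHS](card_imset _ gI); apply: eq_card => -[i p].
  apply/idP/imsetP => [/split_pairsP [hi hp ip]|[[i' p'] /split_pairsP [hi hp ip] [-> ->]]].
    exists (i *m invmx g, g *m p); last by rewrite /= mulmxKV // mulKmx.
    apply/split_pairsP; split; rewrite ?(mhomM hi) ?(mhomM hg) // ?mhom_invmx //.
    by rewrite mulmxA mulmxKV.
  apply/split_pairsP; split; rewrite ?(mhomM hi) // ?(mhomM _ hp) ?mhom_invmx //.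
  by rewrite mulmxA mulmxK.
have E : (\sum_S F (osum X S)) / (nGL L D)%:R =
    (\sum_T #|split_pairs X T|%:R * F T) / (nGL L (d + D))%:R.
  apply/eqP; rewrite eqr_div ?nGL0 // mulrC [X in _ == X]mulrC mulr_sumr.
  exact/eqP/split_count.
transitivity ((\sum_S F (osum X S)) / (nGL L D)%:R).
  rewrite mulr_suml big_mkcond; apply: eq_bigr => S _; rewrite /F.
  case: (c _); last by rewrite mul0r mul0r.
  have s0 : #|split_pairs X (osum X S)|%:R != 0 :> rat.
    rewrite pnatr_eq0 -lt0n; apply/card_gt0P; have [i [p ip]] := mdvd_suml X S.
    by exists (i, p); apply/split_pairsP.
  rewrite mul1r /mwt !mulrA; congr (_ / _); apply: (canRL (mulfK s0)).
  by rewrite -[LHS]mulrA [X in _ * X = _]mulrC card_splits mmult_sum mmultXX add1n !mulrA.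
rewrite E.
rewrite mulr_suml [RHS]big_mkcond; apply: eq_bigr => T _; rewrite /F.
case: (c T); last by rewrite mul0r mulr0 mul0r.
(* When [T] has no splitting the quotient by #splits is a division by 0, but then m = 0 and the
   factor 1 - Q^-m vanishes on the right as well. *)
rewrite mul1r; have [s0|s0] := eqVneq #|split_pairs X T| 0%N; last first.
  by rewrite [X in X / _ = _]mulrC divfK ?pnatr_eq0 // /mwt !mulrA.
rewrite s0 mul0r mul0r; have [->|] := posnP (mmult T).
  by rewrite expr0 subrr mulr0 mul0r.
move=> /mmult_gt0 [i [p ip]]; have : (i, p) \in split_pairs X T by apply/split_pairsP.
by rewrite (card0_eq s0).
Qed.

End Multiplicity.

(** * Locally free representations as families of operators *)

Section LocallyFree.
Variable Q : mquiver.

Definition op : finType := (vert Q + option (arrow Q))%type.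
Definition opV (i : vert Q) : op := inl i.
Definition opT : op := inr None.
Definition opA (a : arrow Q) : op := inr (Some a).

Definition agcd (a : arrow Q) := gcdn (mult (src a)) (mult (tgt a)).

(* [opV i] is the projection onto the vertex module M_i, [opT] is multiplication
   by t on each M_i, [opA a] is the structure map of the arrow a. *)
Record mrel (K : fieldType) D (T : md op K D) : Prop := MRel {
  mrelVV : forall i j, T (opV i) *m T (opV j) = if i == j then T (opV i) else 0;
  mrelV1 : \sum_i T (opV i) = 1%:M;
  mrelVT : forall i, T (opV i) *m T opT = T opT *m T (opV i);
  mrelT0 : forall i, T (opV i) *m T opT ^+ mult i = 0;
  mrelA : forall a, T (opV (src a)) *m T (opA a) *m T (opV (tgt a)) = T (opA a);
  mrelAT : forall a, T opT ^+ (mult (src a) %/ agcd a) *m T (opA a)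
                     = T (opA a) *m T opT ^+ (mult (tgt a) %/ agcd a)
}.

(* On a K[t]/(t^n)-module, t^(n-1) has rank the number of free summands K[t]/(t^n);
   the module is free when n times this rank is its dimension. *)
Definition mrk (K : fieldType) D (T : md op K D) : {ffun vert Q -> nat} :=
  [ffun i => \rank (T (opV i) *m T opT ^+ (mult i).-1)].

Definition lf (K : fieldType) D (T : md op K D) : bool :=
  `[< mrel T /\ forall i, \rank (T (opV i)) = (mult i * mrk T i)%N >].

(** One transport principle for conjugation, field extension, restriction of scalars and diagonal
    blocks. Multiplicativity is asked only on [S], since taking a corner is multiplicative on block
    diagonal matrices but not on all matrices. *)
Lemma mrel_morph (K K' : fieldType) D D' (phi : 'M[K]_D -> 'M[K']_D')
    (S : 'M[K]_D -> Prop) (T : md op K D) (T' : md op K' D') :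
    (forall g, S (T g)) -> (forall g, T' g = phi (T g)) ->
    phi 0 = 0 -> phi 1%:M = 1%:M -> {morph phi : A B / A + B} ->
    (forall A B, S A -> S B -> phi (A *m B) = phi A *m phi B) ->
    S 1%:M -> (forall A B, S A -> S B -> S (A *m B)) ->
  mrel T -> mrel T'.
Proof.
move=> ST TT phi0 phi1 phiD phiM S1 SM.
have SX A k : S A -> S (A ^+ k).
  by move=> SA; elim: k => [|k IH] //; rewrite exprS -mulmxE; apply: SM.
have phiX A k : S A -> phi (A ^+ k) = phi A ^+ k.
  move=> SA; elim: k => [|k IH] //.
  by rewrite !exprS -!mulmxE phiM ?IH //; apply: SX.
case=> VV V1 VT T0 AV AT; split=> [i j||i|i|a|a]; rewrite ?TT.
- by rewrite -phiM // VV; case: eqP.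
- rewrite -phi1 -V1 (big_morph phi phiD phi0).
  by apply: eq_bigr => i _; rewrite TT.
- by rewrite -!phiM // VT.
- by rewrite -phiX // -phiM ?T0 //; apply: SX.
- by rewrite -!phiM // ?AV //; apply: SM.
- by rewrite -!phiX // -!phiM ?AT //; apply: SX.
Qed.

Lemma block_diagX (R : pzSemiRingType) m n (A : 'M[R]_m) (B : 'M[R]_n) k :
  (block_mx A 0 0 B : 'M_(m + n)) ^+ k = block_mx (A ^+ k) 0 0 (B ^+ k).
Proof.
elim: k => [|k IH]; first by rewrite !expr0 -scalar_mx_block.
by rewrite !exprS IH -!mulmxE mulmx_block !mulmx0 !mul0mx !addr0 !add0r.
Qed.

Lemma mrel_osum (K : fieldType) D1 D2 (T1 : md op K D1) (T2 : md op K D2) :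
  mrel T1 -> mrel T2 -> mrel (osum T1 T2).
Proof.
move=> [VV V1 VT T0 AV AT] [VV' V1' VT' T0' AV' AT'].
have diagM (A A' : 'M[K]_D1) (B B' : 'M[K]_D2) :
    block_mx A 0 0 B *m block_mx A' 0 0 B' = block_mx (A *m A') 0 0 (B *m B').
  by rewrite mulmx_block !mulmx0 !mul0mx !addr0 !add0r.
split=> [i j||i|i|a|a]; rewrite ?ffunE ?block_diagX ?diagM.
- by rewrite VV VV'; case: eqP => // _; rewrite block_mx0.
- rewrite scalar_mx_block -V1 -V1'.
  rewrite (eq_bigr (fun i => block_mx (T1 (opV i)) 0 0 (T2 (opV i)))) => [|i _]; last by rewrite ffunE.
  apply: (big_ind3 (fun A B C => A = block_mx B 0 0 C)) => //.
  - by rewrite block_mx0.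
  - by move=> A A' A'' B B' B'' -> ->; rewrite add_block_mx !addr0.
- by rewrite VT VT'.
- by rewrite T0 T0' block_mx0.
- by rewrite AV AV'.
- by rewrite AT AT'.
Qed.

Lemma mrel_osum_inv (K : fieldType) D1 D2 (T1 : md op K D1) (T2 : md op K D2) :
  mrel (osum T1 T2) -> mrel T1 /\ mrel T2.
Proof.
move=> h; pose S (A : 'M[K]_(D1 + D2)) := A = block_mx (ulsubmx A) 0 0 (drsubmx A).
have SM A B : S A -> S B -> A *m B =
    block_mx (ulsubmx A *m ulsubmx B) 0 0 (drsubmx A *m drsubmx B).
  by move=> -> ->; rewrite mulmx_block !mulmx0 !mul0mx !addr0 !add0r !(block_mxKul, block_mxKdr).
have ST g : S (osum T1 T2 g) by rewrite /S ffunE !(block_mxKul, block_mxKdr).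
have S1 : S 1%:M by rewrite /S scalar_mx_block !(block_mxKul, block_mxKdr).
have SMM A B : S A -> S B -> S (A *m B).
  by move=> SA SB; rewrite /S SM // !(block_mxKul, block_mxKdr).
split.
  apply: (@mrel_morph _ _ _ _ (fun A : 'M_(D1 + D2) => ulsubmx A) S) h => //.
  - by move=> g; rewrite ffunE block_mxKul.
  - by apply/matrixP => i j; rewrite !mxE.
  - by rewrite scalar_mx_block block_mxKul.
  - by move=> A B; apply/matrixP => i j; rewrite !mxE.
  - by move=> A B SA SB; rewrite SM // block_mxKul.
apply: (@mrel_morph _ _ _ _ (fun A : 'M_(D1 + D2) => drsubmx A) S) h => //.
- by move=> g; rewrite ffunE block_mxKdr.
- by apply/matrixP => i j; rewrite !mxE.
- by rewrite scalar_mx_block block_mxKdr.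
- by move=> A B; apply/matrixP => i j; rewrite !mxE.
- by move=> A B SA SB; rewrite SM // block_mxKdr.
Qed.

(* Frobenius' inequality makes [\rank (e t^k) - \rank (e t^k.+1)] at least the
   rank of the last nonzero power. *)
Lemma mrel_rank (K : fieldType) D (T : md op K D) i :
  mrel T -> (mult i * mrk T i <= \rank (T (opV i)))%N.
Proof.
move=> [_ _ VT T0 _ _]; rewrite ffunE; set e := T (opV i); set t := T opT.
pose r k := \rank (e *m t ^+ k).
have VTk k : e *m t ^+ k = t ^+ k *m e.
  elim: k => [|k IH]; first by rewrite expr0 mulmx1 mul1mx.
  by rewrite exprS -mulmxE mulmxA VT -mulmxA IH mulmxA.
have step k : (k < mult i)%N -> (r k.+1 + r (mult i).-1 <= r k)%N.
  move=> lt_k; have := mxrank_Frobenius t (e *m t ^+ k) (t ^+ ((mult i).-1 - k)).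
  have -> : t *m (e *m t ^+ k) = e *m t ^+ k.+1 by rewrite mulmxA -VT -mulmxA exprS mulmxE.
  rewrite -!mulmxA !mulmxE -!exprD subnKC; last by rewrite -ltnS prednK // mult_gt0.
  have -> : (k.+1 + ((mult i).-1 - k) = mult i)%N.
    by rewrite addSn subnKC ?prednK ?mult_gt0 // -ltnS prednK ?mult_gt0.
  by rewrite -!mulmxE T0 mxrank0 addn0.
suff h k : (k <= mult i)%N -> (k * r (mult i).-1 + r k <= r 0)%N.
  have := h _ (leqnn _); rewrite {3}/r expr0 mulmx1; apply: leq_trans.
  exact: leq_addr.
elim: k => [|k IH] // lt_k; apply: leq_trans (IH (ltnW lt_k)).
by rewrite mulSn -addnA addnCA leq_add2l addnC step.
Qed.

Lemma mrk_osum (K : fieldType) D1 D2 (T1 : md op K D1) (T2 : md op K D2) i :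
  mrk (osum T1 T2) i = (mrk T1 i + mrk T2 i)%N.
Proof.
rewrite !ffunE block_diagX mulmx_block !mulmx0 !mul0mx !addr0 !add0r.
exact: rank_diag_block_mx.
Qed.

(** Freeness is the equality case of [mrel_rank], and both members of that inequality are additive.
    Equality for the sum therefore forces equality for each summand: summands of locally free
    families are locally free. *)
Lemma lf_osum (K : fieldType) D1 D2 (T1 : md op K D1) (T2 : md op K D2) :
  lf (osum T1 T2) = lf T1 && lf T2.
Proof.
apply/asboolP/andP => [[rT rkT]|[/asboolP [r1 rk1] /asboolP [r2 rk2]]]; last first.
  split=> [|i]; first exact: mrel_osum.
  by rewrite mrk_osum ffunE rank_diag_block_mx rk1 rk2 mulnDr.
have [r1 r2] := mrel_osum_inv rT.
have h i : \rank (T1 (opV i)) = (mult i * mrk T1 i)%N /\ \rank (T2 (opV i)) = (mult i * mrk T2 i)%N.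
  have := rkT i; rewrite mrk_osum ffunE rank_diag_block_mx mulnDr => E.
  have l1 := mrel_rank i r1; have l2 := mrel_rank i r2.
  split; apply/eqP; rewrite eqn_leq ?l1 ?l2 andbT.
    by rewrite -(leq_add2r (\rank (T2 (opV i)))) E leq_add2l.
  by rewrite -(leq_add2l (\rank (T1 (opV i)))) E leq_add2r.
by split; apply/asboolP; split=> // i; case: (h i).
Qed.

Lemma conjmxX (K : fieldType) D1 D2 (A : 'M[K]_(D1, D2)) B (t : 'M[K]_D1) k :
  A *m B = 1%:M -> B *m A = 1%:M -> (B *m t *m A) ^+ k = B *m t ^+ k *m A.
Proof.
move=> AB BA; elim: k => [|k IH]; first by rewrite !expr0 mulmx1 BA.
by rewrite !exprS IH -!mulmxE !mulmxA -(mulmxA (B *m t) A B) AB mulmx1.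
Qed.

Lemma rank_conj (K : fieldType) D1 D2 (A : 'M[K]_(D1, D2)) B (t : 'M[K]_D1) :
  A *m B = 1%:M -> B *m A = 1%:M -> \rank (B *m t *m A) = \rank t.
Proof.
move=> AB BA; apply/eqP; rewrite eqn_leq; apply/andP; split.
  exact: leq_trans (mxrankM_maxl _ _) (mxrankM_maxr _ _).
rewrite -{1}[t]mul1mx -{1}[1%:M *m t]mulmx1 -AB -!mulmxA.
apply: leq_trans (mxrankM_maxr _ _) _; rewrite !mulmxA.
exact: mxrankM_maxl.
Qed.

Lemma miso_conj (K : fieldType) D1 D2 (T1 : md op K D1) (T2 : md op K D2) :
  miso T1 T2 -> exists A B, [/\ A *m B = 1%:M, B *m A = 1%:M &
    forall g, T2 g = B *m T1 g *m A].
Proof.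
move=> [A [B [hA hB AB BA]]]; exists A, B; split=> // g.
by rewrite -mulmxA (mhomP _ _ _ hA) mulmxA BA mul1mx.
Qed.

Lemma mrk_iso (K : fieldType) D1 D2 (T1 : md op K D1) (T2 : md op K D2) :
  miso T1 T2 -> mrk T1 = mrk T2.
Proof.
move=> /miso_conj [A [B [AB BA E]]]; apply/ffunP => i; rewrite !ffunE !E conjmxX //.
by rewrite !mulmxA -(mulmxA (B *m _)) AB mulmx1 -(mulmxA B) rank_conj.
Qed.

Lemma lf_iso (K : fieldType) D1 D2 (T1 : md op K D1) (T2 : md op K D2) :
  miso T1 T2 -> lf T1 -> lf T2.
Proof.
move=> iT /asboolP [rT rkT]; have [A [B [AB BA E]]] := miso_conj iT.
apply/asboolP; split=> [|i]; last by rewrite -(mrk_iso iT) E rank_conj.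
apply: (@mrel_morph _ _ _ _ (fun t => B *m t *m A) (fun=> True)) rT => //.
- by rewrite mulmx0 mul0mx.
- by rewrite mulmx1.
- by move=> t t'; rewrite mulmxDr mulmxDl.
- by move=> t t' _ _; rewrite !mulmxA -(mulmxA (B *m t) A B) AB mulmx1.
Qed.

Lemma lf_isoE (K : fieldType) D1 D2 (T1 : md op K D1) (T2 : md op K D2) :
  miso T1 T2 -> lf T1 = lf T2.
Proof. by move=> iT; apply/idP/idP; apply: lf_iso => //; apply: miso_sym. Qed.

Lemma map_mxX (R R' : pzSemiRingType) (f : {rmorphism R -> R'}) n (A : 'M[R]_n) k :
  map_mx f (A ^+ k) = map_mx f A ^+ k.
Proof.
elim: k => [|k IH]; first by rewrite !expr0 map_mx1.
by rewrite !exprS -!mulmxE map_mxM IH.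
Qed.

Lemma mrk_map (K K' : fieldType) (f : {rmorphism K -> K'}) D (T : md op K D) :
  mrk (mbase f T) = mrk T.
Proof. by apply/ffunP => i; rewrite !ffunE -map_mxX -map_mxM mxrank_map. Qed.

Lemma lf_map (K K' : fieldType) (f : {rmorphism K -> K'}) D (T : md op K D) :
  lf T -> lf (mbase f T).
Proof.
move=> /asboolP [rT rkT]; apply/asboolP; split=> [|i]; last by rewrite mrk_map ffunE mxrank_map.
apply: (@mrel_morph _ _ _ _ (map_mx f) (fun=> True)) rT => //.
- by move=> g; rewrite ffunE.
- exact: map_mx0.
- exact: map_mx1.
- exact: map_mxD.
- by move=> A B _ _; apply: map_mxM.
Qed.

Definition dimr (r : vert Q -> nat) : nat := \sum_i mult i * r i.

(** The lower bound is Frobenius' inequality for e (A + B) f, a product that vanishes. *)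
Lemma rank_orthoD (K : fieldType) D (e f A B : 'M[K]_D) :
    e *m A = A -> e *m B = 0 -> A *m f = 0 -> B *m f = B ->
  \rank (A + B)%R = (\rank A + \rank B)%N.
Proof.
move=> eA eB Af Bf; apply/eqP; rewrite eqn_leq mxrank_add /=.
have := mxrank_Frobenius e (A + B) f.
by rewrite mulmxDr eA eB addr0 Af mxrank0 addn0 mulmxDl Af Bf add0r.
Qed.

Lemma rank_idem_sum (K : fieldType) D (T : md op K D) : mrel T ->
  (\sum_i \rank (T (opV i)))%N = D.
Proof.
move=> [VV V1 _ _ _ _].
have ee i : T (opV i) *m T (opV i) = T (opV i) by rewrite VV eqxx.
have ne i j : i != j -> T (opV i) *m T (opV j) = 0 by rewrite VV => /negPf ->.
suff h (s : seq (vert Q)) (U := \sum_(i <- s) T (opV i)) : uniq s -> U *m U = U /\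
    \rank U = (\sum_(i <- s) \rank (T (opV i)))%N.
  rewrite -[RHS](mxrank1 K) -V1 -[X in \rank X]big_enum /=.
  by have [_ ->] := h _ (enum_uniq (vert Q)); rewrite big_enum.
rewrite {}/U; elim: s => [|i s IH] /=; first by rewrite !big_nil mxrank0 mulmx0.
move=> /andP [is_ us]; rewrite !big_cons; case: (IH us) => {IH}.
have eU : T (opV i) *m \sum_(j <- s) T (opV j) = 0.
  rewrite mulmx_sumr big_seq big1 // => j js; apply: ne.
  by apply: contraNneq is_ => ->.
have Ue : (\sum_(j <- s) T (opV j)) *m T (opV i) = 0.
  rewrite mulmx_suml big_seq big1 // => j js; apply: ne.
  by apply: contraNneq is_ => <-.
move=> UU <-; split; last exact: (@rank_orthoD _ _ (T (opV i)) (\sum_(j <- s) T (opV j))).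
by rewrite mulmxDl !mulmxDr ee UU eU Ue addr0 add0r.
Qed.

Lemma lf_dim (K : fieldType) D (T : md op K D) : lf T -> D = dimr (mrk T).
Proof.
move=> /asboolP [rT rkT]; transitivity (\sum_i \rank (T (opV i)))%N.
  by rewrite rank_idem_sum.
by apply: eq_bigr => i _; rewrite rkT.
Qed.

End LocallyFree.

(** * Recursion for the weighted count *)

Section QIdentity.
Variable u : rat.
Hypothesis u_ne : forall m, (0 < m)%N -> 1 - u ^+ m != 0.

Fixpoint qcoef n : rat := if n is n'.+1 then qcoef n' / (1 - u ^+ n) else 1.

(* The logarithmic derivative of [prod_i 1 / (1 - u^i t)], coefficientwise. *)
Lemma qcoef_sum n :
  n%:R * qcoef n = \sum_(m < n) qcoef (n - m.+1) / (1 - u ^+ m.+1).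
Proof.
elim: n => [|n IH]; first by rewrite mul0r big_ord0.
have u0 := u_ne (ltn0Sn n); apply: (mulfI u0).
rewrite mulrCA [qcoef _]/= [X in _ * X = _]mulrCA divff // mulr1 mulr_sumr big_ord_recr /= subSS subnn.
rewrite [X in _ + X]mulrCA divff // mulr1.
(* With a = u^(m+1) and b = u^(n-m) this is (1 - a b) / ((1 - a) (1 - b)) = 1 / (1 - b) - 1 + 1 / (1
   - a); the first two terms telescope over m and the last reproduces the sum for n. *)
have E m : (m < n)%N -> (1 - u ^+ n.+1) * (qcoef (n.+1 - m.+1) / (1 - u ^+ m.+1)) =
    qcoef (n - m) - qcoef (n - m.+1) + qcoef (n - m.+1) / (1 - u ^+ m.+1).
  move=> ltm; have um := u_ne (ltn0Sn m).
  have [k ->] : exists k, n = (k + m).+1 by exists (n - m.+1)%N; rewrite -addnS subnK.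
  rewrite !subSS -addSn !addnK /= -addnS addnC exprD.
  have uk := u_ne (ltn0Sn k); move: (u ^+ m.+1) (u ^+ k.+1) um uk => a b a0 b0.
  by field; rewrite a0 b0.
rewrite (eq_bigr _ (fun (m : 'I_n) _ => E m (ltn_ord m))) big_split /= -IH.
have -> : \sum_(m < n) (qcoef (n - m) - qcoef (n - m.+1)) = qcoef n - 1.
  rewrite -(big_mkord xpredT (fun m => qcoef (n - m) - qcoef (n - m.+1))).
  rewrite -[LHS]opprK -sumrN; under eq_bigr do rewrite opprB.
  by rewrite (telescope_sumr (fun m => qcoef (n - m))) // subnn subn0 opprB.
by rewrite -natr1 mulrDl mul1r; ring.
Qed.

End QIdentity.

Section Recursion.
Variables (Q : mquiver) (L : finFieldType).
Notation mdL D := (md (op Q) L D).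
Implicit Types r : {ffun vert Q -> nat}.

Definition misob D (T T' : mdL D) : bool := `[< miso T T' >].
(** A representative of each isomorphism class: matrix families form a finite type, and the choice
    made by [pick] depends only on the class. Classes are then counted as fixed points of
    [mcanon]. *)
Definition mcanon D (T : mdL D) : mdL D := odflt T [pick T' | misob T T'].

Lemma mcanon_iso D (T : mdL D) : miso T (mcanon T).
Proof.
by rewrite /mcanon; case: pickP => [T' /asboolP //|/(_ T) /asboolP []]; apply: miso_refl.
Qed.

Lemma mcanon_eq D (T1 T2 : mdL D) : miso T1 T2 -> mcanon T1 = mcanon T2.
Proof.
move=> i12; rewrite /mcanon.
have E : misob T1 =1 misob T2.
  move=> T; apply/asboolP/asboolP => h; first exact: miso_trans (miso_sym i12) h.
  exact: miso_trans i12 h.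
rewrite (eq_pick E); case: pickP => // /(_ T2) /asboolP []; exact: miso_refl.
Qed.

Definition indclass D (X : mdL D) : bool := [&& lf X, `[< mindec X >] & mcanon X == X].

Lemma indclassP D (X : mdL D) :
  reflect [/\ lf X, mindec X & mcanon X = X] (indclass X).
Proof. by apply: (iffP and3P) => -[? /asboolP ? /eqP ?]; split=> //; apply/asboolP || apply/eqP. Qed.

Lemma indclass_iso D1 D2 (X1 : mdL D1) (X2 : mdL D2) (e : D1 = D2) :
  indclass X1 -> indclass X2 -> miso X1 X2 -> X2 = ecast D (mdL D) e X1.
Proof.
case: D2 / e X2 => X2 /indclassP [_ _ c1] /indclassP [_ _ c2] i12 /=.
by rewrite -[RHS]c1 -[LHS]c2; apply: mcanon_eq; apply: miso_sym.
Qed.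

Lemma tdegD (r1 r2 r3 : {ffun vert Q -> nat}) :
  (forall i, r3 i = r1 i + r2 i)%N -> tdeg r3 = (tdeg r1 + tdeg r2)%N.
Proof. by move=> h; rewrite /tdeg -big_split; apply: eq_bigr => i _; apply: h. Qed.

Lemma tdeg_mrk_gt0 D (X : mdL D) : (0 < D)%N -> lf X -> (0 < tdeg (mrk X))%N.
Proof.
move=> D0 lX; rewrite lt0n; apply: contraTneq D0 => r0.
rewrite (lf_dim lX) -eqn0Ngt /dimr big1 // => i _.
apply/eqP; rewrite muln_eq0 orbC -leqn0 -r0 /tdeg (bigD1 i) //= leq_addr //.
Qed.

(** Krull-Schmidt in the only form used: both sides are additive in [T] and agree on
    indecomposables. Any bound [B] above [D] suffices, larger modules having multiplicity 0. It
    turns multiplication by the total rank into a sum over indecomposables. *)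
Lemma total_mult D (T : mdL D) : lf T -> forall B, (D < B)%N ->
  (\sum_(d < B) \sum_(X : mdL d | indclass X) tdeg (mrk X) * mmult X T)%N = tdeg (mrk T).
Proof.
elim/mdecomp_ind: D / T => [D T D0|D T indT|D1 D2 T1 T2 D T iT IH1 IH2] lT B ltB.
- subst D; rewrite big1 => [|d _]; last first.
    by rewrite big1 // => X /indclassP [_ indX _]; rewrite mmult0 ?muln0.
  by rewrite /tdeg big1 // => i _; rewrite ffunE thinmx0 mxrank0.
- rewrite (bigD1 (Ordinal ltB)) //= (bigD1 (mcanon T)) /=; last first.
    apply/indclassP; split; [exact: lf_iso (mcanon_iso T) lT|exact: mindec_iso (mcanon_iso T) indT|].
    by apply: mcanon_eq; apply: miso_sym; apply: mcanon_iso.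
  have indC := mindec_iso (mcanon_iso T) indT.
  rewrite (mmult_iso (mcanon T) (mcanon_iso T)) mmultXX // muln1 -(mrk_iso (mcanon_iso T)).
  rewrite !big1 ?addn0 // => [d nd|X /andP [/indclassP [lX indX cX] nX]].
    rewrite big1 // => X /indclassP [lX indX cX]; rewrite mmult_indec ?muln0 //.
    by move=> /miso_dim e; case/eqP: nd; apply: val_inj.
  rewrite mmult_indec ?muln0 //.
  by move=> /mcanon_eq e; case/eqP: nX; rewrite -cX.
have := lT; rewrite (lf_isoE iT) lf_osum => /andP [lT1 lT2].
have eD := miso_dim iT.
rewrite (mrk_iso iT) (tdegD (mrk_osum T1 T2)).
rewrite -(IH1 lT1 B) ?(leq_ltn_trans _ ltB) ?eD ?leq_addr //.
rewrite -(IH2 lT2 B) ?(leq_ltn_trans _ ltB) ?eD ?leq_addl //.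
rewrite -big_split; apply: eq_bigr => d _; rewrite -big_split /=.
apply: eq_bigr => X /indclassP [_ indX _].
by rewrite (mmult_iso X iT) mmult_sum // mulnDr.
Qed.

(* By orbit-stabilizer, the sum of #End(T)/#Aut(T) over the isomorphism classes of
   locally free [T] of rank vector [r]. *)
Definition wcoef r : rat := \sum_(T : mdL (dimr r) | lf T && (mrk T == r)) mwt T.

Definition rle r s := [forall i, r i <= s i]%N.
Definition rsub r s : {ffun vert Q -> nat} := [ffun i => r i - s i]%N.
Definition rmul m r : {ffun vert Q -> nat} := [ffun i => m * r i]%N.

Section OneClass.
Variables (d : nat) (X : mdL d).
Hypotheses (indX : mindec X) (lX : lf X).
Notation rho := (mrk X).

Definition wcoefn r n : rat :=
  \sum_(T : mdL (dimr r) | [&& lf T, mrk T == r & mmult X T == n]) mwt T.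

Lemma mmult_gt0_split D (T : mdL D) : (0 < mmult X T)%N ->
  exists D' (S : mdL D'), miso T (osum X S) /\ mmult X T = (mmult X S).+1.
Proof.
move=> /(mmult_gt0 indX) /mdvd_complement [D' [S iT]]; exists D', S; split=> //.
by rewrite (mmult_iso X iT) mmult_sum // mmultXX.
Qed.

Lemma mmult_le D (T : mdL D) : lf T -> (mmult X T <= tdeg (mrk T))%N.
Proof.
have [n] := ubnP (mmult X T); elim: n D T => // n IH D T; rewrite ltnS => le_n lT.
have [->//|/mmult_gt0_split [D' [S [iT mT]]]] := posnP (mmult X T).
have := lT; rewrite (lf_isoE iT) lf_osum => /andP [_ lS].
rewrite mT (mrk_iso iT) (tdegD (mrk_osum X S)) -add1n leq_add ?IH // -?mT //.
by rewrite tdeg_mrk_gt0 //; case: indX.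
Qed.

Lemma wcoefE r M : (tdeg r < M)%N -> wcoef r = \sum_(n < M) wcoefn r n.
Proof.
move=> ltM; rewrite /wcoef /wcoefn.
rewrite (partition_big (fun T => inord (mmult X T) : 'I_M.-1.+1) xpredT) //=.
case: M ltM => // M ltM; apply: eq_bigr => n _; apply: eq_bigl => T.
rewrite -andbA; apply: andb_id2l => lT; apply: andb_id2l => /eqP rT.
rewrite -val_eqE /= inordK //; apply: leq_ltn_trans ltM.
by have := mmult_le lT; rewrite rT.
Qed.

Lemma dimrD r1 r2 r3 : (forall i, r3 i = r1 i + r2 i)%N -> dimr r3 = (dimr r1 + dimr r2)%N.
Proof.
by move=> h; rewrite /dimr -big_split; apply: eq_bigr => i _; rewrite h mulnDr.
Qed.

(** [peel] with [h] the indicator of n + 1; adding [X] shifts the rank vector by [rho] and the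
    multiplicity by 1. *)
Lemma wcoefnS r n : rle rho r ->
  wcoefn (rsub r rho) n = (1 - (qres X)%:R^-1 ^+ n.+1) * wcoefn r n.+1.
Proof.
move=> /forallP le_r.
have rE i : r i = (mrk X i + rsub r rho i)%N by rewrite [rsub _ _ _]ffunE subnKC.
have eD : dimr r = (d + dimr (rsub r rho))%N by rewrite (dimrD rE) -(lf_dim lX).
rewrite /wcoefn; move: (dimr r) eD => D ->.
pose c (T : mdL (d + dimr (rsub r rho))) := lf T && (mrk T == r).
have cc g T : g \in unitmx -> c (mconj g T) = c T.
  move=> ug; have iT : miso T (mconj g T) by apply/misoP; exists g => //; rewrite -mconj_hom.
  by rewrite /c (lf_isoE iT) (mrk_iso iT).
transitivity (\sum_(S : mdL (dimr (rsub r rho)) | c (osum X S))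
    ((mmult X S).+1 == n.+1)%:R * mwt S).
  rewrite big_mkcond [RHS]big_mkcond; apply: eq_bigr => S _; rewrite /c lf_osum lX /=.
  have -> : (mrk (osum X S) == r) = (mrk S == rsub r rho).
    apply/eqP/eqP => h; apply/ffunP => i.
      by apply/eqP; rewrite -(eqn_add2l (mrk X i)) -rE -mrk_osum h.
    by rewrite mrk_osum h rE.
  rewrite eqSS; case: (lf S) => //=; case: (mrk S == _) => //=.
  by case: eqP => _; rewrite ?mul1r ?mul0r.
rewrite (peel indX (fun m => (m == n.+1)%:R) cc) mulr_sumr big_mkcond [RHS]big_mkcond.
apply: eq_bigr => T _; rewrite /c andbA; case: (lf T && _) => //=.
by case: eqP => [->|_]; rewrite ?mul1r ?mul0r.
Qed.

Lemma wcoefn_gt r n : ~~ rle rho r -> wcoefn r n.+1 = 0.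
Proof.
move=> /negP nle; rewrite /wcoefn big1 // => T /and3P [lT /eqP rT /eqP mT].
have [|D' [S [iT _]]] := @mmult_gt0_split _ T; first by rewrite mT.
case: nle; apply/forallP => i.
by rewrite -rT (mrk_iso iT) mrk_osum leq_addr.
Qed.

Lemma qres_ne m : (0 < m)%N -> 1 - (qres X)%:R^-1 ^+ m != 0 :> rat.
Proof.
move=> m0; rewrite subr_eq0 eq_sym exprVn invr_eq1 -natrX pnatr_eq1.
by rewrite -(expn0 (qres X)) eqn_exp2l ?(qres_gt1 indX) // -lt0n.
Qed.

Lemma rsub_mulS r m : rsub (rsub r (rmul m rho)) rho = rsub r (rmul m.+1 rho).
Proof. by apply/ffunP => i; rewrite !ffunE mulSnr subnDA. Qed.

Lemma rle_mulS r m : rle (rmul m.+1 rho) r = rle (rmul m rho) r && rle rho (rsub r (rmul m rho)).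
Proof.
apply/forallP/andP => [h|[/forallP h1 /forallP h2] i].
  split; apply/forallP => i; have := h i; rewrite !ffunE mulSnr => hi.
    exact: leq_trans (leq_addr _ _) hi.
  by rewrite leq_subRL ?(leq_trans (leq_addr _ _) hi).
by have := h1 i; have := h2 i; rewrite !ffunE mulSnr => + h3; rewrite leq_subRL.
Qed.

(* w0 k is the weight of the modules [T] with [X^k + T] of rank r and [X] not
   dividing [T]. *)
Let w0 r k : rat := if rle (rmul k rho) r then wcoefn (rsub r (rmul k rho)) 0 else 0.

(** Removing [X] n times divides in turn by 1 - Q^-n, ..., 1 - Q^-1, whose product is the
    denominator of [qcoef]; what remains is the weight of the part without [X]. *)
Lemma wcoefn_w0 r j n : rle (rmul j rho) r ->
  wcoefn (rsub r (rmul j rho)) n = qcoef (qres X)%:R^-1 n * w0 r (j + n).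
Proof.
elim: n j => [|n IH] j le_j; first by rewrite addn0 /w0 le_j mul1r.
have [le1|nle1] := boolP (rle rho (rsub r (rmul j rho))); last first.
  rewrite wcoefn_gt // /w0 -addSnnS; case: ifP; rewrite ?mulr0 //.
  move=> /forallP h; case/negP: nle1; have : rle (rmul j.+1 rho) r.
    apply/forallP => i; apply: leq_trans (h i).
    by rewrite !ffunE leq_mul2r leq_addr orbT.
  by rewrite rle_mulS => /andP [].
have := wcoefnS n le1; rewrite rsub_mulS IH ?rle_mulS ?le_j // addSnnS => E.
have un := qres_ne (ltn0Sn n).
apply: (mulfI un); rewrite -E /= mulrA mulrCA divff // mulr1 //.
Qed.

(** The left side is the sum of n [qcoef] n [w0] n over the multiplicity n. Expanding n [qcoef] n by
    [qcoef_sum] singles out m + 1 copies of [X], and the sum over the remaining n - m - 1 copies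
    reassembles [wcoef]. *)
Lemma mmult_wsum r M : (tdeg r < M)%N ->
  \sum_(T : mdL (dimr r) | lf T && (mrk T == r)) (mmult X T)%:R * mwt T =
  \sum_(m < M) if rle (rmul m.+1 rho) r then
     wcoef (rsub r (rmul m.+1 rho)) / (1 - (qres X)%:R^-1 ^+ m.+1) else 0.
Proof.
move=> ltM.
have r0 : rsub r (rmul 0 rho) = r by apply/ffunP => i; rewrite !ffunE mul0n subn0.
have w00 : rle (rmul 0 rho) r by apply/forallP => i; rewrite !ffunE mul0n.
have rho0 : (0 < tdeg rho)%N by rewrite tdeg_mrk_gt0 //; case: indX.
have w0_big k : (M <= k)%N -> w0 r k = 0.
  move=> leM; rewrite /w0; case: ifP => // /forallP h.
  have : (tdeg (rmul k rho) <= tdeg r)%N by apply: leq_sum => i _; apply: h.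
  have -> : tdeg (rmul k rho) = (k * tdeg rho)%N.
    by rewrite /tdeg big_distrr; apply: eq_bigr => i _; rewrite ffunE.
  by rewrite leqNgt (leq_trans ltM) // (leq_trans leM) // leq_pmulr.
transitivity (\sum_(n < M) n%:R * wcoefn r n).
  rewrite (partition_big (fun T => inord (mmult X T) : 'I_M.-1.+1) xpredT) //=.
  case: M ltM w0_big => // M ltM _; apply: eq_bigr => n _; rewrite mulr_sumr.
  apply: eq_big => [T|T /andP [/andP [lT /eqP rT] /eqP <-]].
    rewrite -andbA; apply: andb_id2l => lT; apply: andb_id2l => /eqP rT.
    rewrite -val_eqE /= inordK //; apply: leq_ltn_trans ltM.
    by have := mmult_le lT; rewrite rT.
  by rewrite inordK // (leq_ltn_trans _ ltM) //; have := mmult_le lT; rewrite rT.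
set u := (qres X)%:R^-1.
have wr n : wcoefn r n = qcoef u n * w0 r n.
  by have := @wcoefn_w0 r 0 n w00; rewrite r0.
under eq_bigr do rewrite wr mulrA (qcoef_sum qres_ne) mulr_suml.
have step m : (if rle (rmul m.+1 rho) r then wcoef (rsub r (rmul m.+1 rho)) / (1 - u ^+ m.+1) else 0)
   = \sum_(n < M | (m < n)%N) qcoef u (n - m.+1) / (1 - u ^+ m.+1) * w0 r n.
  rewrite -[RHS](big_geq_mkord _ _ xpredT
    (fun n => qcoef u (n - m.+1) / (1 - u ^+ m.+1) * w0 r n)).
  case: ifP => [le_m|nle_m]; last first.
    rewrite big_nat big1 // => n /andP [lt_mn _]; rewrite /w0 ifF ?mulr0 //.
    apply: contraFF nle_m => /forallP h; apply/forallP => i; apply: leq_trans (h i).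
    by rewrite !ffunE leq_mul2r lt_mn orbT.
  rewrite (@wcoefE _ M); last first.
    apply: leq_ltn_trans ltM; apply: leq_sum => i _; by rewrite [rsub _ _ _]ffunE leq_subr.
  rewrite -(big_mkord xpredT (fun n => wcoefn (rsub r (rmul m.+1 rho)) n)) mulr_suml.
  rewrite [RHS](big_addn 0 M m.+1).
  rewrite [LHS](big_cat_nat (n := (M - m.+1)%N)) ?leq_subr //= -[RHS]addr0.
  congr (_ + _); last first.
    rewrite big_nat big1 // => k /andP [le_k _].
    by rewrite wcoefn_w0 // w0_big ?mulr0 ?mul0r // -leq_subLR.
  apply: eq_bigr => k _; rewrite wcoefn_w0 // addnK (addnC k).
  by rewrite mulrAC.
under [RHS]eq_bigr do rewrite step.
rewrite [RHS](exchange_big_dep xpredT) //=.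
apply: eq_bigr => n _.
rewrite -(big_ord_widen M (fun m => qcoef u (n - m.+1) / (1 - u ^+ m.+1) * w0 r n)) //.
exact: ltnW.
Qed.

End OneClass.

(** The logarithmic derivative of the left-hand series, read at t^r: [total_mult] distributes the
    total rank of [T] over the indecomposables, and [mmult_wsum] evaluates each contribution. *)
Lemma wcoef_rec r B M : (dimr r < B)%N -> (tdeg r < M)%N ->
  (tdeg r)%:R * wcoef r =
  \sum_(d < B) \sum_(X : mdL d | indclass X) \sum_(m < M)
    if rle (rmul m.+1 (mrk X)) r then
      (tdeg (mrk X))%:R * (wcoef (rsub r (rmul m.+1 (mrk X))) / (1 - (qres X)%:R^-1 ^+ m.+1))
    else 0.
Proof.
move=> ltB ltM; rewrite /wcoef mulr_sumr.
transitivity (\sum_(T : mdL (dimr r) | lf T && (mrk T == r))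
   \sum_(d < B) \sum_(X : mdL d | indclass X) (tdeg (mrk X))%:R * ((mmult X T)%:R * mwt T)).
  apply: eq_bigr => T /andP [lT /eqP rT].
  rewrite -{1}rT -(total_mult lT ltB) natr_sum mulr_suml; apply: eq_bigr => d _.
  rewrite natr_sum mulr_suml; apply: eq_bigr => X _; by rewrite natrM mulrA.
rewrite exchange_big /=; apply: eq_bigr => d _; rewrite exchange_big /=.
apply: eq_bigr => X /indclassP [lX indX _]; rewrite -mulr_sumr (mmult_wsum indX lX ltM).
by rewrite mulr_sumr; apply: eq_bigr => m _; case: ifP; rewrite ?mulr0.
Qed.

End Recursion.

Lemma map_lin_mx (K E : fieldType) (iota : {rmorphism K -> E}) m1 n1 m2 n2
    (f : {linear 'M[K]_(m1, n1) -> 'M[K]_(m2, n2)})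
    (f' : {linear 'M[E]_(m1, n1) -> 'M[E]_(m2, n2)}) :
  (forall A, map_mx iota (f A) = f' (map_mx iota A)) ->
  map_mx iota (lin_mx f) = lin_mx f'.
Proof.
move=> ff; apply/matrixP => i j; rewrite !mxE /=.
by rewrite -(map_delta_mx iota) -map_vec_mx -ff -map_mxvec mxE.
Qed.

(** * Extension of scalars *)

Section CommonKernel.
Variables (G : finType) (K : fieldType) (D1 D2 : nat).
Variables (T1 : md G K D1) (T2 : md G K D2).

(** All commutation conditions as one linear map, so that Hom(T1, T2) is the kernel of a single
    matrix over K; kernels of matrices commute with extension of scalars. *)
Definition mhom_defect (A : 'M[K]_(D1, D2)) : 'M[K]_(#|G|, D1 * D2) :=
  \matrix_k mxvec (T1 (enum_val k) *m A - A *m T2 (enum_val k)).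

Fact mhom_defect_linear : linear mhom_defect.
Proof.
move=> c A B; apply/row_matrixP => k; rewrite linearP /= !rowK -linearP /=.
congr mxvec; rewrite mulmxDr mulmxDl -scalemxAr -scalemxAl scalerBr.
by rewrite opprD addrACA.
Qed.
HB.instance Definition _ := GRing.isLinear.Build K _ _ _ mhom_defect mhom_defect_linear.

Lemma mhom_defect0 A : (mhom_defect A == 0) = mhom T1 T2 A.
Proof.
apply/eqP/mhomP => [/row_matrixP h g|h].
  have := h (enum_rank g); rewrite rowK row0 enum_rankK => /(congr1 vec_mx).
  by rewrite mxvecK linear0 => /eqP; rewrite subr_eq0 => /eqP.
by apply/row_matrixP => k; rewrite rowK row0 h subrr linear0.
Qed.

End CommonKernel.

Section BaseChangeHom.
Variables (G : finType) (K E : fieldType) (iota : {rmorphism K -> E}).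

Notation mbase := (mbase iota).

Lemma mbase_hom D1 D2 (T1 : md G K D1) (T2 : md G K D2) A :
  mhom (mbase T1) (mbase T2) (map_mx iota A) = mhom T1 T2 A.
Proof.
apply/mhomP/mhomP => h g; have := h g; rewrite !ffunE -!map_mxM; first exact: map_mx_inj.
by move=> ->.
Qed.

Lemma mbase_hom_span D1 D2 (T1 : md G K D1) (T2 : md G K D2) A :
    mhom (mbase T1) (mbase T2) A ->
  exists m (c : 'I_m -> E) (B : 'I_m -> 'M[K]_(D1, D2)),
    (forall j, mhom T1 T2 (B j)) /\ A = \sum_j c j *: map_mx iota (B j).
Proof.
rewrite -mhom_defect0 => /eqP hA.
pose M := lin_mx (mhom_defect T1 T2).
have EM : map_mx iota M = lin_mx (mhom_defect (mbase T1) (mbase T2)).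
  apply: map_lin_mx => B; apply/row_matrixP => k.
  by rewrite -map_row !rowK map_mxvec map_mxB !map_mxM !ffunE.
have : (mxvec A <= map_mx iota (kermx M))%MS.
  rewrite map_kermx EM; apply/sub_kermxP.
  by rewrite mul_vec_lin /= hA linear0.
case/submxP => w wE; exists (D1 * D2)%N, (fun j => w 0 j), (fun j => vec_mx (row j (kermx M))).
split=> [j|].
  rewrite -mhom_defect0; apply/eqP/(can_inj mxvecK).
  rewrite -mul_vec_lin vec_mxK linear0 -/M -row_mul mulmx_ker row0 //.
rewrite -[A]mxvecK wE mulmx_sum_row linear_sum; apply: eq_bigr => j _.
by rewrite linearZ /= -map_row map_vec_mx.
Qed.

Lemma mbase_osum D1 D2 (T1 : md G K D1) (T2 : md G K D2) :
  mbase (osum T1 T2) = osum (mbase T1) (mbase T2).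
Proof. by apply/ffunP => g; rewrite !ffunE map_block_mx !map_mx0. Qed.

Lemma mbase_iso D1 D2 (T1 : md G K D1) (T2 : md G K D2) :
  miso T1 T2 -> miso (mbase T1) (mbase T2).
Proof.
move=> [A [B [hA hB AB BA]]]; exists (map_mx iota A), (map_mx iota B).
by rewrite !mbase_hom -!map_mxM AB BA !map_mx1.
Qed.

End BaseChangeHom.

(* Absolute indecomposability over a perfect field: End(T) is local with
   residue field K. *)
Definition mabs (G : finType) (K : fieldType) D (T : md G K D) : Prop :=
  (0 < D)%N /\ forall A, mhom T T A -> exists c k, (A - c%:M) ^+ k = 0.

Lemma mabs_indec (G : finType) (K : fieldType) D (T : md G K D) : mabs T -> mindec T.
Proof.
move=> [D0 h]; split=> // e he ee; have [c [k nilp]] := h e he.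
have idem_nil (f : 'M[K]_D) n : f *m f = f -> f ^+ n = 0 -> f = 0.
  move=> ff; case: n => [E|n].
    by rewrite -[f]mulmx1 -[1%:M]/(1 : 'M_D) -(expr0 f) E mulmx0.
  suff -> : f ^+ n.+1 = f by [].
  by elim: n => [|n IH]; rewrite ?expr1 // exprS IH -mulmxE.
have [c0|c0] := eqVneq c 0.
  by left; apply: (idem_nil e k) => //; move: nilp; rewrite c0 raddf0 subr0.
right; apply/eqP; rewrite -subr_eq0; apply/eqP.
have e1 : (e - 1%:M) *m (e - 1%:M) = - (e - 1%:M).
  by rewrite mulmxBl mul1mx mulmxBr mulmx1 ee subrr sub0r.
(* on the image of 1 - e the operator e - c acts as - c *)
have E n : (1%:M - e) *m (e - c%:M) ^+ n = (- c) ^+ n *: (1%:M - e).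
  elim: n => [|n IH]; first by rewrite !expr0 scale1r mulmx1.
  rewrite exprSr -mulmxE mulmxA IH -scalemxAl mulmxBr.
  rewrite mulmxBl mul1mx ee subrr sub0r mul_mx_scalar.
  by rewrite -scaleNr scalerA -exprSr.
have := E k; rewrite nilp mulmx0 => /eqP; rewrite eq_sym scaler_eq0 expf_eq0 oppr_eq0.
by rewrite (negPf c0) andbF /= => /eqP E1; rewrite -opprB E1 oppr0.
Qed.

(** * The radical of an endomorphism ring after extension of scalars *)

Section NilIdeal.
Variables (G : finType) (L : finFieldType) (d : nat) (X : md G L d).
Hypothesis indX : mindec X.

Lemma mabs_finP : mabs X <-> forall A, mhom X X A -> exists c, A - c%:M \notin unitmx.
Proof.
have [d0 _] := indX; split=> [[_ h] A hA|h].
  by have [c [k /(nil_nonunit d0)]] := h A hA; exists c.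
split=> // A hA; have [c nc] := h A hA; exists c.
by apply: (indec_nil indX) => //; rewrite mhomB // mhom_scalar.
Qed.

Lemma mrad_mul A B : mrad X X A -> mhom X X B -> mrad X X (A *m B).
Proof.
rewrite !mradXX => /andP [hA nA] hB.
by rewrite (mhomM hA hB) nonunit_mull.
Qed.

Lemma mrad_mull A B : mhom X X A -> mrad X X B -> mrad X X (A *m B).
Proof.
rewrite !mradXX => hA /andP [hB nB].
by rewrite (mhomM hA hB) nonunit_mulr.
Qed.

Definition mprod (R : pzSemiRingType) n (s : seq 'M[R]_n) : 'M[R]_n := foldr mulmx 1%:M s.

Lemma mprod_cat (R : pzSemiRingType) n (s1 s2 : seq 'M[R]_n) :
  mprod (s1 ++ s2) = mprod s1 *m mprod s2.
Proof. by elim: s1 => [|A s1 IH] /=; rewrite ?mul1mx // IH mulmxA. Qed.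

(* A finite nil semigroup is nilpotent: two partial products of a long enough
   sequence coincide, and then [s = s b] with [b] nilpotent. *)
Lemma mrad_nilp (s : nat -> 'M[L]_d) : (forall i, mrad X X (s i)) ->
  mprod (mkseq s #|{: 'M[L]_d}|.+1) = 0.
Proof.
move=> rs; pose f n := mprod (mkseq s n).
have [x [y [lt_xy fxy]]] : exists x y : 'I_#|{: 'M[L]_d}|.+2, (x < y)%N /\ f x = f y.
  have /injectivePn [x [y nxy fxy]] : ~~ injectiveb (fun i : 'I_#|{: 'M[L]_d}|.+2 => f i).
    by apply/negP => /injectiveP /leq_card; rewrite card_ord ltnNge leqnSn.
  have [xy|xy|/val_inj/eqP] := ltngtP x y; last by rewrite (negPf nxy).
    by exists x, y.
  by exists y, x.
have split n m : (m <= n)%N -> f n = f m *m mprod (map s (iota m (n - m))).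
  by move=> le_mn; rewrite /f -mprod_cat /mkseq -map_cat -[X in iota X _]add0n -iotaD subnKC.
pose b := mprod (map s (iota x (y - x))).
have rb : mrad X X b.
  rewrite /b; case: (y - x)%N (subn_gt0 x y) => [|k _] /=; first by rewrite lt_xy.
  elim: k (x : nat) => [|k IH] j /=; first by rewrite mulmx1.
  by rewrite mrad_mul // -[_ *m _]/(mprod (map s (iota j.+1 k.+1))); case/andP: (IH j.+1).
have fb : f x = f x *m b by rewrite {1}fxy (split y x) // ltnW.
have [hb nb] : mhom X X b /\ b \notin unitmx by move: rb; rewrite mradXX // => /andP [].
have [k bk] := indec_nil indX hb nb.
have fx0 : f x = 0.
  have -> : f x = f x *m b ^+ k.
    elim: k {bk} => [|k IH]; first by rewrite mulmx1.
    by rewrite exprS -mulmxE mulmxA -fb.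
  by rewrite bk mulmx0.
by rewrite -/(f _) (split _ x) ?fx0 ?mul0mx // -ltnS.
Qed.

Variables (E : fieldType) (io : {rmorphism L -> E}).

(** The E-span of the radical of End(X): a nilpotent ideal of the endomorphism ring over E. *)
Definition nilspan (A : 'M[E]_d) : Prop :=
  exists m (c : 'I_m -> E) (B : 'I_m -> 'M[L]_d),
    (forall j, mrad X X (B j)) /\ A = \sum_j c j *: map_mx io (B j).

Lemma nilspan0 : nilspan 0.
Proof. by exists 0%N, (fun=> 0), (fun=> 0); split=> [[]//|]; rewrite big_ord0. Qed.

Lemma nilspan_rad B : mrad X X B -> nilspan (map_mx io B).
Proof. by exists 1%N, (fun=> 1), (fun=> B); rewrite big_ord1 scale1r. Qed.

Lemma nilspanD A B : nilspan A -> nilspan B -> nilspan (A + B).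
Proof.
move=> [m [c [F [rF ->]]]] [m' [c' [F' [rF' ->]]]].
exists (m + m')%N, (fun j => match split j with inl j => c j | inr j => c' j end),
  (fun j => match split j with inl j => F j | inr j => F' j end).
split=> [j|]; first by case: splitP => k _.
rewrite big_split_ord /=; congr (_ + _); apply: eq_bigr => j _.
  by rewrite -[lshift _ _]/(unsplit (inl j)) unsplitK.
by rewrite -[rshift _ _]/(unsplit (inr j)) unsplitK.
Qed.

Lemma nilspanZ a A : nilspan A -> nilspan (a *: A).
Proof.
move=> [m [c [F [rF ->]]]]; exists m, (fun j => a * c j), F; split=> //.
by rewrite scaler_sumr; apply: eq_bigr => j _; rewrite scalerA.
Qed.

Lemma nilspan_sum I (r : seq I) (P : pred I) (F : I -> 'M[E]_d) :
  (forall i, P i -> nilspan (F i)) -> nilspan (\sum_(i <- r | P i) F i).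
Proof. by move=> h; apply: big_ind => //; [apply: nilspan0|apply: nilspanD]. Qed.

Lemma nilspanM A B : nilspan A -> mhom (mbase io X) (mbase io X) B -> nilspan (A *m B).
Proof.
move=> [m [c [F [rF ->]]]] /mbase_hom_span [m' [c' [F' [hF' ->]]]].
rewrite mulmx_suml; apply: nilspan_sum => i _; rewrite mulmx_sumr.
apply: nilspan_sum => j _; rewrite -scalemxAl -scalemxAr scalerA -map_mxM.
by apply/nilspanZ/nilspan_rad; apply: mrad_mul.
Qed.

Lemma nilspanMl A B : mhom (mbase io X) (mbase io X) A -> nilspan B -> nilspan (A *m B).
Proof.
move=> /mbase_hom_span [m' [c' [F' [hF' ->]]]] [m [c [F [rF ->]]]].
rewrite mulmx_suml; apply: nilspan_sum => i _; rewrite mulmx_sumr.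
apply: nilspan_sum => j _; rewrite -scalemxAl -scalemxAr scalerA -map_mxM.
by apply/nilspanZ/nilspan_rad; apply: mrad_mull.
Qed.

Lemma nilspan_hom A : nilspan A -> mhom (mbase io X) (mbase io X) A.
Proof.
move=> [m [c [F [rF ->]]]]; apply: mhom_sum => j _; apply: mhomZ.
by rewrite mbase_hom; case/andP: (rF j).
Qed.

(** A power of a combination of radical elements expands into words in these elements, and
    [mrad_nilp] kills every word of the stated length. The auxiliary [E1] carries the letters
    already read as a prefix. *)
Lemma nilspan_nil A : nilspan A -> A ^+ #|{: 'M[L]_d}|.+1 = 0.
Proof.
move=> [m [c [F [rF ->]]]]; set A' := \sum_j _.
have E1 n (P : seq 'M[L]_d) : (forall s, size s = n -> all (mrad X X) s -> mprod (P ++ s) = 0) ->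
    map_mx io (mprod P) *m A' ^+ n = 0.
  elim: n P => [|n IH] P hP.
    by rewrite expr0 mulmx1; have := hP [::] erefl isT; rewrite cats0 => ->; rewrite map_mx0.
  rewrite exprS -mulmxE mulmxA /A' mulmx_sumr mulmx_suml big1 // => j _.
  rewrite -scalemxAr -scalemxAl -map_mxM.
  have -> : mprod P *m F j = mprod (P ++ [:: F j]) by rewrite mprod_cat /= mulmx1.
  rewrite -/A' IH ?scaler0 // => s ss rs; rewrite -catA; apply: hP; first by rewrite /= ss.
  by rewrite /= rF.
have := E1 #|{: 'M[L]_d}|.+1 [::]; rewrite map_mx1 mul1mx; apply=> s ss /allP rs /=.
have -> : s = mkseq (nth 0 s) #|{: 'M[L]_d}|.+1 by rewrite -ss mkseq_nth.
apply: mrad_nilp => i; have [lt_i|le_i] := ltnP i (size s); first exact: rs (mem_nth _ lt_i).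
by rewrite nth_default // mrad0.
Qed.

(** Endomorphisms over E are E-combinations of endomorphisms over L. Each of the latter differs from
    a scalar by a radical element, so the combination differs from a scalar by an element of the
    nilpotent ideal. *)
Lemma mabs_base : mabs X -> mabs (mbase io X).
Proof.
move=> absX; split=> [|A /mbase_hom_span [m [c [B [hB ->]]]]]; first by case: absX.
have /choice [b hb] : forall j, exists b, B j - b%:M \notin unitmx.
  by move=> j; apply: (mabs_finP.1 absX).
exists (\sum_j c j * io (b j)), #|{: 'M[L]_d}|.+1; apply: nilspan_nil.
rewrite raddf_sum -sumrB; apply: nilspan_sum => j _.
rewrite /= -scale_scalar_mx -scalerBr -map_scalar_mx -map_mxB.
by apply/nilspanZ/nilspan_rad; rewrite mradXX hb mhomB ?mhom_scalar.
Qed.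

End NilIdeal.

Lemma exprB_pchar (R : comNzRingType) (x y : R) n :
  [pchar R].-nat n -> (x - y) ^+ n = x ^+ n - y ^+ n.
Proof.
by move=> nn; apply/eqP; rewrite eq_sym subr_eq -GRing.exprDn_pchar // subrK.
Qed.

(** Matrices do not commute, but [A] and [c] do: the binomial identity in characteristic p is proved
    in K[X] and evaluated at [A]. *)
Lemma subX_pchar (K : fieldType) D (A : 'M[K]_D.+1) (c : K) n :
  [pchar K].-nat n -> (A - c%:M) ^+ n = A ^+ n - (c ^+ n)%:M.
Proof.
move=> nn; have nn' : [pchar {poly K}].-nat n.
  by apply: sub_in_pnat nn => p _; rewrite pchar_poly.
have hX : horner_mx A 'X^n = A ^+ n by rewrite rmorphXn /= horner_mx_X.
rewrite -{1}(horner_mx_X A) -(horner_mx_C A c) -rmorphB -rmorphXn /= exprB_pchar //.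
by rewrite rmorphB /= hX -rmorphXn /= horner_mx_C.
Qed.

Lemma subXX_pchar (K : fieldType) D (A : 'M[K]_D.+1) a b n :
  [pchar K].-nat n -> (A ^+ a - A ^+ b) ^+ n = A ^+ (a * n) - A ^+ (b * n).
Proof.
move=> nn; have nn' : [pchar {poly K}].-nat n.
  by apply: sub_in_pnat nn => p _; rewrite pchar_poly.
have hX k : horner_mx A 'X^k = A ^+ k by rewrite rmorphXn /= horner_mx_X.
by rewrite -!hX -rmorphB -rmorphXn /= exprB_pchar // -!exprM rmorphB.
Qed.

Lemma map_scalar_inv (K E : fieldType) (io : {rmorphism K -> E}) D (A : 'M[K]_D.+1) c :
  map_mx io A = c%:M -> exists2 a, A = a%:M & io a = c.
Proof.
move=> /matrixP h; have := h 0 0; rewrite !mxE eqxx mulr1n => a0.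
exists (A 0 0) => //; apply/matrixP => i j; apply: (fmorph_inj io).
by have := h i j; rewrite !mxE rmorphMn /= a0.
Qed.

Lemma pnat_card_pchar (L : finFieldType) n : [pchar L].-nat (#|L| ^ n)%N.
Proof.
have [p pr_p pL] := finPcharP L.
have [m ->] : exists m, #|L| = (p ^ m)%N by exists (logn p #|L|); apply: card_pprimeChar pL.
rewrite -expnM pnatX; apply/orP; left; rewrite pnatE //.
Qed.

(** Over C an endomorphism [A] minus one of its eigenvalues l is nilpotent, so A^n = l^n for n a
    large power of |L|. This scalar matrix has entries in L, hence equals some c in L with c^n = c,
    and (A - c)^n = A^n - c^n = 0 already over L. *)
Lemma mabs_of_closed (G : finType) (L : finFieldType) (C : closedFieldType)
    (io : {rmorphism L -> C}) d (X : md G L d) :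
  mindec (mbase io X) -> mabs X.
Proof.
case: d X => [|d] X indXC; first by case: indXC.
split=> // A hA.
have /closed_rootP [l rl] : size (char_poly (map_mx io A)) != 1%N by rewrite size_char_poly.
pose B := map_mx io A - l%:M.
have hB : mhom (mbase io X) (mbase io X) B by rewrite mhomB ?mbase_hom ?mhom_scalar.
have nB : B \notin unitmx.
  move: rl; rewrite -eigenvalue_root_char /eigenvalue /eigenspace kermx_eq0 row_free_unit //.
have [k Bk] := mindec_fitting indXC hB nB.
pose n := (#|L| ^ k)%N.
have le_kn : (k <= n)%N by apply/ltnW/ltn_expl/finNzRing_gt1.
have Bn : B ^+ n = 0 by rewrite -(subnK le_kn) exprD Bk mulr0.
have nC : [pchar C].-nat n.
  by apply: sub_in_pnat (pnat_card_pchar L k) => p _; rewrite (fmorph_pchar io).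
have : map_mx io (A ^+ n) = (l ^+ n)%:M.
  rewrite map_mxX; apply/eqP; rewrite -subr_eq0 -subX_pchar //; exact/eqP.
move/map_scalar_inv => [c Ac _].
exists c, n; rewrite subX_pchar ?pnat_card_pchar // Ac.
have -> : c ^+ n = c.
  by rewrite /n; elim: (k) => [|m IH]; rewrite ?expr1 // expnSr exprM IH expf_card.
by rewrite subrr.
Qed.

Lemma mabs_closedP (G : finType) (L : finFieldType) (C : closedFieldType)
    (io : {rmorphism L -> C}) d (X : md G L d) :
  mindec (mbase io X) <-> mabs X.
Proof.
split=> [|absX]; first exact: mabs_of_closed.
by apply: mabs_indec; apply: mabs_base => //; apply: mabs_indec.
Qed.

Lemma finfield_gen (F : finFieldType) : exists g : F, g != 0 /\
  (forall x, x != 0 -> exists k, x = g ^+ k) /\ forall k, g ^+ k = 1 -> (#|F|.-1 %| k)%N.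
Proof.
have /cyclicP [u uE] := field_unit_group_cyclic [set: {unit F}]%G.
exists (val u); split; first by rewrite -unitfE (valP u).
split=> [x x0|k uk].
  have ux : x \is a GRing.unit by rewrite unitfE.
  have : FinRing.unit F ux \in <[u]>%g by rewrite -uE inE.
  by case/cycleP => k /(congr1 val); rewrite FinRing.val_unitX => E; exists k.
rewrite -card_finField_unit /= uE -orderE order_dvdn; apply/eqP/val_inj.
by rewrite FinRing.val_unitX uk.
Qed.

(** * Splitting of indecomposables over finite extensions *)

Section ResidueField.
Variables (G : finType) (L : finFieldType) (d : nat) (X : md G L d).
Hypothesis indX : mindec X.

Definition mcong (A B : 'M[L]_d) := mrad X X (A - B).

Lemma mcong_refl A : mcong A A.
Proof. by rewrite /mcong subrr mrad0. Qed.

Lemma mradN A : mrad X X A -> mrad X X (- A).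
Proof.
by move=> rA; rewrite -[A]mulmx1 -mulmxN mrad_mul // mhomN // mhom1.
Qed.

Lemma mcong_sym A B : mcong A B -> mcong B A.
Proof. by rewrite /mcong => h; rewrite -opprB mradN. Qed.

Lemma mcong_trans A B C : mcong A B -> mcong B C -> mcong A C.
Proof.
by move=> h1 h2; have := mradD indX h1 h2; rewrite addrA subrK.
Qed.

Lemma mcongD A A' B B' : mcong A A' -> mcong B B' -> mcong (A + B) (A' + B').
Proof. by move=> h1 h2; have := mradD indX h1 h2; rewrite addrACA -opprD. Qed.

Lemma mcongN A B : mcong A B -> mcong (- A) (- B).
Proof. by rewrite /mcong => h; rewrite -opprD mradN. Qed.

Lemma mcongM A A' B B' : mhom X X A' -> mhom X X B ->
  mcong A A' -> mcong B B' -> mcong (A *m B) (A' *m B').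
Proof.
move=> hA' hB h1 h2.
have -> : A *m B = (A - A') *m B + A' *m B by rewrite mulmxBl subrK.
have := mradD indX (mrad_mul h1 hB) (mrad_mull hA' h2).
by rewrite /mcong mulmxBr addrA.
Qed.

(** A canonical representative modulo the radical: the quotient ring End(X)/rad is carried by the
    fixed points of [mrep], a finite subtype of the matrices. *)
Definition mrep (A : 'M[L]_d) : 'M[L]_d := odflt 0 [pick B | mhom X X B && mcong A B].

Lemma mrepP A : mhom X X A -> mhom X X (mrep A) /\ mcong A (mrep A).
Proof.
move=> hA; rewrite /mrep; case: pickP => [B /andP [] //|/(_ A)].
by rewrite hA mcong_refl.
Qed.

Lemma mrep_eq A B : mcong A B -> mrep A = mrep B.
Proof.
move=> AB; rewrite /mrep; congr odflt; apply: eq_pick => C.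
congr (_ && _); apply/idP/idP; apply: mcong_trans => //; exact: mcong_sym.
Qed.

Record resring := Resring { resval :> 'M[L]_d; _ : mhom X X resval && (mrep resval == resval) }.
HB.instance Definition _ := [isSub for resval].
HB.instance Definition _ := [Finite of resring by <:].

Lemma res_hom (a : resring) : mhom X X a.
Proof. by case: a => A /= /andP []. Qed.

Lemma res_rep (a : resring) : mrep a = a.
Proof. by case: a => A /= /andP [_ /eqP]. Qed.

Lemma mkres_proof A (hA : mhom X X A) : mhom X X (mrep A) && (mrep (mrep A) == mrep A).
Proof.
have [h1 h2] := mrepP hA; rewrite h1 /=; apply/eqP; apply: mrep_eq; exact: mcong_sym.
Qed.

Definition mkres A (hA : mhom X X A) : resring := Resring (mkres_proof hA).

Lemma mkresK A (hA : mhom X X A) : mcong (mkres hA) A.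
Proof. by apply: mcong_sym; case: (mrepP hA). Qed.

Lemma res_eq (a b : resring) : mcong a b -> a = b.
Proof. by move=> ab; apply: val_inj; rewrite -[LHS]res_rep -[RHS]res_rep; apply: mrep_eq. Qed.

Definition res0 := mkres (mhom0 X X).
Definition res1 := mkres (mhom1 X).
Definition resD (a b : resring) := mkres (mhomD (res_hom a) (res_hom b)).
Definition resN (a : resring) := mkres (mhomN (res_hom a)).
Definition resM (a b : resring) := mkres (mhomM (res_hom a) (res_hom b)).

Lemma cong_resD (a b : resring) A B : mcong a A -> mcong b B -> mcong (resD a b) (A + B).
Proof. by move=> aA bB; apply: mcong_trans (mkresK _) _; apply: mcongD. Qed.

Lemma cong_resM (a b : resring) A B : mhom X X A -> mcong a A -> mcong b B ->
  mcong (resM a b) (A *m B).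
Proof. by move=> hA aA bB; apply: mcong_trans (mkresK _) _; apply: mcongM => //; apply: res_hom. Qed.

Lemma res_eq2 A (a b : resring) : mcong a A -> mcong b A -> a = b.
Proof. by move=> aA bA; apply: res_eq; apply: mcong_trans aA (mcong_sym bA). Qed.

Local Hint Resolve mcong_refl res_hom : core.

Fact resDA : associative resD.
Proof.
move=> a b c; apply: (@res_eq2 (resval a + (resval b + resval c))).
  by do 2!apply: cong_resD => //.
by rewrite addrA; do 2!apply: cong_resD => //.
Qed.
Fact resDC : commutative resD.
Proof. by move=> a b; apply: val_inj; rewrite /= addrC. Qed.
Fact res0D : left_id res0 resD.
Proof.
move=> a; apply: (@res_eq2 (0 + resval a)); last by rewrite add0r.
by apply: cong_resD => //; apply: mkresK.
Qed.
Fact resND : left_inverse res0 resN resD.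
Proof.
move=> a; apply: (@res_eq2 (- resval a + resval a)).
  by apply: cong_resD => //; apply: mkresK.
by rewrite addNr; apply: mkresK.
Qed.
HB.instance Definition _ := GRing.isZmodule.Build resring resDA resDC res0D resND.

Fact resMA : associative resM.
Proof.
move=> a b c; apply: (@res_eq2 (resval a *m (resval b *m resval c))).
  by do 2!apply: cong_resM => //.
rewrite mulmxA; apply: cong_resM => //; first exact: mhomM.
exact: cong_resM.
Qed.
Fact res1M : left_id res1 resM.
Proof.
move=> a; apply: (@res_eq2 (1%:M *m resval a)); last by rewrite mul1mx.
by apply: cong_resM => //; [apply: mhom1|apply: mkresK].
Qed.
Fact resM1 : right_id res1 resM.
Proof.
move=> a; apply: (@res_eq2 (resval a *m 1%:M)); last by rewrite mulmx1.
by apply: cong_resM => //; apply: mkresK.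
Qed.
Fact resMDl : left_distributive resM resD.
Proof.
move=> a b c; apply: (@res_eq2 ((resval a + resval b) *m resval c)).
  by apply: cong_resM => //; [apply: mhomD|apply: cong_resD].
by rewrite mulmxDl; apply: cong_resD; apply: cong_resM.
Qed.
Fact resMDr : right_distributive resM resD.
Proof.
move=> a b c; apply: (@res_eq2 (resval a *m (resval b + resval c))).
  by apply: cong_resM => //; apply: cong_resD.
by rewrite mulmxDr; apply: cong_resD; apply: cong_resM.
Qed.
Fact res1_neq0 : res1 != 0.
Proof.
apply/eqP => E; have : mcong 1%:M 0.
  apply: mcong_trans (mcong_sym (mkresK (mhom1 X))) _; rewrite -/res1 E.
  exact: mkresK.
by rewrite /mcong subr0 mradXX unitmx1 andbF.
Qed.
HB.instance Definition _ := GRing.Zmodule_isNzRing.Build resring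
  resMA res1M resM1 resMDl resMDr res1_neq0.
HB.instance Definition _ := FinRing.isNzRing.Build resring.

Lemma mcong0 A : mcong A 0 = mrad X X A.
Proof. by rewrite /mcong subr0. Qed.

Fact res_domain : GRing.integral_domain_axiom resring.
Proof.
move=> a b ab0; have : mcong (a *m b) 0.
  apply: mcong_trans (mcong_sym (cong_resM (res_hom a) (mcong_refl a) (mcong_refl b))) _.
  by rewrite -[resM a b]/(a * b) ab0; apply: mkresK.
rewrite mcong0 mradXX unitmx_mul => /andP [_]; rewrite negb_and => /orP [] nu.
  apply/orP; left; apply/eqP/res_eq; apply: mcong_trans (mcong_sym (mkresK (mhom0 X X))).
  by rewrite mcong0 mradXX res_hom.
apply/orP; right; apply/eqP/res_eq; apply: mcong_trans (mcong_sym (mkresK (mhom0 X X))).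
by rewrite mcong0 mradXX res_hom.
Qed.

(* Wedderburn: End(X)/rad is a finite field, so its nonzero elements are the
   powers of one of them. *)
Lemma residue_generator : exists A, mhom X X A /\ A \in unitmx /\
  (forall B, mhom X X B -> mrad X X (B ^+ qres X - B)) /\
  (forall B, mhom X X B -> B \in unitmx -> exists k, mrad X X (B - A ^+ k)) /\
  (forall k, mrad X X (A ^+ k - 1%:M) -> ((qres X).-1 %| k)%N).
Proof.
pose F := FinDomainFieldType res_domain.
have [a [a0 [ha oa]]] := @finfield_gen F.
have XE (b : F) k : mcong (b ^+ k : F) ((b : 'M_d) ^+ k).
  elim: k => [|k IH]; first exact: mkresK.
  by rewrite exprS [X in mcong _ X]exprS -mulmxE; apply: cong_resM => //; apply: res_hom.
have card_res : #|F| = qres X.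
  rewrite /qres -[nhom X X]/#|[set B | mhom X X B]|.
  (* Each endomorphism is in a unique way a chosen representative plus a radical element. *)
  have -> : #|[set B | mhom X X B]| = (#|F| * nrad X X)%N.
    have fI : injective (fun u : resring * {B | mrad X X B} => resval u.1 + sval u.2).
      move=> [b [n rn]] [c [m rm]] /= E.
      have bc : b = c.
        apply: res_eq; rewrite /mcong.
        have -> : resval b - resval c = m - n.
          by apply/eqP; rewrite subr_eq addrAC -subr_eq opprK E addrC.
        by apply: mradD => //; apply: mradN.
      move: E; rewrite bc => /addrI E; subst m; congr (_, exist _ _ _).
      exact: bool_irrelevance.
    have -> : nrad X X = #|{: {B | mrad X X B}}| by rewrite card_sig; apply: eq_card => B; rewrite inE.
    rewrite -[#|F|]/#|{: resring}| -card_prod -(card_codom fI); apply: eq_card => B; rewrite inE.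
    apply/idP/codomP => [hB|[[b [n rn]] /= ->]].
      have rn : mrad X X (B - resval (mkres hB)) := mcong_sym (mkresK hB).
      by exists (mkres hB, exist (fun n => mrad X X n) _ rn); rewrite /= addrC subrK.
    by apply: mhomD => //; case/andP: rn.
  by rewrite mulnK // nrad_gt0.
have unit_res (b : F) : b != 0 -> resval b \in unitmx.
  apply: contraNT => nb; apply/eqP/(@res_eq2 0); last exact: mkresK.
  by rewrite mcong0 mradXX nb andbT.
exists (resval (a : resring)); split=> //; split; first exact: unit_res.
split=> [B hB|].
  have BX k : mcong (B ^+ k) ((mkres hB : F) ^+ k).
    elim: k => [|k IH]; first by apply: mcong_sym; apply: mkresK.
    rewrite exprS [in X in mcong _ X]exprS -mulmxE; apply: mcong_sym.
    by apply: cong_resM => //; [apply: mkresK|apply: mcong_sym].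
  rewrite -/(mcong _ _); apply: mcong_trans (BX _) _.
  by rewrite -card_res expf_card; apply: mkresK.
split=> [B hB uB|k rk].
  have b0 : (mkres hB : F) != 0.
    apply/eqP => E; have : mcong B 0.
      apply: mcong_trans (mcong_sym (mkresK hB)) _; rewrite E; exact: mkresK.
    by rewrite mcong0 mradXX uB andbF.
  have [k bE] := ha _ b0; exists k.
  rewrite -/(mcong _ _); apply: mcong_trans (mcong_sym (mkresK hB)) _.
  by rewrite bE; apply: XE.
rewrite -card_res; apply: oa; apply: (@res_eq2 1%:M); last exact: mkresK.
exact: mcong_trans (XE a k) _.
Qed.

End ResidueField.

(** * Lifting the residue field into the endomorphism ring *)

Section Teichmuller.
Variables (G : finType) (L : finFieldType) (d : nat) (X : md G L d.+1).
Hypothesis indX : mindec X.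
Notation Q := (qres X).

Lemma pnat_qres : [pchar L].-nat Q.
Proof.
have dvdQ : (Q %| #|{: 'M[L]_d.+1}|)%N.
  apply: (@dvdn_trans (nhom X X)); first by rewrite nhomXX // dvdn_mull.
  have gH : group_set [set A | mhom X X A].
    by apply/group_setP; split=> [|A B]; rewrite !inE ?mhom0 //; apply: mhomD.
  rewrite -cardsT; exact: (@cardSg _ [set: 'M[L]_d.+1]%G (Group gH) (subsetT _)).
by apply: pnat_dvd dvdQ _; rewrite card_mx pnat_card_pchar.
Qed.

Lemma mcong_exp A B k : mhom X X A -> mhom X X B ->
  mcong X A B -> mcong X (A ^+ k) (B ^+ k).
Proof.
move=> hA hB AB; elim: k => [|k IH]; first exact: mcong_refl.
by rewrite !exprS -!mulmxE mcongM // mhomX.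
Qed.

(** Let [A] generate the residue field. A^Q - A is nilpotent, so with n = Q^m large, A^(nQ) - A^n =
    (A^Q - A)^n = 0: th = A^n is fixed by the Q-th power, and it is congruent to [A] because A^Q
    is. *)
Lemma teichmuller : exists th : 'M[L]_d.+1, [/\ mhom X X th, th \in unitmx, th ^+ Q = th,
  (forall B, mhom X X B -> exists p : {poly L}, mrad X X (B - horner_mx th p)) &
  (forall k, mrad X X (th ^+ k - 1%:M) -> (Q.-1 %| k)%N)].
Proof.
have [A [hA [uA [frobA [genA ordA]]]]] := residue_generator indX.
have Q1 := qres_gt1 indX.
have hN : mhom X X (A ^+ Q - A) by rewrite mhomB // mhomX.
have [m Nm] : exists m, (A ^+ Q - A) ^+ m = 0.
  by apply: (indec_nil indX) => //; have := frobA A hA; rewrite mradXX => /andP [].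
pose n := (Q ^ m)%N.
have nn : [pchar L].-nat n by rewrite pnatX pnat_qres.
have Qth : (A ^+ n) ^+ Q = A ^+ n.
  have le_mn : (m <= n)%N by apply/ltnW/ltn_expl.
  have Nn : (A ^+ Q - A ^+ 1) ^+ n = 0 by rewrite expr1 -(subnK le_mn) exprD Nm mulr0.
  apply/eqP; rewrite -subr_eq0 -Nn subXX_pchar // mul1n.
  by rewrite -exprM mulnC.
have AQ k : mcong X (A ^+ (Q ^ k)) A.
  elim: k => [|k IH]; first by rewrite expr1 mcong_refl.
  apply: (mcong_trans indX _ IH); rewrite expnSr exprM.
  by apply: frobA; rewrite mhomX.
have thX k : mcong X ((A ^+ n) ^+ k) (A ^+ k) by apply: mcong_exp; rewrite ?mhomX //; apply: AQ.
have hth : mhom X X (A ^+ n) by rewrite mhomX.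
exists (A ^+ n); split=> //.
- by elim: (n) => [|k IH]; rewrite ?unitmx1 // exprS -mulmxE unitmx_mul uA.
- move=> B hB; have [uB|nB] := boolP (B \in unitmx); last first.
    by exists 0; rewrite rmorph0 subr0 mradXX hB.
  have [k Bk] := genA B hB uB; exists 'X^k; rewrite rmorphXn /= horner_mx_X.
  exact: (mcong_trans indX Bk (mcong_sym (thX k))).
- move=> k rk; apply: ordA; exact: (mcong_trans indX (mcong_sym (thX k)) rk).
Qed.

Variable th : 'M[L]_d.+1.
Hypotheses (hth : mhom X X th) (thQ : th ^+ Q = th).

Lemma scalar_Q (c : L) : c ^+ Q = c.
Proof.
have [A [_ [_ [frobA _]]]] := residue_generator indX.
have := frobA c%:M (mhom_scalar X c).
have -> : (c%:M : 'M[L]_d.+1) ^+ Q = (c ^+ Q)%:M by rewrite -rmorphXn.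
rewrite -raddfB mradXX => /andP [_]; rewrite unitmxE det_scalar unitfE expf_eq0 /=.
by rewrite negbK subr_eq0 => /eqP.
Qed.

Lemma horner_Q (p : {poly L}) : (horner_mx th p) ^+ Q = horner_mx th p.
Proof.
have nn : [pchar {poly L}].-nat Q by apply: sub_in_pnat pnat_qres => p' _; rewrite pchar_poly.
rewrite -rmorphXn; elim/poly_ind: p => [|p c IH].
  by rewrite expr0n eqn0Ngt (ltn_trans _ (qres_gt1 indX)).
rewrite GRing.exprDn_pchar // exprMn -rmorphXn scalar_Q !rmorphD !rmorphM IH /=.
by rewrite rmorphXn /= horner_mx_X thQ.
Qed.

(** The Q-th power fixes every element of L[th], so a nilpotent one is 0: L[th] meets the radical
    trivially. *)
Lemma horner_rad0 (p : {poly L}) : mrad X X (horner_mx th p) -> horner_mx th p = 0.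
Proof.
rewrite mradXX => /andP [hp np]; have [m pm] := indec_nil indX hp np.
have E k : horner_mx th p ^+ (Q ^ k) = horner_mx th p.
  by elim: k => [|k IH]; rewrite ?expr1 // expnSr exprM IH horner_Q.
have le_m : (m <= Q ^ m)%N by apply/ltnW/ltn_expl/(qres_gt1 indX).
by rewrite -(E m) -(subnK le_m) exprD pm mulr0.
Qed.

Hypothesis genth : forall B, mhom X X B -> exists p : {poly L}, mrad X X (B - horner_mx th p).

(** End(X) is the direct sum of L[th] and the radical; [f] is this decomposition, L[th] being
    described by the remainders modulo the minimal polynomial of [th]. *)
Lemma qres_degree : Q = (#|L| ^ degree_mxminpoly th)%N.
Proof.
set dg := degree_mxminpoly th.
pose f (u : 'rV[L]_dg * {B | mrad X X B}) := horner_mx th (rVpoly u.1) + sval u.2.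
have fI : injective f.
  move=> [u [n rn]] [v [m rm]]; rewrite /f /= => E.
  have : mrad X X (horner_mx th (rVpoly (u - v))).
    have -> : horner_mx th (rVpoly (u - v)) = m - n.
      rewrite !linearB /=; apply/eqP; rewrite subr_eq addrAC -subr_eq opprK.
      by rewrite E addrC.
    by rewrite -/(mcong X m n); apply: mradD => //; apply: mradN.
  move=> /horner_rad0 uv0.
  have uv : u = v.
    apply/eqP; rewrite -subr_eq0; apply/eqP/(can_inj rVpolyK); rewrite linear0.
    apply/eqP; apply: contraTT (mxminpoly_min uv0) => nz.
    apply/negP => /(dvdp_leq nz); rewrite size_mxminpoly leqNgt ltnS size_poly //.
  move: E; rewrite uv => /addrI E; subst m; congr (_, exist _ _ _).
  exact: bool_irrelevance.
have card_rad : nrad X X = #|{: {B | mrad X X B}}| by rewrite card_sig; apply: eq_card => B; rewrite inE.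
apply/eqP; rewrite -(eqn_pmul2l (nrad_gt0 indX X)) -nhomXX //.
have -> : (#|L| ^ dg)%N = #|{: 'rV[L]_dg}| by rewrite card_mx mul1n.
rewrite card_rad mulnC -card_prod -(card_codom fI); apply/eqP/eq_card => B; rewrite inE.
apply/idP/codomP => [hB|[[u [n rn]] ->]]; last first.
  by apply: mhomD; [apply: mhom_horner|case/andP: (rn)].
have [p rp] := genth hB; pose v := poly_rV (p %% mxminpoly th) : 'rV[L]_dg.
have pv : horner_mx th (rVpoly v) = horner_mx th p.
  rewrite poly_rV_K; last first.
    by rewrite -ltnS -size_mxminpoly ltn_modp monic_neq0 // mxminpoly_monic.
  rewrite {2}(divp_eq p (mxminpoly th)) rmorphD rmorphM /=.
  by rewrite mx_root_minpoly mulr0 add0r.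
exists (v, exist (fun n => mrad X X n) _ rp).
by rewrite /f /= pv addrC subrK.
Qed.

End Teichmuller.

Lemma pnat_card_ext (L E : finFieldType) (io : {rmorphism L -> E}) n : [pchar E].-nat (#|L| ^ n)%N.
Proof. by apply: sub_in_pnat (pnat_card_pchar L n) => p _; rewrite (fmorph_pchar io). Qed.

(** * The Frobenius of an extension, and eigenprojections *)

Section RelativeFrobenius.
Variables (L E : finFieldType) (io : {rmorphism L -> E}).

(** The embedding is an argument so that additivity, which relies on it to make |L| a power of the
    characteristic of E, can be attached to [frob io] as a structure. *)
Definition frob of {rmorphism L -> E} := fun x : E => x ^+ #|L|.

Fact frob_additive : zmod_morphism (frob io).
Proof.
by move=> x y; rewrite /frob exprB_pchar // -[#|L|]expn1 (pnat_card_ext io).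
Qed.
Fact frob_multiplicative : monoid_morphism (frob io).
Proof. by split=> [|x y]; rewrite /frob ?expr1n ?exprMn. Qed.
HB.instance Definition _ := GRing.isZmodMorphism.Build E E (frob io) frob_additive.
HB.instance Definition _ := GRing.isMonoidMorphism.Build E E (frob io) frob_multiplicative.

Lemma frob_base a : frob io (io a) = io a.
Proof. by rewrite /frob -rmorphXn expf_card. Qed.

End RelativeFrobenius.

Section Eigenidempotents.
Variables (E : finFieldType) (D : nat) (t : 'M[E]_D.+1).
Hypothesis tE : t ^+ #|E| = t.

(* Lagrange interpolation on the elements of [E]: the projection onto the
   [x]-eigenspace of [t]. *)
Definition eidem (x : E) : 'M[E]_D.+1 := 1%:M - (t - x%:M) ^+ #|E|.-1.

Lemma eidem_eig x : t *m eidem x = x *: eidem x.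
Proof.
have q0 : (0 < #|E|)%N by apply/ltnW/finNzRing_gt1.
have E0 : (t - x%:M) *m (t - x%:M) ^+ #|E|.-1 = t - x%:M.
  rewrite mulmxE -exprS prednK // subX_pchar ?tE ?expf_card //.
  by have := pnat_card_pchar E 1; rewrite expn1.
apply/eqP; rewrite -subr_eq0 -mul_scalar_mx -mulmxBl /eidem mulmxBr mulmx1 E0.
by rewrite subrr.
Qed.

Lemma eidem_comm x A : A *m t = t *m A -> A *m eidem x = eidem x *m A.
Proof.
move=> At; rewrite mulmxBr mulmxBl mulmx1 mul1mx; congr (_ - _).
have AB : A *m (t - x%:M) = (t - x%:M) *m A.
  by rewrite mulmxBr mulmxBl At mul_mx_scalar mul_scalar_mx.
elim: (_.-1) => [|k IH]; first by rewrite expr0 mulmx1 mul1mx.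
by rewrite exprS -mulmxE mulmxA AB -mulmxA IH mulmxA.
Qed.

Lemma eidem_horner x (p : {poly E}) : horner_mx t p *m eidem x = p.[x] *: eidem x.
Proof.
elim/poly_ind: p => [|p c IH]; first by rewrite rmorph0 mul0mx horner0 scale0r.
rewrite rmorphD rmorphM /= horner_mx_X horner_mx_C hornerMXaddC.
rewrite mulmxDl -mulmxE -mulmxA eidem_eig -scalemxAr IH scalerA mulrC mul_scalar_mx.
by rewrite -scalerDl.
Qed.

Lemma eidem_poly x : eidem x = horner_mx t (1 - ('X - x%:P) ^+ #|E|.-1).
Proof. by rewrite rmorphB rmorph1 rmorphXn rmorphB /= horner_mx_X horner_mx_C. Qed.

Lemma eidem_hornerE (x y : E) :
  (1 - ('X - y%:P) ^+ #|E|.-1).[x] = (x == y)%:R.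
Proof.
rewrite !hornerE; have [->|nxy] := eqVneq x y.
  rewrite subrr expr0n -subn1 subn_eq0 leqNgt finNzRing_gt1 subr0 //.
have nz : x - y != 0 by rewrite subr_eq0.
rewrite -[X in 1 - X](mulfK nz) -exprSr prednK ?expf_card ?divff ?subrr //.
exact/ltnW/finNzRing_gt1.
Qed.

Lemma eidemM x y : eidem x *m eidem y = if x == y then eidem x else 0.
Proof.
rewrite {1}eidem_poly eidem_horner eidem_hornerE eq_sym.
by case: eqP => [->|]; rewrite ?scale1r ?scale0r.
Qed.

(** The interpolation polynomial minus 1 vanishes at all |E| elements of E and has degree below
    |E|. *)
Lemma eidem_sum : \sum_x eidem x = 1%:M.
Proof.
pose P : {poly E} := \sum_y (1 - ('X - y%:P) ^+ #|E|.-1).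
have -> : \sum_x eidem x = horner_mx t P.
  by rewrite rmorph_sum; apply: eq_bigr => x _; apply: eidem_poly.
have -> : P = 1; last exact: rmorph1.
apply/eqP; rewrite -subr_eq0; apply/eqP/(@roots_geq_poly_eq0 _ _ (enum E)).
- apply/allP => x _; rewrite rootE !hornerE horner_sum (bigD1 x) //= eidem_hornerE eqxx.
  rewrite big1 ?addr0 ?subrr // => y nyx.
  by rewrite eidem_hornerE eq_sym (negPf nyx).
- exact: enum_uniq.
rewrite -cardE; have q1 := finNzRing_gt1 E.
rewrite (leq_trans (size_polyD _ _)) // geq_max size_polyN size_poly1 (ltnW q1) andbT.
apply: (leq_trans (size_sum _ _ _)); apply/bigmax_leqP => y _.
rewrite (leq_trans (size_polyD _ _)) // geq_max size_polyN size_poly1 (ltnW q1) /=.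
by rewrite size_exp_XsubC prednK // ltnW.
Qed.

Lemma rank_eidem_sum U : U *m t = t *m U ->
  \rank U = (\sum_x \rank (eidem x *m U))%N.
Proof.
move=> Ut; have Ue x : U *m eidem x = eidem x *m U by apply: eidem_comm.
suff h (s : seq E) : uniq s -> \rank (\sum_(x <- s) eidem x *m U)%R =
    (\sum_(x <- s) \rank (eidem x *m U))%N.
  have := h _ (enum_uniq E); rewrite !big_enum => <-.
  by rewrite -mulmx_suml eidem_sum mul1mx.
elim: s => [|x s IH] /=; first by rewrite !big_nil mxrank0.
move=> /andP [xs us]; rewrite !big_cons -IH //.
have ne y : y \in s -> x != y by apply: contraTneq => <-.
apply: (@rank_orthoD _ _ (eidem x) (\sum_(y <- s) eidem y)).
- by rewrite mulmxA eidemM eqxx.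
- rewrite mulmx_sumr big_seq big1 // => y ys.
  by rewrite mulmxA eidemM (negPf (ne y ys)) mul0mx.
- rewrite mulmx_sumr big_seq big1 // => y ys.
  by rewrite -mulmxA Ue mulmxA eidemM (negPf (ne y ys)) mul0mx.
- rewrite -mulmx_suml -mulmxA mulmx_sumr (eq_bigr _ (fun y _ => Ue y)) -mulmx_suml mulmxA.
  congr (_ *m _); rewrite mulmx_sumr; apply: eq_big_seq => y ys.
  rewrite mulmx_suml (big_rem y) //= eidemM eqxx big1_seq ?addr0 // => z /andP [_].
  rewrite mem_rem_uniq // inE => /andP [zy _].
  by rewrite eidemM (negPf zy).
Qed.

End Eigenidempotents.

Lemma mulmx_word (G : finType) (K : fieldType) D1 D2 (T1 : md G K D1) (T2 : md G K D2) A g h k :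
  mhom T1 T2 A -> T1 g *m T1 h ^+ k *m A = A *m (T2 g *m T2 h ^+ k).
Proof.
move=> /mhomP hA; have E : T1 h ^+ k *m A = A *m T2 h ^+ k.
  elim: k => [|k IH]; first by rewrite !expr0 mul1mx mulmx1.
  by rewrite exprS -mulmxE -mulmxA IH mulmxA hA -mulmxA mulmxE -exprS.
by rewrite -mulmxA E mulmxA hA mulmxA.
Qed.

Lemma mrk_summand (Q : mquiver) (K : fieldType) D D' (Y : md (op Q) K D') (T : md (op Q) K D) k c :
    mhom Y T k -> mhom T Y c -> k *m c = 1%:M ->
  forall i, mrk Y i = \rank (c *m k *m (T (opV i) *m T (opT Q) ^+ (mult i).-1)).
Proof.
move=> hk hc kc i; rewrite ffunE.
have := mulmx_word (opV i) (opT Q) (mult i).-1 hk.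
move: (T _ *m _) (Y _ *m _) => W V kW.
have -> : c *m k *m W = c *m V *m k by rewrite -!mulmxA kW.
apply/eqP; rewrite eqn_leq; apply/andP; split; last first.
  exact: leq_trans (mxrankM_maxl _ _) (mxrankM_maxr _ _).
rewrite -{1}[V]mulmx1 -kc -{1}[V]mul1mx -kc -!mulmxA [c *m (V *m _)]mulmxA.
apply: leq_trans (mxrankM_maxr _ _) _; rewrite !mulmxA; exact: mxrankM_maxl.
Qed.

(** * Eigenspaces of the lift over a field containing the residue field *)

Section ExtensionSplit.
Variables (Q0 : mquiver) (L E : finFieldType) (io : {rmorphism L -> E}).
Variables (d : nat) (X : md (op Q0) L d.+1).
Hypotheses (indX : mindec X) (lX : lf X).
Variable th : 'M[L]_d.+1.
Hypotheses (hth : mhom X X th) (uth : th \in unitmx) (thQ : th ^+ qres X = th).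
Hypothesis genth : forall B, mhom X X B -> exists p : {poly L}, mrad X X (B - horner_mx th p).
Hypothesis ordth : forall k, mrad X X (th ^+ k - 1%:M) -> ((qres X).-1 %| k)%N.
Notation XE := (mbase io X).
Notation thE := (map_mx io th).
Notation dg := (degree_mxminpoly th).

Lemma endXE_span A : mhom XE XE A -> exists p : {poly E}, nilspan X io (A - horner_mx thE p).
Proof.
move=> /mbase_hom_span [m [c [B [hB ->]]]].
have /choice [p hp] : forall j, exists p : {poly L}, mrad X X (B j - horner_mx th p).
  by move=> j; apply: genth.
exists (\sum_j c j *: map_poly io (p j)); rewrite rmorph_sum -sumrB.
apply: nilspan_sum => j _; rewrite /= linearZ /= -map_horner_mx -scalerBr -map_mxB.
exact/nilspanZ/nilspan_rad.
Qed.

Hypothesis tE : thE ^+ #|E| = thE.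
Notation e := (eidem thE).

Lemma eidem_hom x : mhom XE XE (e x).
Proof.
rewrite /eidem mhomB ?mhom1 // mhomX // mhomB ?mhom_scalar // mbase_hom //.
Qed.

Lemma eidem_frob x : map_mx (frob io) (e x) = e (frob io x).
Proof.
have thF : map_mx (frob io) thE = thE by apply/matrixP => i j; rewrite !mxE frob_base.
by rewrite /eidem map_mxB map_mx1 map_mxX map_mxB map_scalar_mx thF.
Qed.

Lemma eidem_annul x (p : {poly L}) : horner_mx th p = 0 -> e x != 0 -> root (map_poly io p) x.
Proof.
move=> p0; apply: contraR => px; have := eidem_horner tE x (map_poly io p).
rewrite -map_horner_mx p0 map_mx0 mul0mx => /eqP; rewrite eq_sym scaler_eq0.
by move: px; rewrite rootE => /negPf ->.
Qed.

(** If x^k = 1, then th^k - 1 kills the nonzero [e x], so it is not invertible and lies in the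
    radical. With [eidem_Q], every eigenvalue has order exactly Q - 1. *)
Lemma eidem_order x k : e x != 0 -> x ^+ k = 1 -> ((qres X).-1 %| k)%N.
Proof.
move=> ex xk; apply: ordth; rewrite mradXX mhomB ?mhomX ?mhom1 //=.
rewrite -(map_unitmx io); apply/negP => u; move/negP: ex; apply.
have := eidem_horner tE x ('X^k - 1); rewrite !hornerE xk subrr scale0r.
have -> : horner_mx thE ('X^k - 1) = map_mx io (th ^+ k - 1%:M).
  by rewrite rmorphB rmorph1 rmorphXn /= horner_mx_X map_mxB map_mx1 map_mxX.
by move=> E0; rewrite -(mulKmx u (e x)) E0 mulmx0.
Qed.

Lemma eidem_Q x : e x != 0 -> x ^+ (qres X).-1 = 1.
Proof.
move=> ex; have x0 : x != 0.
  apply: contraNneq ex => x0; have uE : thE \in unitmx by rewrite map_unitmx.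
  by have := eidem_eig tE x; rewrite x0 scale0r => /(congr1 (mulmx (invmx thE))); rewrite mulKmx // mulmx0 => ->.
have Q0' : (0 < qres X)%N by apply/ltnW/qres_gt1.
have : root (map_poly io ('X^(qres X) - 'X)) x.
  by apply: eidem_annul => //; rewrite rmorphB rmorphXn /= !horner_mx_X thQ subrr.
rewrite rmorphB /= map_polyXn map_polyX rootE !hornerE subr_eq0 => /eqP xQ.
by apply: (mulIf x0); rewrite -exprSr prednK // xQ mul1r.
Qed.

Definition eigset : {set E} := [set x | e x != 0].

Lemma eigset_frob x : x \in eigset -> frob io x \in eigset.
Proof. by rewrite !inE -eidem_frob map_mx_eq0. Qed.

Lemma eigset_iter j x : x \in eigset -> x ^+ (#|L| ^ j) \in eigset.
Proof.
move=> xL; elim: j => [|j IH]; first by rewrite expr1.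
by rewrite expnSr exprM; apply: (eigset_frob IH).
Qed.

(** Let q = |L|, so that Q = q^dg. A coincidence of the i-th and j-th conjugates gives x =
    x^(q^(j-i)) after further Frobenius steps, so Q - 1 divides q^(j-i) - 1, which is positive and
    smaller. *)
Lemma eigset_orbit_inj x : x \in eigset ->
  {in [pred j | (j < dg)%N] &, injective (fun j => x ^+ (#|L| ^ j))}.
Proof.
move=> xL; have QE := qres_degree indX hth thQ genth.
have q1 := finNzRing_gt1 L.
have xQ : x ^+ (#|L| ^ dg) = x.
  rewrite -QE -(prednK (ltnW (qres_gt1 indX))) exprSr eidem_Q ?mul1r //.
  by move: xL; rewrite inE.
suff h i j : (i < j)%N -> (j < dg)%N -> x ^+ (#|L| ^ i) <> x ^+ (#|L| ^ j).
  move=> i j; rewrite !inE => li lj E0; have [lij|lji|//] := ltngtP i j.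
    by case: (h _ _ lij lj).
  by case: (h _ _ lji li).
move=> lij lj E0.
have x0 : x != 0.
  apply/eqP => x0; have := eidem_Q; move: xL; rewrite inE => ex /(_ _ ex).
  rewrite x0 expr0n; case: (qres X) (qres_gt1 indX) => [|[|m]] //= _ /eqP.
  by rewrite eq_sym oner_eq0.
have E1 : x = x ^+ (#|L| ^ (j - i)).
  have := congr1 (fun y => y ^+ (#|L| ^ (dg - i))) E0.
  rewrite -!exprM -!expnD subnKC; last by rewrite ltnW // (ltn_trans lij).
  have -> : (j + (dg - i) = dg + (j - i))%N.
    by rewrite !addnBA 1?addnC ?(ltnW lij) // ltnW // (ltn_trans lij).
  by rewrite expnD exprM xQ.
have p0 : (0 < #|L| ^ (j - i))%N by rewrite expn_gt0 (ltnW q1).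
have := @eidem_order x (#|L| ^ (j - i)).-1; move: (xL); rewrite inE => -> /(_ isT).
have -> : x ^+ (#|L| ^ (j - i)).-1 = 1.
  by apply: (mulIf x0); rewrite -exprSr prednK // -E1 mul1r.
move=> /(_ erefl) /dvdn_leq.
have lt1 : (1 < #|L| ^ (j - i))%N by rewrite -(expn0 #|L|) ltn_exp2l // subn_gt0.
rewrite -ltnS prednK // => /(_ lt1); rewrite leqNgt QE => /negP; apply.
rewrite -ltnS !prednK //; last by rewrite expn_gt0 (ltnW q1).
by rewrite ltn_exp2l // (leq_ltn_trans (leq_subr _ _)).
Qed.

Lemma card_eigset_le : (#|eigset| <= dg)%N.
Proof.
have f0 : map_poly io (mxminpoly th) != 0.
  by rewrite map_poly_eq0 monic_neq0 // mxminpoly_monic.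
have := @max_poly_roots _ (map_poly io (mxminpoly th)) (enum eigset) f0.
rewrite size_map_poly size_mxminpoly -cardE ltnS; apply; last exact: enum_uniq.
apply/allP => x; rewrite mem_enum inE => ex; apply: eidem_annul => //.
exact: mx_root_minpoly.
Qed.

(** The Frobenius orbit of one eigenvalue already has as many elements as the minimal polynomial of
    [th] has room for roots. *)
Lemma eigset_orbit x : x \in eigset ->
  eigset = [set x ^+ (#|L| ^ (j : 'I_dg)) | j in 'I_dg] /\ #|eigset| = dg.
Proof.
move=> xL; set O := [set _ | _ in _].
have cO : #|O| = dg.
  rewrite card_in_imset ?card_ord // => i j _ _ /(eigset_orbit_inj xL) E0.
  by apply: val_inj; apply: E0; rewrite inE.
have sO : O \subset eigset by apply/subsetP => _ /imsetP [j _ ->]; apply: eigset_iter.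
have E0 : O = eigset by apply/eqP; rewrite eqEcard sO cO card_eigset_le.
by rewrite -cO E0.
Qed.

Lemma eigset_exists : exists x, x \in eigset.
Proof.
apply/set0Pn/eqP => L0; have := eidem_sum thE; rewrite big1 => [|x _].
  by move/eqP; rewrite eq_sym (negPf (matrix_nonzero1 _ _)).
by apply/eqP; have := in_set0 x; rewrite -L0 inE => /negbFE.
Qed.

Definition eigrank x : {ffun vert Q0 -> nat} :=
  [ffun i => \rank (e x *m (XE (opV i) *m XE (opT Q0) ^+ (mult i).-1))].

(** The matrices of [X] and of [th] have entries in L, so Frobenius carries the eigenprojection of x
    to that of its conjugate and preserves the ranks. *)
Lemma eigrank_frob x : eigrank (frob io x) = eigrank x.
Proof.
apply/ffunP => i; rewrite !ffunE -eidem_frob -(mxrank_map (frob io) (e x *m _)).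
congr (\rank _); rewrite [RHS]map_mxM; congr (_ *m _).
rewrite map_mxM map_mxX; congr (_ *m _ ^+ _); apply/matrixP => a b;
by rewrite !mxE /= ?frob_base.
Qed.

Lemma eigrank_const x y : x \in eigset -> y \in eigset -> eigrank x = eigrank y.
Proof.
move=> xL; have [-> _] := eigset_orbit xL => /imsetP [j _ ->].
elim: (nat_of_ord j) => [|k IH]; first by rewrite expr1.
by rewrite expnSr exprM -[_ ^+ #|L|]/(frob io _) eigrank_frob.
Qed.

Lemma mrk_eigrank x i : x \in eigset -> mrk X i = (dg * eigrank x i)%N.
Proof.
move=> xL; have [_ cL] := eigset_orbit xL.
rewrite -(mrk_map io X) ffunE (rank_eidem_sum tE); last first.
  rewrite -(mulmx_word _ _ _ (T1 := XE) (T2 := XE)) //; last by rewrite mbase_hom.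
rewrite (bigID (mem eigset)) /= [X in (_ + X)%N]big1 ?addn0 => [|y]; last first.
  by rewrite inE negbK => /eqP ->; rewrite mul0mx mxrank0.
rewrite -cL -sum_nat_const; apply: eq_bigr => y yL.
by rewrite (eigrank_const xL yL) [RHS]ffunE.
Qed.

(** The eigenspace is absolutely indecomposable: an endomorphism of it, extended by zero to X over
    E, is p(th) modulo the nilpotent ideal, and [th] acts on the eigenspace as x, so it differs from
    the scalar p(x) by a nilpotent. *)
Lemma eig_summand x : x \in eigset ->
  exists (Y : md (op Q0) E (dimr (eigrank x))) k c,
    [/\ mhom Y XE k, mhom XE Y c, k *m c = 1%:M, c *m k = e x &
      [/\ lf Y, mrk Y = eigrank x & mabs Y]].
Proof.
rewrite inE => ex; have ee : e x *m e x = e x by rewrite eidemM // eqxx.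
have [r [c [k [rE ck kc]]]] := idem_factor ee.
have he := eidem_hom x.
have ke : k *m e x = k by rewrite -ck mulmxA kc mul1mx.
have ec : e x *m c = c by rewrite -ck -mulmxA kc mulmx1.
pose Y : md (op Q0) E r := [ffun g => k *m XE g *m c].
have hk : mhom Y XE k.
  apply/mhomP => g; rewrite ffunE -mulmxA ck -mulmxA.
  by rewrite (mhomP _ _ _ he) mulmxA ke.
have hc : mhom XE Y c.
  apply/mhomP => g; rewrite [Y g]ffunE !mulmxA ck.
  by rewrite -(mhomP _ _ _ he) -mulmxA ec.
have mY : mrk Y = eigrank x.
  by apply/ffunP => i; rewrite (mrk_summand hk hc kc) [RHS]ffunE ck.
have lY : lf Y.
  have [D' [S iS]] := mdvd_complement (ex_intro _ k (ex_intro _ c (And3 hk hc kc))).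
  by have := lf_map io lX; rewrite (lf_isoE iS) lf_osum => /andP [].
have aY : mabs Y.
  split; first by rewrite rE lt0n mxrank_eq0.
  move=> A hA; have [p np] := endXE_span (mhomM hc (mhomM hA hk)).
  exists p.[x], #|{: 'M[L]_d.+1}|.+2.
  set B := c *m (A *m k) in np; set n := B - horner_mx thE p in np.
  have AE : A - p.[x]%:M = k *m n *m c.
    rewrite /n mulmxBr mulmxBl /B !mulmxA kc mul1mx -[_ *m k *m c]mulmxA kc mulmx1.
    have hcx : horner_mx thE p *m c = p.[x] *: c.
      by rewrite -[in LHS]ec mulmxA eidem_horner // -scalemxAl ec.
    by congr (_ - _); rewrite -mulmxA hcx -scalemxAr kc scalemx1.
  (* The inner factor lies in the nilpotent ideal; the outer factors account for the extra 1 in the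
     exponent. *)
  have XE' m : (k *m n *m c) ^+ m.+1 = k *m n *m (e x *m n) ^+ m *m c.
    elim: m => [|m IH]; first by rewrite expr1 expr0 mulmx1.
    by rewrite exprSr IH exprSr -!mulmxE -!ck !mulmxA.
  rewrite AE XE'; have ne : nilspan X io (e x *m n) by apply: nilspanMl.
  by rewrite (nilspan_nil indX ne) mulmx0 mul0mx.
rewrite -mY; move: (lf_dim lY) => eD.
(* The size [r] is [dimr] of the rank vector only up to a proof, along which the summand is
   transported. *)
suff h D (eD' : r = D) : exists (Y : md (op Q0) E D) k c,
    [/\ mhom Y XE k, mhom XE Y c, k *m c = 1%:M, c *m k = e x &
      [/\ lf Y, mrk Y = eigrank x & mabs Y]].
  by have := h _ eD; rewrite mY.
by case: D / eD'; exists Y, k, c.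
Qed.

(** For x <> y an isomorphism would give A = e_x A e_y over E. Since A is p(th) modulo the nilpotent
    ideal and e_x p(th) e_y = 0, [A] would lie in that ideal, and so would the nonzero idempotent
    e_x = A A'. *)
Lemma eig_summand_neq x y D1 D2 (Y1 : md (op Q0) E D1) (Y2 : md (op Q0) E D2) k1 c1 k2 c2 :
    mhom Y1 XE k1 -> mhom XE Y1 c1 -> k1 *m c1 = 1%:M -> c1 *m k1 = e x ->
    mhom Y2 XE k2 -> mhom XE Y2 c2 -> k2 *m c2 = 1%:M -> c2 *m k2 = e y ->
  x \in eigset -> miso Y1 Y2 -> x = y.
Proof.
move=> hk1 hc1 kc1 ck1 hk2 hc2 kc2 ck2; rewrite inE => ex [g [g' [hg hg' gg' _]]].
apply/eqP; apply: contraNT ex => nxy.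
pose A := c1 *m g *m k2; pose A' := c2 *m g' *m k1.
have hA : mhom XE XE A by rewrite (mhomM _ hk2) // (mhomM hc1).
have hA' : mhom XE XE A' by rewrite (mhomM _ hk1) // (mhomM hc2).
have AA : A *m A' = e x.
  rewrite /A /A' !mulmxA -[_ *m k2 *m c2]mulmxA kc2 mulmx1.
  by rewrite -[c1 *m g *m g']mulmxA gg' mulmx1 ck1.
have ke : k2 *m e y = k2 by rewrite -ck2 mulmxA kc2 mul1mx.
have ec : e x *m c1 = c1 by rewrite -ck1 -mulmxA kc1 mulmx1.
have [p np] := endXE_span hA.
have nA : nilspan X io A.
  have -> : A = e x *m (A - horner_mx thE p) *m e y.
    rewrite (mulmxBr (e x) A) (mulmxBl _ _ (e y)) -[_ *m horner_mx _ _ *m _]mulmxA eidem_horner //.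
    rewrite -scalemxAr eidemM // (negPf nxy) scaler0 subr0.
    by rewrite /A !mulmxA ec -(mulmxA _ k2) ke.
  by apply: nilspanM; [apply: nilspanMl|]; rewrite ?eidem_hom.
have ne : nilspan X io (e x) by rewrite -AA; apply: nilspanM.
have eX m : e x ^+ m.+1 = e x.
  elim: m => [|m IH]; first by rewrite expr1.
  by rewrite exprS IH -mulmxE eidemM // eqxx.
by have := nilspan_nil indX ne; rewrite eX => ->.
Qed.

(** In the local ring End(Y) the terms i e_x p add up to 1, so one of them is invertible and makes
    [Y] a summand of that eigenspace. *)
Lemma eig_summand_complete D (Y : md (op Q0) E D) : mindec Y -> mdvd Y XE ->
  exists2 x, x \in eigset & forall D' (Y' : md (op Q0) E D') k c,
    mhom Y' XE k -> mhom XE Y' c -> k *m c = 1%:M -> c *m k = e x ->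
    mindec Y' -> miso Y Y'.
Proof.
move=> indY [i [p [hi hp ip]]].
have hx x : mhom Y Y (i *m e x *m p) by rewrite (mhomM _ hp) // (mhomM hi) // eidem_hom.
have /existsP [x ux] : [exists x, i *m e x *m p \in unitmx].
  apply: contraT => /existsPn nu.
  have : \sum_x i *m e x *m p \notin unitmx.
    pose P A := mhom Y Y A && (A \notin unitmx).
    have /andP [] // : P (\sum_x i *m e x *m p).
    apply: (big_ind P) => [|A B /andP [hA nA] /andP [hB nB]|x _].
    - by rewrite /P mhom0 (@nil_nonunit _ _ _ 1) //; case: indY.
    - by rewrite /P mhomD // (nonunitD indY).
    - by rewrite /P hx nu.
  by rewrite -mulmx_suml -mulmx_sumr eidem_sum // mulmx1 ip unitmx1.
exists x.
  rewrite inE; apply: contraTneq ux => ->; rewrite mulmx0 mul0mx.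
  by rewrite (@nil_nonunit _ _ _ 1) //; case: indY.
move=> D' Y' k c hk hc kc ck indY'; apply: mdvd_indec => //; first by case: indY.
apply: (@mdvd_unit _ _ _ _ _ _ (i *m c) (k *m p)).
- exact: mhomM hi hc.
- exact: mhomM hk hp.
- by rewrite mulmxA -(mulmxA i) ck.
Qed.

End ExtensionSplit.

(** * An absolutely indecomposable summand forces the field to contain the residue field *)

Section Converse.
Variables (G : finType) (L E : finFieldType) (io : {rmorphism L -> E}).
Variables (d : nat) (X : md G L d.+1).
Hypothesis (indX : mindec X).
Variable th : 'M[L]_d.+1.
Hypotheses (hth : mhom X X th) (thQ : th ^+ qres X = th).
Hypothesis genth : forall B, mhom X X B -> exists p : {poly L}, mrad X X (B - horner_mx th p).
Notation XE := (mbase io X).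
Notation thE := (map_mx io th).

(** Modulo the nilpotent ideal the endomorphism ring over E is E[th], which is commutative. *)
Lemma nilspan_commutator A B : mhom XE XE A -> mhom XE XE B ->
  nilspan X io (A *m B - B *m A).
Proof.
have span C : mhom XE XE C -> exists p : {poly E}, nilspan X io (C - horner_mx thE p).
  move=> /mbase_hom_span [m [c [F [hF ->]]]].
  have /choice [p hp] : forall j, exists p : {poly L}, mrad X X (F j - horner_mx th p).
    by move=> j; apply: genth.
  exists (\sum_j c j *: map_poly io (p j)); rewrite rmorph_sum -sumrB.
  apply: nilspan_sum => j _; rewrite /= linearZ /= -map_horner_mx -scalerBr -map_mxB.
  exact/nilspanZ/nilspan_rad.
move=> hA hB; have [a na] := span A hA; have [b nb] := span B hB.
have ha : mhom XE XE (horner_mx thE a) by rewrite mhom_horner // mbase_hom.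
have hb : mhom XE XE (horner_mx thE b) by rewrite mhom_horner // mbase_hom.
move: na nb ha hb; set a' := horner_mx thE a; set b' := horner_mx thE b => na nb ha hb.
have ab : a' *m b' = b' *m a' by rewrite /a' /b' !mulmxE -!rmorphM mulrC.
have -> : A *m B - B *m A = A *m (B - b') + (A - a') *m b' +
    (-1) *: (B *m (A - a') + (B - b') *m a').
  have E1 (U V u v : 'M[E]_d.+1) : U *m (V - v) + (U - u) *m v = U *m V - u *m v.
    by rewrite mulmxBr mulmxBl addrA subrK.
  by rewrite !E1 ab scaleN1r opprB addrA subrK.
apply: nilspanD; last apply: nilspanZ; apply: nilspanD;
  by [apply: nilspanM|apply: nilspanMl].
Qed.

Variables (D : nat) (Y : md G E D).
Hypothesis absY : mabs Y.

(** A |-> i A p is multiplicative modulo the radical of End(Y), its defect being the image of A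
    [B, p i], where the commutator lies in the nilpotent ideal. Since End(Y)/rad = E, [th] goes to
    some c with c^|E| = c, so th^|E| - th goes to 0. It is thus not invertible, hence radical in
    End(X); being in L[th], it vanishes. *)
Lemma abs_dvd_fixed : mdvd Y XE -> thE ^+ #|E| = thE.
Proof.
have indY := mabs_indec absY; have [D0 locY] := absY.
move=> [i [p [hi hp ip]]].
pose phi A := i *m A *m p.
have hphi A : mhom XE XE A -> mhom Y Y (phi A) by move=> hA; rewrite (mhomM _ hp) // (mhomM hi).
have hpi : mhom XE XE (p *m i) by rewrite (mhomM hp).
have phi_nil n : nilspan X io n -> mrad Y Y (phi n).
  move=> nn; rewrite mradXX hphi ?nilspan_hom //=.
  have XEn m : phi n ^+ m.+1 = i *m n *m ((p *m i) *m n) ^+ m *m p.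
    elim: m => [|m IH]; first by rewrite expr1 expr0 mulmx1.
    by rewrite exprSr IH exprSr -!mulmxE /phi !mulmxA.
  apply: (@nil_nonunit _ _ _ #|{: 'M[L]_d.+1}|.+2) => //.
  by rewrite XEn (nilspan_nil indX (nilspanMl hpi nn)) mulmx0 mul0mx.
have phiM A B : mhom XE XE A -> mhom XE XE B -> mcong Y (phi (A *m B)) (phi A *m phi B).
  move=> hA hB.
  rewrite /mcong; have -> : phi (A *m B) - phi A *m phi B = phi (A *m (B *m (p *m i) - (p *m i) *m B)).
    by rewrite /phi !mulmxBr mulmxBl !mulmxA -(mulmxA _ i p) ip mulmx1.
  by apply: phi_nil; apply: nilspanMl => //; apply: nilspan_commutator.
have hthE : mhom XE XE thE by rewrite mbase_hom.
have [c [k ck]] := locY _ (hphi _ hthE).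
have thc : mcong Y (phi thE) c%:M.
  by rewrite /mcong mradXX mhomB ?mhom_scalar ?hphi //=; apply: nil_nonunit ck.
have phi1 : phi 1%:M = 1%:M by rewrite /phi mulmx1.
have thck m : mcong Y (phi (thE ^+ m)) (c ^+ m)%:M.
  elim: m => [|m IH]; first by rewrite !expr0 -[1]/(1%:M) phi1 mcong_refl.
  rewrite !exprS -mulmxE scalar_mxM.
  apply: (mcong_trans indY (phiM _ _ hthE (mhomX m hthE))).
  by apply: mcongM; rewrite ?mhom_scalar ?hphi ?mhomX.
pose B := th ^+ #|E| - th.
have hB : mhom X X B by rewrite mhomB // mhomX.
have BE : map_mx io B = thE ^+ #|E| - thE by rewrite map_mxB map_mxX.
have phiB : mcong Y (phi (map_mx io B)) 0.
  have -> : phi (map_mx io B) = phi (thE ^+ #|E|) - phi thE by rewrite BE /phi mulmxBr mulmxBl.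
  rewrite -(subrr c%:M); apply: mcongD => //; last exact: mcongN.
  by have := thck #|E|; rewrite expf_card.
have nB : B \notin unitmx.
  apply/negP => uB; have hC := mhom_invmx uB hB.
  have h1 : mcong Y (phi (map_mx io B *m map_mx io (invmx B))) 0.
    apply: (mcong_trans indY (phiM _ _ _ _)); rewrite ?mbase_hom //.
    have := mcongM indY (mhom0 Y Y) (hphi (map_mx io (invmx B)) _) phiB (mcong_refl indY _).
    by rewrite mul0mx; apply; rewrite mbase_hom.
  move: h1; rewrite -map_mxM mulmxV // map_mx1 phi1 /mcong subr0 mradXX unitmx1 andbF //.
have : horner_mx th ('X^#|E| - 'X) = 0.
  by apply: (horner_rad0 indX thQ); rewrite rmorphB rmorphXn /= !horner_mx_X mradXX hB.
rewrite rmorphB rmorphXn /= !horner_mx_X -/B => B0.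
by move: BE; rewrite B0 map_mx0 => /esym/eqP; rewrite subr_eq0 => /eqP.
Qed.

End Converse.

Section SummandsOfExtensions.
Variables (G : finType) (L E : finFieldType) (io : {rmorphism L -> E}).

Lemma mdvd_sum_local D D1 D2 (Y : md G E D) (T1 : md G E D1) (T2 : md G E D2) :
  mindec Y -> mdvd Y (osum T1 T2) -> mdvd Y T1 \/ mdvd Y T2.
Proof.
move=> indY /mdvd_sum_split [f1 [f2 [p1 [p2 [hf1 hf2 hp1 hp2 E1]]]]].
have [u1|n1] := boolP (f1 *m p1 \in unitmx); first by left; apply: mdvd_unit u1.
have [u2|n2] := boolP (f2 *m p2 \in unitmx); first by right; apply: mdvd_unit u2.
have := nonunitD indY (mhomM hf1 hp1) (mhomM hf2 hp2) n1 n2.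
by rewrite E1 unitmx1.
Qed.

Lemma mdvd_base_indec D (T : md G L D) D' (Y : md G E D') : mindec Y ->
  mdvd Y (mbase io T) -> exists d (X : md G L d),
    [/\ mindec X, mdvd X T & mdvd Y (mbase io X)].
Proof.
move=> indY; elim/mdecomp_ind: D / T => [D T D0|D T indT|D1 D2 T1 T2 D T iT IH1 IH2] dY.
- subst D; have := mdvd_dim dY; rewrite leqn0 => /eqP D'0; subst D'.
  by case: indY.
- by exists D, T; split=> //; apply/miso_mdvd/miso_refl.
have dY' : mdvd Y (osum (mbase io T1) (mbase io T2)).
  by rewrite -mbase_osum; apply: mdvd_trans dY (miso_mdvd (mbase_iso io iT)).
have iT' := miso_mdvd (miso_sym iT).
have [/IH1|/IH2] := mdvd_sum_local indY dY' => -[d [X [indX dX dYX]]]; exists d, X; split=> //.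
  exact: mdvd_trans (mdvd_trans dX (mdvd_suml T1 T2)) iT'.
exact: mdvd_trans (mdvd_trans dX (mdvd_sumr T1 T2)) iT'.
Qed.

(** If [X] and [X'] were not isomorphic, all composites X -> X' -> X over L would be radical, so the
    endomorphism [n], which passes through [Y], X' and [Y] again, would be nilpotent; but n p =
    p. *)
Lemma mdvd_base_unique d d' (X : md G L d) (X' : md G L d') D (Y : md G E D) :
  (0 < D)%N -> mindec X -> mindec X' ->
  mdvd Y (mbase io X) -> mdvd Y (mbase io X') -> miso X X'.
Proof.
move=> D0 indX indX' [i [p [hi hp ip]]] [i' [p' [hi' hp' ip']]].
apply: contrapT => nXX.
have hf := mhomM hp hi'; have hg := mhomM hp' hi.
pose n := (p *m i') *m (p' *m i).
have nn : nilspan X io n.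
  have [m [c [F [hF fE]]]] := mbase_hom_span hf.
  have [m' [c' [F' [hF' gE]]]] := mbase_hom_span hg.
  rewrite /n fE gE mulmx_suml; apply: nilspan_sum => j _.
  rewrite mulmx_sumr; apply: nilspan_sum => l _.
  rewrite -scalemxAl -scalemxAr scalerA -map_mxM; apply/nilspanZ/nilspan_rad.
  rewrite mradXX (mhomM (hF j) (hF' l)) /=; apply/negP => u.
  by apply: nXX; apply: mdvd_indec indX' (mdvd_unit (hF j) (hF' l) u); case: indX.
have np : n *m p = p.
  by rewrite /n !mulmxA -!(mulmxA _ i p) ip mulmx1 -(mulmxA p) ip' mulmx1.
have nk k : n ^+ k *m p = p.
  by elim: k => [|k IH]; rewrite ?mul1mx // exprS -mulmxE -mulmxA IH.
have p0 : p = 0 by rewrite -(nk #|{: 'M[L]_d}|.+1) (nilspan_nil indX nn) mul0mx.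
move: ip; rewrite p0 mulmx0; case: (D) D0 => // m _ /eqP.
by rewrite eq_sym (negPf (matrix_nonzero1 _ _)).
Qed.

End SummandsOfExtensions.

(** * Embeddings of finite fields *)

Lemma expX_sub_dvd (K : fieldType) q N : [pchar K].-nat q ->
  ('X^q - 'X : {poly K}) %| 'X^(q ^ N) - 'X.
Proof.
move=> nq; have nq' : [pchar {poly K}].-nat q by apply: sub_in_pnat nq => p _; rewrite pchar_poly.
elim: N => [|N IH]; first by rewrite expn0 expr1 subrr dvdp0.
have -> : 'X^(q ^ N.+1) - 'X = ('X^(q ^ N) - 'X) ^+ q + ('X^q - 'X) :> {poly K}.
  by rewrite exprB_pchar // -exprM expnSr addrA subrK.
have q0 : (0 < q)%N by case/andP: nq.
apply: dvdp_add => //; apply: dvdp_trans IH _; move: ('X^_ - 'X) => a.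
by rewrite -(prednK q0) exprS dvdp_mulr.
Qed.

(** Let [a] generate L and let [g] be an annihilating polynomial of [a] over F_p of least size. It
    divides X^|L| - X, hence X^|E| - X, which splits over E; for a root [b] of [g], h(a) |-> h(b) is
    well defined. *)
Lemma finfield_embed (L E : finFieldType) N : (0 < N)%N -> #|E| = (#|L| ^ N)%N ->
  exists io : {rmorphism L -> E}, True.
Proof.
move=> N0 cE; have [p pr_p pL] := finPcharP L.
have [m cL] : exists m, #|L| = (p ^ m)%N by exists (logn p #|L|); apply: card_pprimeChar pL.
have pE : p \in [pchar E] by apply: (@card_finPcharP _ p (m * N)) => //; rewrite cE cL expnM.
have jF (F : finFieldType) (pF : p \in [pchar F]) : {rmorphism 'F_p -> F}.
  exact: (GRing.in_alg (pPrimeCharType pF) : {rmorphism 'F_p -> pPrimeCharType pF}).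
have jL := jF L pL; have jE := jF E pE.
have [a [a0 [genA _]]] := finfield_gen L.
pose vL (h : {poly 'F_p}) := (map_poly jL h).[a].
have exg : exists n, `[< exists h : {poly 'F_p}, [/\ h != 0, vL h = 0 & size h = n] >].
  exists (size ('X^#|L| - 'X : {poly 'F_p})); apply/asboolP; exists ('X^#|L| - 'X); split=> //.
    by rewrite -size_poly_eq0 size_polyDl size_polyXn // size_polyN size_polyX ltnS finNzRing_gt1.
  by rewrite /vL rmorphB /= map_polyXn map_polyX !hornerE expf_card subrr.
have [n /asboolP [g [g0 va szg]] ming] := ex_minnP exg.
have gdvd h : vL h = 0 -> g %| h.
  move=> vh; rewrite /dvdp; apply: contraT => r0; have := ming (size (h %% g)).
  have lt_r : (size (h %% g)%R < size g)%N by rewrite ltn_modp.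
  rewrite leqNgt -szg lt_r; apply; apply/asboolP; exists (h %% g); split=> //.
  have := vh; rewrite {1}(divp_eq h g) /vL rmorphD rmorphM /= hornerD hornerM.
  by rewrite -!/(vL _) va mulr0 add0r.
have nq : [pchar 'F_p].-nat #|L| by rewrite cL pnatX pnatE // pchar_Fp // inE eqxx.
have dE : map_poly jE g %| \prod_(x <- enum E) ('X - x%:P).
  rewrite big_enum /= -finField_genPoly.
  have -> : 'X^#|E| - 'X = map_poly jE ('X^#|E| - 'X) by rewrite rmorphB /= map_polyXn map_polyX.
  rewrite dvdp_map; apply: (@dvdp_trans _ ('X^#|L| - 'X)); last by rewrite cE; apply: expX_sub_dvd.
  by apply: gdvd; rewrite /vL rmorphB /= map_polyXn map_polyX !hornerE expf_card subrr.
have [b rb] : exists b, root (map_poly jE g) b.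
  have [msk eqm] := dvdp_prod_XsubC dE.
  have szm : (1 < size (map_poly jE g))%N.
    rewrite size_map_poly ltnNge; apply/negP => /size1_polyC gC.
    move: va; rewrite /vL gC map_polyC hornerC => /eqP; rewrite fmorph_eq0 => /eqP g00.
    by move: g0; rewrite gC g00 eqxx.
  case: (mask msk (enum E)) eqm => [|b s] eqm.
    by move: szm; rewrite (eqp_size eqm) big_nil size_poly1.
  by exists b; rewrite (eqp_root eqm) big_cons rootM root_XsubC eqxx.
pose vE (h : {poly 'F_p}) := (map_poly jE h).[b].
have vLE h h' : vL h = vL h' -> vE h = vE h'.
  move=> hh; have : g %| h - h' by apply: gdvd; rewrite /vL rmorphB hornerD hornerN -!/(vL _) hh subrr.
  rewrite -(dvdp_map jE) => /(dvdpP _ _) [c cE'].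
  have : vE (h - h') = 0 by rewrite /vE cE' hornerM (rootP rb) mulr0.
  by rewrite /vE rmorphB hornerD hornerN => /eqP; rewrite subr_eq0 => /eqP.
have /choice [f fP] : forall x, exists h, vL h = x.
  move=> x; have [->|/genA [k ->]] := eqVneq x 0; first by exists 0; rewrite /vL rmorph0 horner0.
  by exists 'X^k; rewrite /vL map_polyXn hornerXn.
pose F x := vE (f x).
have Fadd : zmod_morphism F.
  move=> x y; rewrite /F -[RHS]/(vE (f x) - vE (f y)).
  have -> : vE (f x) - vE (f y) = vE (f x - f y) by rewrite /vE rmorphB hornerD hornerN.
  by apply: vLE; rewrite {2}/vL rmorphB hornerD hornerN -!/(vL _) !fP.
have Fmul : monoid_morphism F.
  split=> [|x y]; rewrite /F.
    have -> : 1 = vE 1 by rewrite /vE rmorph1 hornerC.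
    by apply: vLE; rewrite fP /vL rmorph1 hornerC.
  have -> : vE (f x) * vE (f y) = vE (f x * f y) by rewrite /vE rmorphM hornerM.
  by apply: vLE; rewrite {2}/vL rmorphM hornerM -!/(vL _) !fP.
pose M1 := GRing.isZmodMorphism.Build L E F Fadd.
pose M2 := GRing.isMonoidMorphism.Build L E F Fmul.
pose io : {rmorphism L -> E} := HB.pack F M1 M2.
by exists io.
Qed.

(** * Restriction of scalars *)

Section RegularRepresentation.
Variables (L E : finFieldType) (io : {rmorphism L -> E}) (N : nat).
Hypothesis cE : #|E| = (#|L| ^ N.+1)%N.

Lemma regular_basis : exists g : E,
  bijective (fun u : 'rV[L]_N.+1 => (map_poly io (rVpoly u)).[g]) /\
  injective (fun k : 'I_N.+1 => g ^+ (#|L| ^ k)).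
Proof.
have [g [g0 [gen ord]]] := finfield_gen E.
have q1 := finNzRing_gt1 L.
exists g; split.
  have phiB (m : nat) (u v : 'rV[L]_m) : (map_poly io (rVpoly (u - v))).[g] =
      (map_poly io (rVpoly u)).[g] - (map_poly io (rVpoly v)).[g].
    by rewrite linearB rmorphB hornerD hornerN.
  apply: inj_card_bij; last by rewrite card_mx mul1n cE.
  move=> u v /eqP; rewrite -subr_eq0 -phiB => /eqP h0.
  apply/eqP; rewrite -subr_eq0; apply/eqP.
  pose h := rVpoly (u - v); apply/(can_inj rVpolyK); rewrite linear0 -/h.
  (* A nonzero [h] of degree at most N vanishing at the generator [g] would make every element of E
     the value at [g] of a remainder modulo [h]; there are fewer than |E| such remainders. *)
  apply/eqP; apply: contraT => nh.
  have szh : ((size h).-1 < N.+1)%N by rewrite prednK ?lt0n ?size_poly_eq0 // size_poly.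
  pose phi (w : 'rV[L]_(size h).-1) := (map_poly io (rVpoly w)).[g].
  have surj x : exists w, phi w = x.
    have modE (p : {poly L}) : (map_poly io (p %% h)).[g] = (map_poly io p).[g].
      by rewrite {2}(divp_eq p h) rmorphD rmorphM /= hornerD hornerM -/h in h0 *; rewrite h0 mulr0 add0r.
    have polyx : exists p : {poly L}, (map_poly io p).[g] = x.
      have [->|/gen [k ->]] := eqVneq x 0; first by exists 0; rewrite rmorph0 horner0.
      by exists 'X^k; rewrite map_polyXn hornerXn.
    have [p <-] := polyx; exists (poly_rV (p %% h)); rewrite /phi poly_rV_K ?modE //.
    by rewrite -ltnS prednK ?lt0n ?size_poly_eq0 // ltn_modp.
  have /choice [psi psiK] := surj.
  have : (#|E| <= #|{: 'rV[L]_(size h).-1}|)%N by apply: leq_card (can_inj psiK).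
  by rewrite card_mx mul1n cE leq_exp2l // leqNgt szh.
suff h (i j : 'I_N.+1) : (i < j)%N -> g ^+ (#|L| ^ i) <> g ^+ (#|L| ^ j).
  move=> i j E0; have [lij|lji|/val_inj//] := ltngtP i j; first by case: (h _ _ lij E0).
  by case: (h _ _ lji (esym E0)).
move=> lij E0.
have E1 : g = g ^+ (#|L| ^ (j - i)).
  have := congr1 (fun y => y ^+ (#|L| ^ (N.+1 - i))) E0.
  rewrite -!exprM -!expnD subnKC; last by rewrite ltnW // ltn_ord.
  have -> : (j + (N.+1 - i) = N.+1 + (j - i))%N.
    by rewrite !addnBA 1?addnC ?(ltnW lij) // ltnW // ltn_ord.
  by rewrite expnD exprM -cE expf_card.
have p0 : (0 < #|L| ^ (j - i))%N by rewrite expn_gt0 (ltnW q1).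
have lt1 : (1 < #|L| ^ (j - i))%N by rewrite -(expn0 #|L|) ltn_exp2l // subn_gt0.
have /ord/dvdn_leq : g ^+ (#|L| ^ (j - i)).-1 = 1.
  by apply: (mulIf g0); rewrite -exprSr prednK // -E1 mul1r.
rewrite -ltnS prednK // => /(_ lt1); rewrite leqNgt => /negP; apply.
rewrite -ltnS !prednK //; last by rewrite ltnW // finNzRing_gt1.
by rewrite cE ltn_exp2l // (leq_ltn_trans (leq_subr _ _)).
Qed.

(** [rho c] is multiplication by c in the basis of powers of [g]. The Vandermonde matrix of the
    conjugates of [g] diagonalizes it over E with eigenvalues c^(|L|^k); [v] and [w] are the dual
    left and right eigenvectors for k = 0, where the eigenvalue is c itself. *)
Lemma regular_rep : exists (rho : E -> 'M[L]_N.+1) (v : 'rV[E]_N.+1) (w : 'cV[E]_N.+1),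
  [/\ rho 1 = 1%:M, {morph rho : a b / a + b}, (forall a b, rho (a * b) = rho a *m rho b),
      v *m w = 1%:M & forall c, v *m map_mx io (rho c) = c *: v /\ map_mx io (rho c) *m w = c *: w].
Proof.
have [g [[psi phiK psiK] ginj]] := regular_basis.
set phi := (fun u : 'rV[L]_N.+1 => _) in phiK psiK.
have phi_inj := can_inj phiK.
have phiE u : phi u = \sum_j io (u 0 j) * g ^+ j.
  rewrite /phi (@horner_coef_wide _ N.+1) ?(leq_trans (size_poly _ _)) ?size_poly //.
  by apply: eq_bigr => j _; rewrite coef_map coef_rVpoly_ord.
pose rho c : 'M[L]_N.+1 := \matrix_(i, j) (psi (g ^+ i * c)) 0 j.
have rhoE u c : phi (u *m rho c) = phi u * c.
  rewrite !phiE mulr_suml.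
  transitivity (\sum_j \sum_i io (u 0 i) * (io (psi (g ^+ i * c) 0 j) * g ^+ j)).
    apply: eq_bigr => j _; rewrite mxE rmorph_sum mulr_suml; apply: eq_bigr => i _.
    by rewrite rmorphM mxE mulrA.
  rewrite exchange_big; apply: eq_bigr => i _ /=.
  by rewrite -mulr_sumr -phiE psiK mulrA.
have mx_eq (A B : 'M[L]_N.+1) : (forall u, phi (u *m A) = phi (u *m B)) -> A = B.
  by move=> AB; apply/row_matrixP => i; rewrite !rowE; apply/phi_inj/AB.
have phiD u u' : phi (u + u') = phi u + phi u'.
  by rewrite /phi linearD rmorphD hornerD.
pose W : 'M[E]_N.+1 := Vandermonde N.+1 (\row_k g ^+ (#|L| ^ k)).
have uW : W \in unitmx.
  rewrite unitmxE det_Vandermonde unitfE; apply/prodf_neq0 => i _.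
  apply/prodf_neq0 => j lij; rewrite !mxE subr_eq0; apply/eqP => /ginj ji.
  by rewrite ji ltnn in lij.
have WE i k : W i k = (g ^+ i) ^+ (#|L| ^ k) by rewrite !mxE -!exprM mulnC.
have rhoW c : map_mx io (rho c) *m W = W *m diag_mx (\row_k c ^+ (#|L| ^ k)).
  apply/matrixP => i k; rewrite mul_mx_diag !mxE.
  have nk := pnat_card_ext io k.
  have fD (x y : E) : (x + y) ^+ (#|L| ^ k) = x ^+ (#|L| ^ k) + y ^+ (#|L| ^ k).
    exact: GRing.exprDn_pchar.
  have f0 : (0 : E) ^+ (#|L| ^ k) = 0 by rewrite expr0n expn_eq0 eqn0Ngt (ltnW (finNzRing_gt1 L)).
  transitivity (phi (psi (g ^+ i * c)) ^+ (#|L| ^ k)).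
    rewrite phiE (big_morph (fun x => x ^+ (#|L| ^ k)) fD f0); apply: eq_bigr => j _.
    rewrite !mxE exprMn -!exprM mulnC; congr (_ * _).
    elim: (nat_of_ord k) => [|l IH]; first by rewrite expr1.
    by rewrite expnSr exprM -IH -rmorphXn expf_card.
  by rewrite psiK exprMn -!exprM mulnC.
have colM (A B : 'M[E]_N.+1) j : col j (A *m B) = A *m col j B by rewrite !colE mulmxA.
exists rho, (row 0 (invmx W)), (col 0 W); split.
- by apply: mx_eq => u; rewrite rhoE mulmx1 mulr1.
- by move=> a b; apply: mx_eq => u; rewrite mulmxDr phiD !rhoE mulrDr.
- by move=> a b; apply: mx_eq => u; rewrite mulmxA !rhoE mulrA.
- by rewrite -row_mul -colM mulVmx //; apply/matrixP => i j; rewrite !ord1 !mxE.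
move=> c; have rW : map_mx io (rho c) = W *m diag_mx (\row_k c ^+ (#|L| ^ k)) *m invmx W.
  by rewrite -rhoW mulmxK.
split.
  rewrite rW mulmxA -row_mul mulmxA mulVmx // mul1mx.
  apply/rowP => j; rewrite !mxE (bigD1 0) //= big1 ?addr0 => [|l l0]; rewrite !mxE ?eqxx ?expr1 //.
  by rewrite eq_sym (negPf l0) mul0r.
by rewrite -colM rhoW; apply/colP => i; rewrite mul_mx_diag !mxE expn0 expr1 mulrC.
Qed.

End RegularRepresentation.

Section RestrictionAction.
Variables (F E : fieldType) (N : nat) (rho : E -> 'M[F]_N) (m n : nat) (A : 'M[E]_(m, n)).

(* The rows of [U] are the coordinates of the entries of a vector of E^m. *)
Definition res_act (U : 'M[F]_(m, N)) : 'M[F]_(n, N) :=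
  \matrix_(j < n) \sum_i row i U *m rho (A i j).

Fact res_act_linear : linear res_act.
Proof.
move=> c U V; apply/row_matrixP => j; rewrite linearP /= !rowK scaler_sumr -big_split.
by apply: eq_bigr => i _; rewrite linearP /= mulmxDl scalemxAl.
Qed.
HB.instance Definition _ := GRing.isLinear.Build F _ _ _ res_act res_act_linear.

Definition mx_res : 'M[F]_(m * N, n * N) := lin_mx res_act.

End RestrictionAction.

Section Restriction.
Variables (L E : fieldType) (io : {rmorphism L -> E}) (N : nat).
Variables (rho : E -> 'M[L]_N) (v : 'rV[E]_N) (w : 'cV[E]_N).
Hypotheses (rho1 : rho 1 = 1%:M) (rhoD : {morph rho : a b / a + b})
  (rhoM : forall a b, rho (a * b) = rho a *m rho b).
Notation Res := (mx_res rho).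

Lemma rho0 : rho 0 = 0.
Proof. by apply: (addIr (rho 0)); rewrite -rhoD !add0r. Qed.

Lemma mx_vec_eq m n (A B : 'M[L]_(m * N, n * N)) :
  (forall U : 'M_(m, N), mxvec U *m A = mxvec U *m B) -> A = B.
Proof.
by move=> AB; apply/row_matrixP => i; rewrite !rowE -[delta_mx 0 i]vec_mxK AB.
Qed.

Lemma mx_resM m n p (A : 'M[E]_(m, n)) (B : 'M[E]_(n, p)) : Res (A *m B) = Res A *m Res B.
Proof.
apply: mx_vec_eq => U; rewrite mulmxA !mul_vec_lin /=; congr mxvec.
apply/row_matrixP => k; rewrite !rowK.
transitivity (\sum_j \sum_i row i U *m rho (A i j) *m rho (B j k)).
  rewrite exchange_big; apply: eq_bigr => i _ /=.
  rewrite mxE (big_morph rho rhoD rho0) mulmx_sumr.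
  by apply: eq_bigr => j _; rewrite rhoM mulmxA.
by apply: eq_bigr => j _; rewrite rowK mulmx_suml.
Qed.

Lemma mx_resD m n (A B : 'M[E]_(m, n)) : Res (A + B) = Res A + Res B.
Proof.
apply: mx_vec_eq => U; rewrite mulmxDr !mul_vec_lin /= -linearD; congr mxvec.
apply/row_matrixP => k; rewrite linearD /= !rowK -big_split.
by apply: eq_bigr => i _; rewrite mxE rhoD mulmxDr.
Qed.

Lemma mx_res0 m n : Res (0 : 'M[E]_(m, n)) = 0.
Proof. by apply: (addIr (Res 0)); rewrite -mx_resD !add0r. Qed.

Lemma mx_res1 m : Res (1%:M : 'M[E]_m) = 1%:M.
Proof.
apply: mx_vec_eq => U; rewrite mulmx1 mul_vec_lin /=; congr mxvec.
apply/row_matrixP => k; rewrite rowK (bigD1 k) //= big1 => [|i nik].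
  by rewrite mxE eqxx rho1 mulmx1 addr0.
by rewrite mxE (negPf nik) rho0 mulmx0.
Qed.

Lemma mx_res_rank m n (A : 'M[E]_(m, n)) : \rank (Res A) = (\rank A * N)%N.
Proof.
apply/eqP; rewrite eqn_leq; apply/andP; split.
  rewrite -{1}(mulmx_base A) mx_resM.
  exact: leq_trans (mxrankM_maxl _ _) (rank_leq_col _).
have [l lc] : exists l, l *m col_base A = 1%:M by apply/row_fullP/col_base_full.
have [r cr] : exists r, row_base A *m r = 1%:M by apply/row_freeP/row_base_free.
have E1 : Res l *m Res A *m Res r = 1%:M.
  have : Res A = Res (col_base A) *m Res (row_base A) by rewrite -mx_resM mulmx_base.
  move: (col_base A) (row_base A) l lc r cr => c k l lc r cr ->.
  by rewrite mulmxA -mx_resM lc -mulmxA -mx_resM cr mx_res1 mulmx1.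
rewrite -(mxrank1 L (\rank A * N)) -E1.
exact: leq_trans (mxrankM_maxl _ _) (mxrankM_maxr _ _).
Qed.

Lemma mx_resX m (A : 'M[E]_m) k : Res (A ^+ k) = Res A ^+ k.
Proof.
elim: k => [|k IH]; first by rewrite !expr0 mx_res1.
by rewrite !exprS -!mulmxE mx_resM IH.
Qed.

Definition md_res (G : finType) D (T : md G E D) : md G L (D * N) := [ffun g => Res (T g)].

Lemma lf_res (Q : mquiver) D (T : md (op Q) E D) : lf T -> lf (md_res T).
Proof.
move=> /asboolP [rT rkT]; apply/asboolP; split=> [|i]; last first.
  by rewrite [md_res T]/md_res !ffunE -mx_resX -mx_resM !mx_res_rank rkT ffunE mulnA.
apply: (@mrel_morph _ _ _ _ _ (fun A => Res A) (fun=> True)) rT => //.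
- by move=> g; rewrite ffunE.
- exact: mx_res0.
- exact: mx_res1.
- exact: mx_resD.
- by move=> A B _ _; apply: mx_resM.
Qed.

Hypotheses (vw : v *m w = 1%:M) (vrho : forall c, v *m map_mx io (rho c) = c *: v)
  (rhow : forall c, map_mx io (rho c) *m w = c *: w).

Lemma map_mx_res m n (A : 'M[E]_(m, n)) :
  map_mx io (Res A) = lin_mx (res_act (fun c => map_mx io (rho c)) A).
Proof.
apply: map_lin_mx => U; apply/row_matrixP => j; rewrite -map_row !rowK map_mx_sum.
by apply: eq_bigr => i _; rewrite map_mxM map_row.
Qed.

(** Coordinate by coordinate, [w] projects the extension of the restriction onto the part where E
    acts through its own scalars, and [v] embeds that part back. *)
Lemma mdvd_res (G : finType) D (Y : md G E D) : mdvd Y (mbase io (md_res Y)).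
Proof.
pose i : 'M[E]_(D, D * N) := lin1_mx (mxvec \o mulmxr v \o trmx).
pose p : 'M[E]_(D * N, D) := lin1_mx (trmx \o mulmxr w \o vec_mx).
have iE (u : 'rV_D) : u *m i = mxvec (u^T *m v) by rewrite mul_rV_lin1.
have pE (U : 'M_(D, N)) : mxvec U *m p = (U *m w)^T by rewrite mul_rV_lin1 /= mxvecK.
have row_eq m (A B : 'M[E]_(D, m)) : (forall u : 'rV_D, u *m A = u *m B) -> A = B.
  by move=> AB; apply/row_matrixP => a; rewrite !rowE AB.
have rowu (u : 'cV[E]_D) a : row a (u *m v) = u a 0 *: v.
  by rewrite row_mul; apply/rowP => b; rewrite !mxE big_ord1 !mxE.
exists i, p; split.
- apply/mhomP => g; rewrite !ffunE map_mx_res; apply: row_eq => u.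
  rewrite !mulmxA !iE mul_vec_lin /=; congr mxvec; apply/row_matrixP => b.
  rewrite rowK rowu; transitivity (\sum_a (u 0 a * Y g a b) *: v).
    by rewrite -scaler_suml; congr (_ *: _); rewrite !mxE.
  by apply: eq_bigr => a _; rewrite rowu -scalemxAl vrho scalerA mxE.
- apply/mhomP => g; rewrite !ffunE map_mx_res.
  apply/row_matrixP => a; rewrite !rowE -[delta_mx 0 a]vec_mxK.
  move: (vec_mx _) => U; rewrite !mulmxA mul_vec_lin /= !pE.
  apply/rowP => b; rewrite mxE.
  have -> : (res_act (fun c => map_mx io (rho c)) (Y g) U *m w) b 0 =
     (row b (res_act (fun c => map_mx io (rho c)) (Y g) U) *m w) 0 0.
    by rewrite -row_mul [RHS]mxE.
  rewrite rowK mulmx_suml summxE mxE; apply: eq_bigr => c _.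
  by rewrite -mulmxA rhow -scalemxAr -row_mul !mxE mulrC.
- apply: row_eq => u; rewrite mulmxA iE pE -mulmxA vw mulmx1 trmxK mulmx1 //.
Qed.

End Restriction.

Lemma restriction_exists (Q : mquiver) (L E : finFieldType) (io : {rmorphism L -> E}) N D
    (Y : md (op Q) E D) : #|E| = (#|L| ^ N.+1)%N -> lf Y ->
  exists T : md (op Q) L (D * N.+1), lf T /\ mdvd Y (mbase io T).
Proof.
move=> cE lY; have [rho [v [w [r1 rD rM vw h]]]] := regular_rep io cE.
exists (md_res rho Y); split; first exact: lf_res.
by apply: (@mdvd_res _ _ _ _ _ v w) => // c; case: (h c).
Qed.

Lemma dvdn_predX_inv q a b : (1 < q)%N -> (0 < a)%N ->
  ((q ^ a).-1 %| (q ^ b).-1)%N -> (a %| b)%N.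
Proof.
move=> q1 a0; rewrite (divn_eq b a); set k := (b %/ a)%N; have := ltn_pmod b a0.
move: (b %% a)%N => r lt_ra h; rewrite dvdn_addr ?dvdn_mull //.
suff -> : r = 0%N by rewrite dvdn0.
have qa x : (0 < q ^ x)%N by rewrite expn_gt0 (ltnW q1).
have h1 : ((q ^ a).-1 %| (q ^ (k * a)).-1)%N.
  by rewrite mulnC expnM; apply: dvdn_pred_predX.
have E : ((q ^ (k * a + r)).-1 = (q ^ (k * a)).-1 * q ^ r + (q ^ r).-1)%N.
  rewrite expnD -[(q ^ (k * a))%N in LHS]prednK // mulSn addnC.
  by rewrite -[X in (_ + X).-1]prednK // addnS.
move: h; rewrite E dvdn_addr; last exact: dvdn_mulr.
move=> /dvdn_leq; case: r lt_ra {E} => // r lt_ra.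
have lt1 : (1 < q ^ r.+1)%N by rewrite -(expn0 q) ltn_exp2l.
have lt2 : ((q ^ r.+1).-1 < (q ^ a).-1)%N.
  by rewrite -!subn1 ltn_sub2r ?ltn_exp2l // -(expn0 q) ltn_exp2l.
have p0 : (0 < (q ^ r.+1).-1)%N by rewrite -subn1 subn_gt0.
by move=> /(_ p0); rewrite leqNgt lt2.
Qed.

Lemma mabs_iso (G : finType) (K : fieldType) D1 D2 (T1 : md G K D1) (T2 : md G K D2) :
  miso T1 T2 -> mabs T1 -> mabs T2.
Proof.
move=> iT [D0 h]; split; first by rewrite -(miso_dim iT).
move: iT => [i [p [hi hp ip pi]]] A hA.
have [c [k ck]] := h (i *m A *m p) (mhomM (mhomM hi hA) hp).
exists c, k; have AE : A - c%:M = p *m (i *m A *m p - c%:M) *m i.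
  rewrite mulmxBr mulmxBl mul_mx_scalar -scalemxAl pi scalemx1.
  by rewrite !mulmxA pi mul1mx -mulmxA pi mulmx1.
by rewrite AE conjmxX // ck mulmx0 mul0mx.
Qed.

Lemma summand_lf (Q : mquiver) (K : fieldType) D1 D2 (Y : md (op Q) K D1) (T : md (op Q) K D2) :
  mdvd Y T -> lf T -> lf Y.
Proof.
by move=> /mdvd_complement [D' [S iS]]; rewrite (lf_isoE iS) lf_osum => /andP [].
Qed.

(** The degree over L of the residue field of an indecomposable [X], see [rdeg_spec]. *)
Definition rdeg (Q : mquiver) (L : finFieldType) d (X : md (op Q) L d) : nat :=
  trunc_log #|L| (qres X).

Definition absclass (Q : mquiver) (E : finFieldType) D (Y : md (op Q) E D) : bool :=
  indclass Y && `[< mabs Y >].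

Definition nabs (Q : mquiver) (E : finFieldType) (s : {ffun vert Q -> nat}) : nat :=
  #|[set Y : md (op Q) E (dimr s) | absclass Y && (mrk Y == s)]|.

(** * Absolutely indecomposables over an extension, counted over the base *)

Section CountExtension.
Variables (Q : mquiver) (L E : finFieldType) (io : {rmorphism L -> E}) (N : nat).
Hypotheses (N0 : (0 < N)%N) (cE : #|E| = (#|L| ^ N)%N).

Lemma rdeg_spec d (X : md (op Q) L d) : mindec X ->
  qres X = (#|L| ^ rdeg X)%N /\ (0 < rdeg X)%N.
Proof.
case: d X => [|d] X indX; first by case: indX.
have [th [hth uth thQ gen ord]] := teichmuller indX.
have QE := qres_degree indX hth thQ gen.
have E1 : rdeg X = degree_mxminpoly th by rewrite /rdeg QE trunc_expnK // finNzRing_gt1.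
by rewrite E1 -QE; split=> //; apply: mxminpoly_nonconstant.
Qed.

(** All depends on whether th^|E| = th, that is, whether E contains the residue field. If not,
    [abs_dvd_fixed] leaves no absolutely indecomposable summand; if so, the summands are the
    eigenspaces of [th], pairwise non-isomorphic, complete, and of the common rank vector rk X /
    [rdeg X]. *)
Lemma count_summands d (X : md (op Q) L d) (s : {ffun vert Q -> nat}) : indclass X ->
  #|[set Y : md (op Q) E (dimr s) |
      [&& absclass Y, mrk Y == s & `[< mdvd Y (mbase io X) >]]]| =
  if (rdeg X %| N)%N && (mrk X == [ffun i => rdeg X * s i]%N) then rdeg X else 0%N.
Proof.
move=> /indclassP [lX indX _]; have [QE' rd0] := rdeg_spec indX.
case: d X lX indX QE' rd0 => [|d] X lX indX QE' rd0; first by case: indX.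
have [th [hth uth thQ gen ord]] := teichmuller indX.
have QE := qres_degree indX hth thQ gen.
have q1 := finNzRing_gt1 L.
have dgE : degree_mxminpoly th = rdeg X.
  by apply/eqP; rewrite -(eqn_exp2l _ _ q1) -QE -QE'.
have [tE|ntE] := eqVneq (map_mx io th ^+ #|E|) (map_mx io th); last first.
  rewrite ifF; last first.
    apply: contraNF ntE => /andP [/dvdnP [k Nk] _].
    have -> : #|E| = (qres X ^ k)%N by rewrite QE' -expnM mulnC -Nk.
    rewrite -map_mxX; apply/eqP; congr map_mx.
    by elim: k {Nk} => [|k IH]; rewrite ?expr1 // expnSr exprM IH.
  apply/eqP; rewrite cards_eq0; apply/eqP/setP => Y; rewrite !inE.
  apply/negP => /and3P [/andP [_ /asboolP aY] _ /asboolP dY].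
  by case/eqP: ntE; apply: (abs_dvd_fixed indX hth thQ gen aY).
(* [th] has order Q - 1 modulo the radical, so |L|^(rdeg X) - 1 divides |L|^N - 1. *)
have dvdN : (rdeg X %| N)%N.
  apply: (dvdn_predX_inv q1 rd0); rewrite -QE' -cE; apply: ord.
  have thE : th ^+ #|E| = th by apply: (map_mx_inj (f := io)); rewrite map_mxX.
  have e0 : (0 < #|E|)%N by apply/ltnW/finNzRing_gt1.
  suff -> : th ^+ #|E|.-1 = 1%:M by rewrite subrr mrad0.
  by rewrite -[LHS](mulmxK uth) mulmxE -exprSr prednK // thE -mulmxE mulmxV.
have [x0 x0L] := eigset_exists io th.
pose s0 := eigrank io X th x0.
have mX i : mrk X i = (rdeg X * s0 i)%N.
  by rewrite -dgE; apply: (mrk_eigrank indX hth uth thQ gen ord tE).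
have sE : (mrk X == [ffun i => rdeg X * s i]%N) = (s == s0).
  apply/eqP/eqP => [E1|->]; apply/ffunP => i; last by rewrite mX [RHS]ffunE.
  by apply/eqP; rewrite -(eqn_pmul2l rd0) -mX E1 [X in _ == X]ffunE.
rewrite dvdN sE /=.
have sconst x : x \in eigset io th -> eigrank io X th x = s0.
  by move=> xL; apply: (eigrank_const indX hth uth thQ gen ord tE).
have /choice [f fP] : forall x, exists Y : md (op Q) E (dimr s0), x \in eigset io th ->
    exists k c, [/\ mhom Y (mbase io X) k, mhom (mbase io X) Y c, k *m c = 1%:M,
      c *m k = eidem (map_mx io th) x & [/\ lf Y, mrk Y = s0 & mabs Y]].
  move=> x; have [xL|nx] := boolP (x \in eigset io th); last by exists [ffun=> 0].
  have := eig_summand indX lX hth gen tE xL; rewrite (sconst x xL) => -[Y h].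
  by exists Y.
have complete D (Y : md (op Q) E D) : mindec Y -> mdvd Y (mbase io X) ->
    exists2 x, x \in eigset io th & miso Y (f x).
  move=> indY dY; have [x xL h] := eig_summand_complete hth indY dY.
  exists x => //; have [k [c [hk hc kc ck [_ _ aY]]]] := fP x xL.
  exact: h hk hc kc ck (mabs_indec aY).
case: eqP => [ss|ns]; last first.
  apply/eqP; rewrite cards_eq0; apply/eqP/setP => Y; rewrite !inE.
  apply/negP => /and3P [/andP [/indclassP [_ indY _] _] /eqP sY /asboolP dY].
  have [x xL iY] := complete _ Y indY dY.
  have [_ [_ [_ _ _ _ [_ mf _]]]] := fP x xL.
  by case: ns; rewrite -sY (mrk_iso iY).
subst s; rewrite -dgE.
have [_ <-] := eigset_orbit indX hth uth thQ gen ord tE x0L.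
rewrite -(@card_in_imset _ _ (fun x => mcanon (f x))); last first.
  move=> x y xL yL exy; have [k [c [hk hc kc ck _]]] := fP x xL.
  have [k' [c' [hk' hc' kc' ck' _]]] := fP y yL.
  apply: (eig_summand_neq indX hth gen tE hk hc kc ck hk' hc' kc' ck' xL).
  by apply: miso_trans (mcanon_iso (f x)) _; rewrite exy; apply/miso_sym/mcanon_iso.
apply: eq_card => Y; rewrite inE; apply/idP/imsetP => [/and3P [/andP [/indclassP [lY indY cY] aY] sY /asboolP dY]|[x xL ->]].
  have [x xL iY] := complete _ Y indY dY.
  by exists x => //; rewrite -(mcanon_eq iY) cY.
have [k [c [hk hc kc ck [lf' mf' aY']]]] := fP x xL.
have iC := mcanon_iso (f x).
apply/and3P; split.
- apply/andP; split; last exact/asboolP/(mabs_iso iC).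
  apply/indclassP; split; first exact: lf_iso iC lf'.
    exact: mindec_iso iC (mabs_indec aY').
  by apply: mcanon_eq; apply: miso_sym.
- by rewrite -(mrk_iso iC) mf'.
- apply/asboolP; apply: mdvd_trans (miso_mdvd (miso_sym iC)) _.
  by exists k, c.
Qed.

(** Each [Y] occurs in the extension of exactly one class over L: existence by restricting scalars,
    uniqueness by [mdvd_base_unique]. The bound on [B] is the size of the restriction of [Y], of
    which that class is a summand. *)
Lemma nabs_sum (s : {ffun vert Q -> nat}) B : (dimr s * N < B)%N ->
  nabs E s = (\sum_(d < B) \sum_(X : md (op Q) L d | indclass X)
    if (rdeg X %| N) && (mrk X == [ffun i => rdeg X * s i]%N) then rdeg X else 0)%N.
Proof.
move=> ltB.
have E1 (Y : md (op Q) E (dimr s)) : absclass Y && (mrk Y == s) ->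
    (\sum_(d < B) \sum_(X : md (op Q) L d | indclass X) `[< mdvd Y (mbase io X) >] = 1)%N.
  move=> /andP [/andP [/indclassP [lY indY _] _] _].
  have [N' EN] : exists N', N = N'.+1 by exists N.-1; rewrite prednK.
  have cE' := cE; rewrite EN in cE' ltB.
  have [T [lT dYT]] := restriction_exists io cE' lY.
  have [d0 [X' [indX' dX' dYX']]] := mdvd_base_indec indY dYT.
  have lX' := summand_lf dX' lT.
  have ltd : (d0 < B)%N by apply: leq_ltn_trans (mdvd_dim dX') ltB.
  have iC := mcanon_iso X'.
  have cC : indclass (mcanon X').
    apply/indclassP; split; [exact: lf_iso iC lX'|exact: mindec_iso iC indX'|].
    by apply: mcanon_eq; apply: miso_sym.
  have dC : mdvd Y (mbase io (mcanon X')).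
    exact: mdvd_trans dYX' (miso_mdvd (mbase_iso io iC)).
  have indC := mindec_iso iC indX'.
  rewrite (bigD1 (Ordinal ltd)) //= (bigD1 (mcanon X')) //=.
  rewrite big1 => [|X /andP [cX nX]]; last first.
    apply/eqP; rewrite eqb0; apply/negP => /asboolP dX.
    have [_ indX _] := indclassP _ cX.
    have iX := mdvd_base_unique indY.1 indC indX dC dX.
    by case/eqP: nX; rewrite (indclass_iso (erefl d0) cC cX iX).
  rewrite big1 => [|d nd]; last first.
    apply: big1 => X cX; apply/eqP; rewrite eqb0; apply/negP => /asboolP dX.
    have [_ indX _] := indclassP _ cX.
    have /miso_dim e := mdvd_base_unique indY.1 indC indX dC dX.
    by case/eqP: nd; apply: val_inj.
  by rewrite asboolT.
rewrite /nabs -sum1_card.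
rewrite (eq_bigl (fun Y => absclass Y && (mrk Y == s))) => [|Y]; last by rewrite inE.
rewrite -(eq_bigr _ E1) exchange_big /=; apply: eq_bigr => d _.
rewrite exchange_big /=; apply: eq_bigr => X cX; rewrite -count_summands //.
rewrite -sum1_card big_mkcond [RHS]big_mkcond; apply: eq_bigr => Y _.
by rewrite inE andbA; case: (_ && _) => //=; case: asboolP.
Qed.

(** Over the extension of degree exactly [rdeg X], [X] splits into that many eigenspaces with equal
    rank vectors. *)
Lemma rdeg_dvd d (X : md (op Q) L d) : lf X -> mindec X -> N = rdeg X ->
  exists s, mrk X = [ffun i => rdeg X * s i]%N.
Proof.
move=> lX indX EN; have [QE' rd0] := rdeg_spec indX.
case: d X lX indX EN QE' rd0 => [|d] X lX indX EN QE' rd0; first by case: indX.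
have [th [hth uth thQ gen ord]] := teichmuller indX.
have QE := qres_degree indX hth thQ gen.
have dgE : degree_mxminpoly th = rdeg X.
  by apply/eqP; rewrite -(eqn_exp2l _ _ (finNzRing_gt1 L)) -QE -QE'.
have tE : map_mx io th ^+ #|E| = map_mx io th by rewrite cE EN -QE' -map_mxX thQ.
have [x0 x0L] := eigset_exists io th.
exists (eigrank io X th x0); apply/ffunP => i; rewrite [RHS]ffunE -dgE.
exact: (mrk_eigrank indX hth uth thQ gen ord tE).
Qed.

End CountExtension.

(** * Representations in coordinates *)

Section Coordinates.
Variables (Q : mquiver) (K : fieldType).
Implicit Types r s : vert Q -> nat.

Definition vsp r : Type := forall i : vert Q, rmod K r i.

Definition vidx r : finType := {i : vert Q & ('I_(mult i) * 'I_(r i))%type}.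

Lemma card_vidx r : #|vidx r| = dimr r.
Proof.
rewrite card_tagged sumnE big_map big_enum; apply: eq_bigr => i _.
by rewrite card_prod !card_ord.
Qed.

Definition vdec r (a : 'I_(dimr r)) : vidx r := enum_val (cast_ord (esym (card_vidx r)) a).
Definition venc r (b : vidx r) : 'I_(dimr r) := cast_ord (card_vidx r) (enum_rank b).

Lemma vdecK r : cancel (@vdec r) (@venc r).
Proof. by move=> a; rewrite /venc /vdec enum_valK cast_ordKV. Qed.

Lemma vencK r : cancel (@venc r) (@vdec r).
Proof. by move=> b; rewrite /venc /vdec cast_ordK enum_rankK. Qed.

Definition vpos r i (k : 'I_(mult i)) (j : 'I_(r i)) : 'I_(dimr r) :=
  venc (Tagged (fun i => ('I_(mult i) * 'I_(r i))%type) (k, j)).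

Definition vcoord r (v : vsp r) : 'rV[K]_(dimr r) :=
  \row_a (let b := vdec a in (v (tag b) (tagged b).2 0 : {poly K})`_(tagged b).1).

Definition vuncoord r (u : 'rV[K]_(dimr r)) : vsp r :=
  fun i => \col_j \sum_(k < mult i) (u 0 (vpos k j))%:A * 'qX ^+ k.

Lemma vcoordE r (v : vsp r) i k j : vcoord v 0 (vpos k j) = (v i j 0 : {poly K})`_k.
Proof. by rewrite mxE /= vencK. Qed.

Lemma vposP r (P : 'I_(dimr r) -> Prop) :
  (forall i (k : 'I_(mult i)) (j : 'I_(r i)), P (vpos k j)) -> forall a, P a.
Proof. by move=> h a; rewrite -(vdecK a); case: (vdec a) => i [k j]; apply: h. Qed.

Lemma coef_poly_qX n (c : 'I_n -> K) (l : 'I_n) : (0 < n)%N ->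
  ((\sum_(k < n) (c k)%:A * 'qX ^+ k : tpoly K n) : {poly K})`_l = c l.
Proof.
move=> n0; rewrite poly_of_qpoly_sum coef_sum (bigD1 l) //= big1 => [|k nkl].
  by rewrite coef_tpoly_alg coef_qXn // eqxx mulr1 addr0.
by rewrite coef_tpoly_alg coef_qXn // -[val l == val k]/(l == k) eq_sym (negPf nkl) mulr0.
Qed.

Lemma vcoordK r : cancel (@vcoord r) (@vuncoord r).
Proof.
move=> v; apply: functional_extensionality_dep => i; apply/matrixP => j b; rewrite mxE ord1.
rewrite [RHS]tpoly_basis ?mult_gt0 //.
by apply: eq_bigr => k _; rewrite vcoordE.
Qed.

Lemma vuncoordK r : cancel (@vuncoord r) (@vcoord r).
Proof.
move=> u; apply/rowP; apply: vposP => i k j; rewrite vcoordE mxE.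
by rewrite (coef_poly_qX (fun k => u 0 (vpos k j))) // mult_gt0.
Qed.

Definition vlin r (c : K) (u v : vsp r) : vsp r := fun i => c%:A *: u i + v i.

Lemma vcoord_lin r c (u v : vsp r) : vcoord (vlin c u v) = c *: vcoord u + vcoord v.
Proof.
apply/rowP; apply: vposP => i k j; rewrite vcoordE [RHS]mxE [X in _ = X + _]mxE !vcoordE.
by rewrite !mxE coefD coef_tpoly_alg.
Qed.

Definition klin r s (f : vsp r -> vsp s) :=
  forall c u v, f (vlin c u v) = vlin c (f u) (f v).

Lemma row_linE m n (g : 'rV[K]_m -> 'rV[K]_n) :
  (forall c u v, g (c *: u + v) = c *: g u + g v) ->
  forall u, g u = u *m \matrix_a g (delta_mx 0 a).
Proof.
move=> gL u.
have g0 : g 0 = 0 by have := gL (-1) 0 0; rewrite scaler0 addr0 scaleN1r addNr.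
have gD u1 u2 : g (u1 + u2) = g u1 + g u2 by have := gL 1 u1 u2; rewrite !scale1r.
have gZ c u1 : g (c *: u1) = c *: g u1 by have := gL c u1 0; rewrite g0 !addr0.
rewrite {1}[u]row_sum_delta (big_morph g gD g0) mulmx_sum_row.
by apply: eq_bigr => a _; rewrite gZ rowK.
Qed.

Definition mxof r s (f : vsp r -> vsp s) : 'M[K]_(dimr r, dimr s) :=
  \matrix_a vcoord (f (vuncoord (delta_mx 0 a))).

Lemma vuncoord_lin r c (u v : 'rV[K]_(dimr r)) :
  vuncoord (c *: u + v) = vlin c (vuncoord u) (vuncoord v).
Proof. by apply: (can_inj (@vcoordK r)); rewrite vcoord_lin !vuncoordK. Qed.

Lemma mxofE r s (f : vsp r -> vsp s) v : klin f -> vcoord v *m mxof f = vcoord (f v).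
Proof.
move=> fL; rewrite -(row_linE (g := fun u => vcoord (f (vuncoord u)))) ?vcoordK //.
by move=> c u1 u2; rewrite vuncoord_lin fL vcoord_lin.
Qed.

Lemma mx_ext r n (A B : 'M[K]_(dimr r, n)) :
  (forall v : vsp r, vcoord v *m A = vcoord v *m B) -> A = B.
Proof. by move=> AB; apply/row_matrixP => a; rewrite !rowE -[delta_mx 0 a]vuncoordK AB. Qed.

Definition funmx r s (A : 'M[K]_(dimr r, dimr s)) (v : vsp r) : vsp s := vuncoord (vcoord v *m A).

Lemma funmx_lin r s (A : 'M[K]_(dimr r, dimr s)) : klin (funmx A).
Proof. by move=> c u v; rewrite /funmx vcoord_lin mulmxDl -scalemxAl vuncoord_lin. Qed.

Lemma mxofK r s (A : 'M[K]_(dimr r, dimr s)) : mxof (funmx A) = A.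
Proof. by apply: mx_ext => v; rewrite mxofE ?vuncoordK //; apply: funmx_lin. Qed.

Lemma funmxE r s (A : 'M[K]_(dimr r, dimr s)) v : vcoord (funmx A v) = vcoord v *m A.
Proof. by rewrite /funmx vuncoordK. Qed.

Lemma klin_comp r s t (f : vsp r -> vsp s) (g : vsp s -> vsp t) :
  klin f -> klin g -> klin (g \o f).
Proof. by move=> fL gL c u v; rewrite /= fL gL. Qed.

Lemma mxof_comp r s t (f : vsp r -> vsp s) (g : vsp s -> vsp t) : klin f -> klin g ->
  mxof f *m mxof g = mxof (g \o f).
Proof.
move=> fL gL; apply: mx_ext => v; rewrite mulmxA !mxofE //.
by move=> c u w; rewrite /= fL gL.
Qed.

Lemma mxof_inj r s (f g : vsp r -> vsp s) : klin f -> klin g -> mxof f = mxof g ->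
  forall v, f v = g v.
Proof.
by move=> fL gL fg v; apply: (can_inj (@vcoordK s)); rewrite -!mxofE // fg.
Qed.

Lemma eq_mxof r s (f g : vsp r -> vsp s) : (forall v, f v = g v) -> mxof f = mxof g.
Proof. by move=> fg; apply/row_matrixP => a; rewrite !rowK fg. Qed.

Definition vat r i (w : rmod K r i) : vsp r := dfwith (fun i' => 0 : rmod K r i') w.

Lemma vat_in r i (w : rmod K r i) : vat w i = w.
Proof. exact: dfwith_in. Qed.

Lemma vat_out r i i' (w : rmod K r i) : i != i' -> vat w i' = 0.
Proof. exact: dfwith_out. Qed.

Lemma vsp_eq r (u v : vsp r) : (forall i, u i = v i) -> u = v.
Proof. exact: functional_extensionality_dep. Qed.

Lemma vat_lin r i c (u v : rmod K r i) : vat (c%:A *: u + v) = vlin c (vat u) (vat v).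
Proof.
apply: vsp_eq => i'; rewrite /vlin; have [e|ne] := eqVneq i i'.
  by subst i'; rewrite !vat_in.
by rewrite !vat_out // scaler0 addr0.
Qed.

Definition opfV r i : vsp r -> vsp r := fun v => vat (v i).
Definition opfT r : vsp r -> vsp r := fun v i => 'qX *: v i.
Definition opfA r (x : rep K r) a : vsp r -> vsp r := fun v => vat (x a (v (src a))).

Lemma opfV_lin r i : klin (@opfV r i).
Proof. by move=> c u v; rewrite /opfV -vat_lin. Qed.

Lemma opfT_lin r : klin (@opfT r).
Proof.
move=> c u v; apply: vsp_eq => i; rewrite /opfT /vlin scalerDr !scalerA.
by rewrite [_ * 'qX]mulrC.
Qed.

Lemma opfA_lin r (x : rep K r) a : klin (opfA x a).
Proof.
move=> c u v; rewrite /opfA -vat_lin.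
have E : x a (c%:A *: u (src a) + v (src a)) = c%:A *: x a (u (src a)) + x a (v (src a)).
  by rewrite (@rep_mapD Q K r x a (_ *: _) (v (src a))) (@rep_mapZ Q K r x a c (u (src a))).
by rewrite -E.
Qed.

Definition md_of r (x : rep K r) : md (op Q) K (dimr r) :=
  [ffun g : op Q => match g with
    | inl i => mxof (@opfV r i)
    | inr None => mxof (@opfT r)
    | inr (Some a) => mxof (opfA x a)
    end].

Definition famact r s (g : forall i, 'M[tpoly K (mult i)]_(s i, r i)) : vsp r -> vsp s :=
  fun v i => g i *m v i.

Lemma famact_lin r s (g : forall i, 'M[tpoly K (mult i)]_(s i, r i)) : klin (famact g).
Proof. by move=> c u v; apply: vsp_eq => i; rewrite /famact /vlin mulmxDr -scalemxAr. Qed.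

Lemma famact_vat r s (g : forall i, 'M[tpoly K (mult i)]_(s i, r i)) i w :
  famact g (vat w) = vat (g i *m w).
Proof.
apply: vsp_eq => i'; rewrite /famact; have [e|ne] := eqVneq i i'.
  by subst i'; rewrite !vat_in.
by rewrite !vat_out // mulmx0.
Qed.

Lemma mxof_famact_inj r s (g h : forall i, 'M[tpoly K (mult i)]_(s i, r i)) :
  mxof (famact g) = mxof (famact h) -> g = h.
Proof.
move=> gh; apply: functional_extensionality_dep => i.
have E := mxof_inj (famact_lin g) (famact_lin h) gh.
apply/matrixP => a b; have := congr1 (fun v : vsp s => v i a 0) (E (vat (delta_mx b 0))).
by rewrite /famact vat_in -!colE !mxE.
Qed.

Definition intertwines r s (x : rep K r) (y : rep K s)
    (g : forall i, 'M[tpoly K (mult i)]_(s i, r i)) : Prop :=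
  forall a v, g (tgt a) *m x a v = y a (g (src a) *m v).

Lemma mhom_famact r s (x : rep K r) (y : rep K s) g :
  mhom (md_of x) (md_of y) (mxof (famact g)) <-> intertwines x y g.
Proof.
split=> [/mhomP h a v|h].
  have := h (opA a); rewrite !ffunE !mxof_comp; try exact: famact_lin; try exact: opfA_lin.
  have lx := klin_comp (opfA_lin x a) (famact_lin g).
  have ly := klin_comp (famact_lin g) (opfA_lin y a).
  move=> /(mxof_inj lx ly) /(_ (vat v)) /(congr1 (fun u : vsp s => u (tgt a))).
  by rewrite /= /opfA famact_vat /famact !vat_in.
apply/mhomP => -[i|[a|]]; rewrite !ffunE !mxof_comp;
  try exact: famact_lin; try exact: opfA_lin; try exact: opfV_lin; try exact: opfT_lin;
  apply: eq_mxof => v /=.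
- by rewrite /opfV famact_vat.
- by rewrite /opfA famact_vat h.
- by apply: vsp_eq => i; rewrite /famact /opfT -scalemxAr.
Qed.

(** Commuting with the vertex projections cuts [A] into blocks, and commuting with t makes each
    block linear over K[t]/(t^n). *)
Lemma mhom_is_famact r s (A : 'M[K]_(dimr r, dimr s)) :
    (forall i, mxof (@opfV r i) *m A = A *m mxof (@opfV s i)) ->
    mxof (@opfT r) *m A = A *m mxof (@opfT s) ->
  exists g : forall i, 'M[tpoly K (mult i)]_(s i, r i), A = mxof (famact g).
Proof.
move=> hV hT; pose f := funmx A; have fL := @funmx_lin r s A : klin f.
have fE v : vcoord (f v) = vcoord v *m A := funmxE A v.
have fV i v : f (opfV i v) = opfV i (f v).
  apply: (can_inj (@vcoordK s)); by rewrite fE -!(mxofE _ (@opfV_lin _ _)) -mulmxA hV mulmxA fE.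
have fT v : f (opfT v) = opfT (f v).
  apply: (can_inj (@vcoordK s)); by rewrite fE -!(mxofE _ (@opfT_lin _)) -mulmxA hT mulmxA fE.
pose F i (w : rmod K r i) : rmod K s i := f (vat w) i.
have FL i c u v : F i (c%:A *: u + v) = c%:A *: F i u + F i v by rewrite /F vat_lin fL.
have F0 i : F i 0 = 0 by have := FL i (-1) 0 0; rewrite scaler0 addr0 !scaleN1r addNr.
have FD i u v : F i (u + v) = F i u + F i v by have := FL i 1 u v; rewrite !scale1r.
have FA i c u : F i (c%:A *: u) = c%:A *: F i u by have := FL i c u 0; rewrite F0 !addr0.
have FX i u : F i ('qX *: u) = 'qX *: F i u.
  rewrite /F; have -> : vat ('qX *: u) = opfT (vat u).
    apply: vsp_eq => i'; rewrite /opfT; have [e|ne] := eqVneq i i'; first by subst i'; rewrite !vat_in.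
    by rewrite !vat_out // scaler0.
  by rewrite fT.
have FXn i k u : F i ('qX ^+ k *: u) = 'qX ^+ k *: F i u.
  by elim: k => [|k IH]; rewrite ?expr0 ?scale1r // exprS -!scalerA FX IH.
have FZ i (p : tpoly K (mult i)) u : F i (p *: u) = p *: F i u.
  rewrite {1}[p]tpoly_basis ?mult_gt0 // {2}[p]tpoly_basis ?mult_gt0 //.
  rewrite !scaler_suml (big_morph _ (FD i) (F0 i)); apply: eq_bigr => k _.
  by rewrite -!scalerA FA FXn.
pose g i : 'M[tpoly K (mult i)]_(s i, r i) := \matrix_(h, j) F i (delta_mx j 0) h 0.
have gE i w : F i w = g i *m w.
  rewrite {1}[w]matrix_sum_delta (big_morph _ (FD i) (F0 i)).
  apply/matrixP => h b; rewrite ord1 summxE mxE; apply: eq_bigr => j _.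
  by rewrite big_ord1 FZ !mxE mulrC.
exists g; rewrite -[LHS]mxofK; apply: eq_mxof => v; rewrite -/f.
apply: vsp_eq => i; rewrite /famact -gE /F -[vat (v i)]/(opfV i v) fV.
by rewrite /opfV vat_in.
Qed.

Lemma mhom_md_of r s (x : rep K r) (y : rep K s) A : mhom (md_of x) (md_of y) A ->
  exists g, A = mxof (famact g) /\ intertwines x y g.
Proof.
move=> hA; have [||g gE] := @mhom_is_famact r s A.
- by move=> i; have := mhomP _ _ _ hA (opV i); rewrite !ffunE.
- by have := mhomP _ _ _ hA (opT Q); rewrite !ffunE.
by exists g; split=> //; apply/mhom_famact; rewrite -gE.
Qed.

End Coordinates.

Section MatrixModel.
Variables (Q : mquiver) (K : fieldType).
Implicit Types r s : vert Q -> nat.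

Lemma in_qpoly_tpoly n (p : tpoly K n) : (0 < n)%N -> in_qpoly 'X^n (p : {poly K}) = p.
Proof. by move=> n0; apply: tpolyP => // k lt_kn; rewrite coef_in_qpolyXn // lt_kn. Qed.

Lemma coef_qXM n (p : tpoly K n) k : (k < n)%N ->
  ('qX * p : {poly K})`_k = if k is l.+1 then (p : {poly K})`_l else 0.
Proof.
move=> lt_kn; have n0 : (0 < n)%N by apply: leq_ltn_trans lt_kn.
rewrite -{1}(in_qpoly_tpoly p n0) -rmorphM coef_in_qpolyXn // lt_kn coefXM.
by case: k lt_kn.
Qed.

Lemma qX_nilp n : (0 < n)%N -> ('qX ^+ n : tpoly K n) = 0.
Proof.
move=> n0; apply: tpolyP => // k lt_kn.
by rewrite -rmorphXn coef_in_qpolyXn // lt_kn coefXn coef0 (ltn_eqF lt_kn).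
Qed.

Lemma tpoly_extE m n (c : tpoly K m) : (0 < n)%N ->
  tpoly_ext n c = \sum_(i < size (c : {poly K})) ((c : {poly K})`_i)%:A * ('qX ^+ (n %/ m)) ^+ i.
Proof.
move=> n0; rewrite /tpoly_ext comp_polyE (big_morph (in_qpoly ('X^n : {poly K})) (@in_qpolyD _ _) (in_qpoly0 _)); apply: eq_bigr => i _.
by rewrite in_qpolyZ mulr_algl -!rmorphXn.
Qed.

(** K_m is generated over K by its t, which acts through t^(n1/m) and t^(n2/m); this is the form
    linearity takes in [mrelAT]. *)
Lemma hom_linearP (m n1 n2 r1 r2 : nat) (f : 'cV[tpoly K n1]_r1 -> 'cV[tpoly K n2]_r2) :
    (0 < n1)%N -> (0 < n2)%N ->
    (forall c u v, f (c%:A *: u + v) = c%:A *: f u + f v) ->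
    (forall u, f ('qX ^+ (n1 %/ m) *: u) = 'qX ^+ (n2 %/ m) *: f u) ->
  hom_linear m f.
Proof.
move=> n10 n20 fL fX.
have f0 : f 0 = 0 by have := fL (-1) 0 0; rewrite scaler0 addr0 !scaleN1r addNr.
have fD u v : f (u + v) = f u + f v by have := fL 1 u v; rewrite !scale1r.
have fA c u : f (c%:A *: u) = c%:A *: f u by have := fL c u 0; rewrite f0 !addr0.
have fXk k u : f (('qX ^+ (n1 %/ m)) ^+ k *: u) = ('qX ^+ (n2 %/ m)) ^+ k *: f u.
  elim: k => [|k IH]; first by rewrite !expr0 !scale1r.
  by rewrite !exprS -!scalerA fX IH.
move=> c u v; rewrite fD; congr (_ + _); rewrite !tpoly_extE // !scaler_suml.
rewrite (big_morph f fD f0); apply: eq_bigr => k _.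
by rewrite -!scalerA fA fXk.
Qed.

Lemma hom_linearX (m n1 n2 r1 r2 : nat) (f : 'cV[tpoly K n1]_r1 -> 'cV[tpoly K n2]_r2) u :
    (0 < m)%N -> (0 < n1)%N -> (0 < n2)%N -> hom_linear m f -> 
  f ('qX ^+ (n1 %/ m) *: u) = 'qX ^+ (n2 %/ m) *: f u.
Proof.
move=> m0 n10 n20 fL.
have f0 : f 0 = 0.
  apply: (addIr (f 0)); rewrite add0r.
  by have := fL 1 0 0; rewrite !tpoly_ext1 !scale1r addr0.
have eX n : (0 < n)%N -> tpoly_ext n ('qX : tpoly K m) = 'qX ^+ (n %/ m).
  move=> n0; case: (ltnP 1 m) => [lt1m|le_m1].
    rewrite /tpoly_ext.
    suff -> : (('qX : tpoly K m) : {poly K}) = 'X by rewrite comp_polyX -!rmorphXn.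
    by apply: in_qpoly_small; rewrite mk_monic_Xn prednK // size_polyXn size_polyX.
  (* In K_1 = K the class ['qX] is 0 and not represented by the polynomial ['X]; on the other side
     t^n is 0 in K_n. *)
  have -> : m = 1%N by apply/eqP; rewrite eqn_leq le_m1.
  rewrite divn1 qX_nilp //; apply: tpolyP => // k lt_kn.
  have -> : ('qX : tpoly K 1) = 0 by have := @qX_nilp 1 isT; rewrite expr1.
  by rewrite /tpoly_ext comp_poly0 in_qpoly0.
by have := fL 'qX u 0; rewrite !addr0 f0 addr0 !eX.
Qed.

Lemma rep_mapX r (x : rep K r) a u :
  x a ('qX ^+ (mult (src a) %/ agcd a) *: u) = 'qX ^+ (mult (tgt a) %/ agcd a) *: x a u.
Proof.
by apply: (hom_linearX (m := agcd a)); rewrite ?gcdn_gt0 ?mult_gt0 //; apply: rep_mapP.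
Qed.

Definition opfX r k : vsp K r -> vsp K r := fun v i => 'qX ^+ k *: v i.

Lemma opfX_lin r k : klin (@opfX r k).
Proof.
move=> c u v; apply: vsp_eq => i; rewrite /opfX /vlin scalerDr !scalerA.
by rewrite [_ * 'qX ^+ _]mulrC.
Qed.

Lemma mxof_id r : mxof (fun v : vsp K r => v) = 1%:M.
Proof. by apply: mx_ext => v; rewrite mxofE ?mulmx1. Qed.

Lemma mxof_opfTX r k : mxof (@opfT Q K r) ^+ k = mxof (@opfX r k).
Proof.
elim: k => [|k IH].
  by rewrite expr0 -[LHS]/(1%:M) -mxof_id; apply: eq_mxof => v; apply: vsp_eq => i; rewrite /opfX scale1r.
rewrite exprSr IH -mulmxE mxof_comp; [|exact: opfX_lin|exact: opfT_lin].
by apply: eq_mxof => v; apply: vsp_eq => i; rewrite /= /opfT /opfX scalerA -exprS.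
Qed.

Lemma opfX_vat r k i (w : rmod K r i) : opfX k (vat w) = vat ('qX ^+ k *: w).
Proof.
apply: vsp_eq => i'; rewrite /opfX; have [e|ne] := eqVneq i i'.
  by subst i'; rewrite !vat_in.
by rewrite !vat_out // scaler0.
Qed.

Lemma mxof0 r s : mxof (fun _ : vsp K r => (fun i => 0) : vsp K s) = 0.
Proof.
apply: mx_ext => v; rewrite mulmx0 mxofE => [|c u w].
  by apply/rowP; apply: vposP => i k j; rewrite vcoordE !mxE coef0.
by apply: vsp_eq => i; rewrite /vlin scaler0 addr0.
Qed.

Lemma mxof_opfV_sum r : \sum_i mxof (@opfV Q K r i) = 1%:M.
Proof.
apply: mx_ext => v; rewrite mulmx1 mulmx_sumr; apply/rowP; apply: vposP => i k j.
rewrite summxE (bigD1 i) //= big1 => [|i' ne].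
  by rewrite mxofE ?vcoordE ?addr0 /opfV ?vat_in //; apply: opfV_lin.
by rewrite mxofE ?vcoordE /opfV ?vat_out ?mxE ?coef0 //; apply: opfV_lin.
Qed.

Lemma mrel_md_of r (x : rep K r) : mrel (md_of x).
Proof.
have lV i := @opfV_lin Q K r i; have lT := @opfT_lin Q K r.
have lX k := @opfX_lin r k; have lA a := opfA_lin x a.
split=> [i j||i|i|a|a]; rewrite ?ffunE ?mxof_opfTX.
- rewrite mxof_comp //; case: (eqVneq i j) => [<-|ne].
    by apply: eq_mxof => v; rewrite /= /opfV vat_in.
  rewrite -mxof0; apply: eq_mxof => v; apply: vsp_eq => i'; rewrite /= /opfV.
  rewrite [vat (v i) j]vat_out //; have [e|ne'] := eqVneq j i'; last by rewrite vat_out.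
  by subst i'; rewrite vat_in.
- by rewrite -[RHS]mxof_opfV_sum; apply: eq_bigr => i _; rewrite ffunE.
- rewrite !mxof_comp //; apply: eq_mxof => v; rewrite /= /opfV -[opfT v i]/('qX *: v i).
  by have := opfX_vat 1 (v i); rewrite /opfX /opfT expr1.
- rewrite mxof_comp //  -mxof0; apply: eq_mxof => v; apply: vsp_eq => i'.
  rewrite /= opfX_vat qX_nilp ?mult_gt0 // scale0r.
  have [e|ne] := eqVneq i i'; last by rewrite vat_out.
  by subst i'; rewrite vat_in.
- rewrite mxof_comp // mxof_comp //; last exact: klin_comp.
  by apply: eq_mxof => v; rewrite /= /opfA /opfV !vat_in.
- rewrite !mxof_comp //; apply: eq_mxof => v.
  by rewrite /= /opfA opfX_vat -[opfX _ v _]/('qX ^+ _ *: v _) rep_mapX.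
Qed.

Lemma vcoord_vat r i (w : rmod K r i) i' (k : 'I_(mult i')) (j : 'I_(r i')) :
  i != i' -> vcoord (vat w) 0 (vpos k j) = 0.
Proof. by move=> ne; rewrite vcoordE vat_out // mxE coef0. Qed.

Lemma mrk_md_of_ge r (x : rep K r) i : (r i <= mrk (md_of x) i)%N.
Proof.
rewrite ffunE !ffunE mxof_opfTX mxof_comp; [|exact: opfV_lin|exact: opfX_lin].
set M := mxof _.
have n1 : ((mult i).-1 < mult i)%N by rewrite prednK ?mult_gt0.
(* [P] lists the generators e_j, which [M] sends to t^(n_i - 1) e_j, and [R] reads the coefficient
   of t^(n_i - 1). *)
pose P := \matrix_(j < r i) vcoord (vat (delta_mx j 0 : rmod K r i)).
pose R := \matrix_(a < dimr r, j < r i) (a == vpos (Ordinal n1) j)%:R : 'M[K]_(_, _).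
have lM : klin (@opfX r (mult i).-1 \o @opfV Q K r i).
  by apply: klin_comp; [exact: opfV_lin|exact: opfX_lin].
suff PMR : P *m M *m R = 1%:M.
  rewrite -[X in (X <= _)%N](mxrank1 K) -PMR.
  exact: leq_trans (mxrankM_maxl _ _) (mxrankM_maxr _ _).
apply/row_matrixP => j; rewrite 2!row_mul rowK mxofE //.
rewrite /= /opfV vat_in opfX_vat; apply/rowP => l; rewrite !mxE.
rewrite (bigD1 (vpos (Ordinal n1) l)) //= [X in _ + X]big1 => [|a ne]; last first.
  by rewrite [R _ _]mxE (negPf ne) mulr0.
rewrite vcoordE vat_in [R _ _]mxE eqxx mulr1 addr0 /= !mxE eqxx andbT.
rewrite [l == j]eq_sym; case: (j == l); rewrite ?mulr1 ?mulr0 ?coef0 //.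
by rewrite coef_qXn ?eqxx ?mult_gt0.
Qed.

Lemma lf_md_of r (x : rep K r) : lf (md_of x) /\ mrk (md_of x) = [ffun i => r i].
Proof.
have rT := mrel_md_of x.
have h i : (mult i * r i <= \rank (md_of x (opV i)))%N.
  by apply: leq_trans (mrel_rank i rT); rewrite leq_mul2l mrk_md_of_ge orbT.
(* Each rank is at least n_i r_i, and both families add up to [dimr r], so all the inequalities are
   equalities. *)
have eqh i : (mult i * r i = \rank (md_of x (opV i)))%N.
  have [_] := leqif_sum (fun i (_ : true) => leqif_eq (h i)).
  by rewrite (rank_idem_sum rT) -/(dimr r) eqxx => /esym/forallP/(_ i)/eqP.
have mE i : mrk (md_of x) i = r i.
  apply/eqP; rewrite eqn_leq mrk_md_of_ge andbT -(leq_pmul2l (mult_gt0 i)) eqh.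
  exact: mrel_rank.
split; last by apply/ffunP => i; rewrite mE ffunE.
by apply/asboolP; split=> // i; rewrite mE eqh.
Qed.

End MatrixModel.

Section EssentialSurjectivity.
Variables (Q : mquiver) (K : fieldType).
Implicit Types r s : vert Q -> nat.

Lemma md_of_surj r (T : md (op Q) K (dimr r)) : mrel T ->
    (forall i, T (opV i) = mxof (@opfV Q K r i)) -> T (opT Q) = mxof (@opfT Q K r) ->
  exists x : rep K r, T = md_of x.
Proof.
move=> [_ _ _ _ rA rAT] TV TT.
pose f a := funmx (T (opA a)); have fL a := @funmx_lin Q K r r (T (opA a)) : klin (f a).
have fE a v : vcoord (f a v) = vcoord v *m T (opA a) := funmxE _ v.
pose F a (w : rmod K r (src a)) : rmod K r (tgt a) := f a (vat w) (tgt a).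
have FP a : hom_linear (gcdn (mult (src a)) (mult (tgt a))) (@F a).
  apply: hom_linearP; rewrite ?mult_gt0 //.
    by move=> c u v; rewrite /F vat_lin fL.
  move=> u.
  rewrite /F -opfX_vat.
  suff -> v : f a (opfX (mult (src a) %/ agcd a) v) = opfX (mult (tgt a) %/ agcd a) (f a v) by [].
  apply: (can_inj (@vcoordK Q K r)).
  rewrite fE -!(mxofE _ (@opfX_lin Q K r _)) fE -!mulmxA -!mxof_opfTX -TT.
  by rewrite rAT.
exists (Rep FP); apply/ffunP => -[i|[a|]]; rewrite !ffunE ?TV ?TT //.
apply: mx_ext => v; rewrite mxofE; last exact: opfA_lin.
rewrite -[T _]rA !TV /opfA /= /F -[vat (v (src a))]/(opfV (src a) v).
rewrite -[vat _]/(opfV (tgt a) (f a (opfV (src a) v))).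
by rewrite !mulmxA (mxofE _ (@opfV_lin Q K r _)) -fE (mxofE _ (@opfV_lin Q K r _)).
Qed.

Lemma row_free_lift m n d (M : 'M[K]_(m, n)) : \rank M = d ->
  exists B : 'M[K]_(d, m), row_free (B *m M).
Proof.
move=> <-; have /submxP [C CE] : (row_base M <= M)%MS by rewrite eq_row_base.
by exists C; rewrite -CE row_base_free.
Qed.

Lemma sum_mulr_shift n p q (t : 'M[K]_q) (F G : nat -> 'M[K]_(p, q)) : (0 < n)%N ->
    G 0%N = 0 -> F n.-1 *m t = 0 -> (forall k, (k.+1 < n)%N -> G k.+1 = F k *m t) ->
  \sum_(k < n) G k = (\sum_(k < n) F k) *m t.
Proof.
case: n => // n _ G0 Ft FG; rewrite big_ord_recl G0 add0r big_ord_recr mulmxDl Ft addr0.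
by rewrite mulmx_suml; apply: eq_bigr => k _; rewrite FG //= ltnS.
Qed.

(** Lift a basis of the image of t^(n_i - 1) at each vertex to rows [B i]. Their multiples by t^k, k
    < n_i, are independent and fill the space by dimension; in this basis the projections and t are
    standard, so [md_of_surj] applies. *)
Lemma lf_md_of_iso r (T : md (op Q) K (dimr r)) : lf T -> (forall i, mrk T i = r i) ->
  exists x : rep K r, miso T (md_of x).
Proof.
move=> lfT rk; have /asboolP [rT _] := lfT; pose e i := T (opV i); pose t := T (opT Q).
have [eV eT t0] : [/\ (forall i j, e i *m e j = if i == j then e i else 0),
    (forall i, e i *m t = t *m e i) & (forall i, e i *m t ^+ mult i = 0)] by case: rT.
have eTX i k : e i *m t ^+ k = t ^+ k *m e i.
  elim: k => [|k IH]; first by rewrite expr0 mulmx1 mul1mx.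
  by rewrite exprS -mulmxE mulmxA eT -mulmxA IH mulmxA.
have exB i : exists B : 'M[K]_(r i, dimr r),
    (B *m e i == B) && row_free (B *m t ^+ (mult i).-1).
  have [|B freeB] := @row_free_lift _ _ (r i) (e i *m t ^+ (mult i).-1).
    by have := rk i; rewrite ffunE.
  by exists (B *m e i); rewrite -!mulmxA eV eqxx freeB eqxx.
pose B i := xchoose (exB i).
have Be i : B i *m e i = B i by have /andP [/eqP] := xchooseP (exB i).
have Bf i : row_free (B i *m t ^+ (mult i).-1) by have /andP [_] := xchooseP (exB i).
have Bt i k : (mult i <= k)%N -> B i *m t ^+ k = 0.
  move=> le_k; rewrite -Be -mulmxA -(subnKC le_k) exprD -mulmxE.
  by rewrite (mulmxA (e i)) t0 mul0mx mulmx0.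
have Be' i j : i != j -> B i *m e j = 0.
  by move=> ne; rewrite -Be -mulmxA eV (negPf ne) mulmx0.
pose W (v : vsp K r) i k : 'rV[K]_(r i) := \row_j (v i j 0 : {poly K})`_k.
pose phi v := \sum_i \sum_(k < mult i) W v i k *m B i *m t ^+ k.
have WL c u v i k : W (vlin c u v) i k = c *: W u i k + W v i k.
  by apply/rowP => j; rewrite !mxE coefD coef_tpoly_alg.
have phiL c u v : phi (vlin c u v) = c *: phi u + phi v.
  rewrite /phi scaler_sumr -big_split; apply: eq_bigr => i _.
  rewrite scaler_sumr -big_split; apply: eq_bigr => k _.
  by rewrite WL !mulmxDl -!scalemxAl.
have [A AE] : exists A, forall v, phi v = vcoord v *m A.
  exists (\matrix_a phi (vuncoord (delta_mx 0 a))) => v.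
  rewrite -(row_linE (g := fun u => phi (vuncoord u))) ?vcoordK //.
  by move=> c u1 u2; rewrite vuncoord_lin phiL.
have phiV i v : phi (opfV i v) = phi v *m e i.
  rewrite /phi mulmx_suml; apply: eq_bigr => j _; rewrite mulmx_suml; apply: eq_bigr => k _.
  rewrite -[RHS]mulmxA -eTX mulmxA -[_ *m B j *m e i]mulmxA.
  have [<-|ne] := eqVneq j i; last first.
    rewrite Be' // mulmx0 mul0mx.
    suff -> : W (opfV i v) j k = 0 by rewrite !mul0mx.
    by apply/rowP => l; rewrite !mxE /opfV vat_out 1?eq_sym // mxE coef0.
  rewrite Be; congr (_ *m _ *m _); apply/rowP => l.
  by rewrite !mxE /opfV vat_in.
have phiT v : phi (opfT v) = phi v *m t.
  rewrite /phi mulmx_suml; apply: eq_bigr => i _.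
  apply: (sum_mulr_shift (F := fun k => W v i k *m B i *m t ^+ k)
    (G := fun k => W (opfT v) i k *m B i *m t ^+ k)); first exact: mult_gt0.
  - suff -> : W (opfT v) i 0%N = 0 by rewrite !mul0mx.
    by apply/rowP => l; rewrite !mxE /= coef_qXM ?mult_gt0.
  - by rewrite -mulmxA mulmxE -exprSr prednK ?mult_gt0 // -mulmxA Bt // mulmx0.
  move=> k lt_k; rewrite -[RHS]mulmxA mulmxE -exprSr; congr (_ *m _ *m _).
  by apply/rowP => l; rewrite !mxE /= coef_qXM.
have phi_inj v : phi v = 0 -> vcoord v = 0.
  move=> v0; suff h i k : (k < mult i)%N -> W v i k = 0.
    apply/rowP; apply: vposP => i k j; rewrite vcoordE mxE.
    by have /rowP/(_ j) := h i k (ltn_ord k); rewrite !mxE.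
  have vi : \sum_(l < mult i) W v i l *m B i *m t ^+ l = 0.
    have := phiV i v; rewrite v0 mul0mx /phi (bigD1 i) //= [X in _ + X]big1 => [|j ne].
      rewrite addr0 => vi; rewrite -[RHS]vi; apply: eq_bigr => l _; congr (_ *m _ *m _).
      by apply/rowP => j; rewrite !mxE /opfV vat_in.
    apply: big1 => l _; suff -> : W (opfV i v) j l = 0 by rewrite !mul0mx.
    by apply/rowP => h; rewrite !mxE /opfV vat_out 1?eq_sym // mxE coef0.
  (* Multiplying by t^(n_i - 1 - k) kills the terms l > k, since t^(n_i) vanishes on [B i]; the
     terms l < k are zero by induction. What is left is W_k times a row-free matrix. *)
  elim/ltn_ind: k => k IH lt_k.
  have := congr1 (mulmx^~ (t ^+ ((mult i).-1 - k))) vi; rewrite mul0mx mulmx_suml.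
  have le_k : (k <= (mult i).-1)%N by rewrite -ltnS prednK // mult_gt0.
  rewrite (bigD1 (Ordinal lt_k)) //= [X in _ + X]big1 => [|l ne].
    rewrite addr0 -!mulmxA mulmxE -exprD subnKC // => W0.
    by apply: (row_free_inj (Bf i)); rewrite mul0mx.
  have [lt_lk|le_kl] := ltnP l k; first by rewrite IH // !mul0mx.
  have {}le_kl : (k < l)%N by rewrite ltn_neqAle le_kl andbT eq_sym.
  rewrite -!mulmxA mulmxE -exprD Bt ?mulmx0 //.
  rewrite addnBA // leq_subRL ?(leq_trans le_k) ?leq_addl // -[X in (_ + X <= _)%N]prednK ?mult_gt0 //.
  by rewrite addnS -addSn leq_add2r.
have freeA : row_free A.
  apply/inj_row_free => u; rewrite -[u]vuncoordK -AE => /phi_inj.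
  by rewrite vuncoordK.
have uA : A \in unitmx by rewrite -row_free_unit.
pose T' : md (op Q) K (dimr r) := [ffun g => A *m T g *m invmx A].
have hA : mhom T' T A.
  by apply/mhomP => g; rewrite ffunE mulmxKV.
have hV : mhom T T' (invmx A).
  by apply/mhomP => g; rewrite ffunE !mulmxA mulVmx // mul1mx.
have iT : miso T T' by exists (invmx A), A; split=> //; rewrite ?mulmxV ?mulVmx.
have [|||x xE] := @md_of_surj r T'.
- by have /asboolP [] := lf_iso iT lfT.
- by move=> i; rewrite ffunE; apply: (canLR (mulmxK uA)); apply: mx_ext => v; rewrite !mulmxA -AE -phiV (mxofE _ (@opfV_lin Q K r _)) AE.
- by rewrite ffunE; apply: (canLR (mulmxK uA)); apply: mx_ext => v; rewrite !mulmxA -AE -phiT (mxofE _ (@opfT_lin Q K r)) AE.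
by exists x; rewrite -xE.
Qed.

End EssentialSurjectivity.

Section Dictionary.
Variables (Q : mquiver) (K : fieldType).
Implicit Types r s : vert Q -> nat.

Lemma md_of_inj r : injective (@md_of Q K r).
Proof.
move=> x y xy; apply: rep_eq => a w.
have := congr1 (fun T : md (op Q) K (dimr r) => T (opA a)) xy; rewrite !ffunE.
move=> /(mxof_inj (opfA_lin x a) (opfA_lin y a)) /(_ (vat w)).
by move=> /(congr1 (fun v : vsp K r => v (tgt a))); rewrite /opfA !vat_in.
Qed.

Lemma eq_cols (R : Type) m n (A B : 'M[R]_(m, n)) : (forall j, col j A = col j B) -> A = B.
Proof.
by move=> AB; apply/matrixP => i j; have /colP/(_ i) := AB j; rewrite !mxE.
Qed.

Lemma mul_delta_ext (R : pzRingType) m n (A B : 'M[R]_(m, n)) :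
  (forall w : 'cV_n, A *m w = B *m w) -> A = B.
Proof.
by move=> AB; apply: eq_cols => j; rewrite !colE.
Qed.

Lemma mxof_famactM r s t (g : forall i, 'M[tpoly K (mult i)]_(s i, r i))
    (h : forall i, 'M[tpoly K (mult i)]_(t i, s i)) :
  mxof (famact g) *m mxof (famact h) = mxof (famact (fun i => h i *m g i)).
Proof.
rewrite mxof_comp; try exact: famact_lin.
by apply: eq_mxof => v; apply: vsp_eq => i; rewrite /famact /= mulmxA.
Qed.

Lemma mxof_famact1 r (g : forall i, 'M[tpoly K (mult i)]_(r i)) :
  (forall i, g i = 1%:M) -> mxof (famact g) = 1%:M.
Proof.
move=> e; rewrite -mxof_id; apply: eq_mxof => v; apply: vsp_eq => i.
by rewrite /famact e mul1mx.
Qed.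

Lemma famact_inv r s (g : forall i, 'M[tpoly K (mult i)]_(s i, r i))
    (h : forall i, 'M[tpoly K (mult i)]_(r i, s i)) :
  mxof (famact g) *m mxof (famact h) = 1%:M <-> forall i, h i *m g i = 1%:M.
Proof.
rewrite mxof_famactM; split=> [|e]; last exact: mxof_famact1.
have e1 := @mxof_famact1 r (fun i => 1%:M) (fun=> erefl).
move=> gh1; have /mxof_famact_inj e := etrans gh1 (esym e1); move=> i.
by rewrite -[LHS]/((fun i => h i *m g i) i) e.
Qed.

Lemma rep_isoE r s (x : rep K r) (y : rep K s) :
  rep_iso x y <-> miso (md_of x) (md_of y).
Proof.
split=> [[g [gbij gint]]|[A [B [hA hB AB BA]]]].
  pose G i : 'M[tpoly K (mult i)]_(s i, r i) := \matrix_(h, j) g i (delta_mx j 0) h 0.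
  have GE i w : g i w = G i *m w.
    have gZ c (u : rmod K r i) : g i (c *: u) = c *: g i u by exact: linearZ.
    have gD (u v : rmod K r i) : g i (u + v) = g i u + g i v by exact: raddfD.
    have g0 : g i 0 = 0 by exact: raddf0.
    rewrite {1}[w]matrix_sum_delta (big_morph (g i) gD g0); apply/matrixP => h b.
    rewrite ord1 summxE mxE; apply: eq_bigr => j _.
    by rewrite big_ord1 gZ !mxE mulrC.
  have inj i : injective (mulmx (G i) : rmod K r i -> rmod K s i).
    by move=> u v; rewrite -!GE => /(bij_inj (gbij i)).
  have surj i j : exists w : rmod K r i, G i *m w == delta_mx j 0.
    by have [h _ hK] := gbij i; exists (h (delta_mx j 0)); rewrite -GE hK.
  pose H i : 'M[tpoly K (mult i)]_(r i, s i) := \matrix_(h, j) xchoose (surj i j) h 0.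
  have GH i : G i *m H i = 1%:M.
    apply: eq_cols => j; rewrite !colE mul1mx -mulmxA -colE.
    have -> : col j (H i) = xchoose (surj i j) by apply/colP => h; rewrite !mxE.
    exact: eqP (xchooseP (surj i j)).
  have HG i : H i *m G i = 1%:M.
    apply: mul_delta_ext => w; apply: inj; by rewrite !mulmxA GH mul1mx mulmx1.
  have hA : mhom (md_of x) (md_of y) (mxof (famact G)).
    by apply/mhom_famact => a v; rewrite -!GE gint.
  have gh : mxof (famact G) *m mxof (famact H) = 1%:M by apply/famact_inv.
  have hg : mxof (famact H) *m mxof (famact G) = 1%:M by apply/famact_inv.
  by exists (mxof (famact G)), (mxof (famact H)); split=> //; apply: mhom_inv hA _ _.
have [G [GE Gint]] := mhom_md_of hA; have [H [HE _]] := mhom_md_of hB.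
have HG i : H i *m G i = 1%:M by move: i; apply/famact_inv; rewrite -GE -HE.
have GH i : G i *m H i = 1%:M by move: i; apply/famact_inv; rewrite -GE -HE.
exists (fun i => mulmx (G i) : {linear rmod K r i -> rmod K s i}); split=> [i|a v] /=.
  by exists (mulmx (H i)) => w; rewrite mulmxA ?HG ?GH mul1mx.
exact: Gint.
Qed.

Lemma miso_dsum r s (x : rep K r) (y : rep K s) :
  miso (osum (md_of x) (md_of y)) (md_of (dsum x y)).
Proof.
pose rs i := (r i + s i)%N.
pose i1 i : 'M[tpoly K (mult i)]_(rs i, r i) := col_mx 1%:M 0.
pose i2 i : 'M[tpoly K (mult i)]_(rs i, s i) := col_mx 0 1%:M.
pose p1 i : 'M[tpoly K (mult i)]_(r i, rs i) := row_mx 1%:M 0.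
pose p2 i : 'M[tpoly K (mult i)]_(s i, rs i) := row_mx 0 1%:M.
have h1 : intertwines x (dsum x y) i1.
  by move=> a v; rewrite /i1 !mul_col_mx !mul1mx !mul0mx /= col_mxKu col_mxKd rep_map0.
have h2 : intertwines y (dsum x y) i2.
  by move=> a v; rewrite /i2 !mul_col_mx !mul1mx !mul0mx /= col_mxKu col_mxKd rep_map0.
have q1 : intertwines (dsum x y) x p1.
  move=> a v; rewrite /p1 /= mul_row_col mul1mx mul0mx addr0.
  by rewrite -[X in row_mx _ _ *m X]vsubmxK mul_row_col mul1mx mul0mx addr0.
have q2 : intertwines (dsum x y) y p2.
  move=> a v; rewrite /p2 /= mul_row_col mul1mx mul0mx add0r.
  by rewrite -[X in row_mx _ _ *m X]vsubmxK mul_row_col mul1mx mul0mx add0r.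
have f0 (p q : vert Q -> nat) (A1 : forall i, 'M[tpoly K (mult i)]_(q i, p i)) : (forall i, A1 i = 0) ->
    mxof (famact A1) = 0.
  move=> e; rewrite -mxof0; apply: eq_mxof => v; apply: vsp_eq => i.
  by rewrite /famact e mul0mx.
exists (col_mx (mxof (famact i1)) (mxof (famact i2))).
exists (row_mx (mxof (famact p1)) (mxof (famact p2))); split.
- by rewrite mhom_col; apply/andP; split; apply/mhom_famact.
- by rewrite mhom_row; apply/andP; split; apply/mhom_famact.
- rewrite mul_col_row !mxof_famactM scalar_mx_block; congr block_mx.
  + by apply: mxof_famact1 => i; rewrite /p1 /i1 mul_row_col mul1mx mul0mx addr0.
  + by apply: f0 => i; rewrite /p2 /i1 mul_row_col mul0mx mulmx0 addr0.
  + by apply: f0 => i; rewrite /p1 /i2 mul_row_col mul0mx mulmx0 addr0.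
  + by apply: mxof_famact1 => i; rewrite /p2 /i2 mul_row_col mul1mx mul0mx add0r.
have E i : i1 i *m p1 i + i2 i *m p2 i = 1%:M.
  rewrite /i1 /p1 /i2 /p2 !mul_col_row !mul1mx !mul0mx add_block_mx !add0r !addr0.
  by rewrite -scalar_mx_block.
have m (p q : vert Q -> nat) (A1 : forall i, 'M[tpoly K (mult i)]_(q i, p i)) v :
    vcoord v *m mxof (famact A1) = vcoord (famact A1 v).
  by apply: mxofE; apply: famact_lin.
rewrite mul_row_col; apply: mx_ext => v; rewrite mulmx1 mulmxDr !mulmxA.
rewrite (m rs r p1 v) (m rs s p2 v) (m r rs i1) (m s rs i2).
rewrite -[X in X + _]scale1r -vcoord_lin; congr vcoord; apply: vsp_eq => i.
by rewrite /vlin /famact !mulmxA !scale1r -mulmxDl E mul1mx.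
Qed.

Lemma lf_md_of_cast D (T : md (op Q) K D) r : lf T -> (forall i, mrk T i = r i) ->
  exists x : rep K r, miso T (md_of x).
Proof.
move=> lfT rk; have e : dimr r = D.
  by rewrite [RHS](lf_dim lfT); apply: eq_bigr => i _; rewrite rk.
by case: D / e T lfT rk => T lfT rk; apply: lf_md_of_iso.
Qed.

Lemma dimr_gt0 r : (0 < dimr r)%N <-> nonzero_rank r.
Proof.
rewrite lt0n sum_nat_eq0 negb_forall; split=> [/existsP [i]|[i ri]].
  by rewrite /= muln_eq0 negb_or => /andP [_ ri]; exists i; rewrite lt0n.
by apply/existsP; exists i; rewrite /= muln_eq0 negb_or -!lt0n mult_gt0.
Qed.

Lemma mindec_osum D1 D2 (T1 : md (op Q) K D1) (T2 : md (op Q) K D2) :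
  (0 < D1)%N -> (0 < D2)%N -> ~ mindec (osum T1 T2).
Proof.
move=> D10 D20 [_ /(_ (block_mx 1%:M 0 0 0))] [].
- by apply/mhomP => g; rewrite ffunE !mulmx_block !mulmx0 !mul0mx mulmx1 mul1mx !addr0.
- by rewrite mulmx_block !mulmx0 !mul0mx mulmx1 !addr0.
- move=> /(congr1 (fun A : 'M_(D1 + D2) => ulsubmx A (Ordinal D10) (Ordinal D10))) /eqP.
  by rewrite block_mxKul !mxE eqxx oner_eq0.
rewrite scalar_mx_block.
move=> /(congr1 (fun A : 'M_(D1 + D2) => drsubmx A (Ordinal D20) (Ordinal D20))) /eqP.
by rewrite !block_mxKdr !mxE eqxx eq_sym oner_eq0.
Qed.

(** A decomposition of the operator family has locally free parts by [lf_osum], so both are realized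
    by representations and give a decomposition of [x]. *)
Lemma indecomposableE r (x : rep K r) : indecomposable x <-> mindec (md_of x).
Proof.
split=> [[r0 indx]|mx].
  have D0 : (0 < dimr r)%N by apply/dimr_gt0.
  apply: contrapT => nx; have [D1 [D2 [T1 [T2 [iT D10 D20]]]]] := mdecompose D0 nx.
  have := lf_iso iT (lf_md_of x).1; rewrite lf_osum => /andP [lf1 lf2].
  have [x1 i1] := @lf_md_of_cast _ T1 (mrk T1) lf1 (fun=> erefl).
  have [x2 i2] := @lf_md_of_cast _ T2 (mrk T2) lf2 (fun=> erefl).
  apply: indx; exists (mrk T1), (mrk T2), x1, x2; split.
  - by apply/dimr_gt0; rewrite -(miso_dim i1).
  - by apply/dimr_gt0; rewrite -(miso_dim i2).
  - apply/rep_isoE; apply: miso_trans iT _; apply: miso_trans (miso_osum i1 i2) _.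
    exact: miso_dsum.
split; first by apply/dimr_gt0; case: mx.
move=> [r1 [r2 [x1 [x2 [r10 r20 /rep_isoE iT]]]]].
apply: (@mindec_osum _ _ (md_of x1) (md_of x2)); try exact/dimr_gt0.
by apply: mindec_iso mx; apply: miso_trans iT (miso_sym (miso_dsum x1 x2)).
Qed.

End Dictionary.

(** * Base change in coordinates *)

Section BaseChangeModel.
Variables (Q : mquiver) (K E : fieldType) (io : {rmorphism K -> E}).
Implicit Types r s : vert Q -> nat.

Definition vbas (F : fieldType) r i (k : 'I_(mult i)) (j : 'I_(r i)) : vsp F r :=
  vat ('qX ^+ k *: delta_mx j 0 : rmod F r i).

Lemma vpos_eq r i (k k' : 'I_(mult i)) (j j' : 'I_(r i)) :
  (vpos k j == vpos k' j') = (k == k') && (j == j').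
Proof. by rewrite /vpos (can_eq (@vencK Q r)) eq_Tagged. Qed.

Lemma vuncoord_delta (F : fieldType) r i (k : 'I_(mult i)) (j : 'I_(r i)) :
  vuncoord (delta_mx 0 (vpos k j)) = vbas F k j.
Proof.
apply: (can_inj (@vcoordK Q F r)); rewrite vuncoordK.
apply/rowP; apply: vposP => i' k' j'; rewrite mxE eqxx /= /vbas.
have [e|ne] := eqVneq i i'; last first.
  rewrite vcoord_vat //; case: eqP => // /(can_inj (@vencK _ _)) /(congr1 tag) /= e.
  by rewrite e eqxx in ne.
subst i'; rewrite vcoordE vat_in !mxE andbT vpos_eq. case: (eqVneq j' j) => _.
  by rewrite mulr1 coef_qXn ?mult_gt0 // andbT.
by rewrite andbF mulr0 coef0.
Qed.

Definition vmap r (v : vsp K r) : vsp E r := fun i => map_mx (@tpoly_map K E io (mult i)) (v i).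

Lemma tpoly_mapX n k : (0 < n)%N -> tpoly_map io ('qX ^+ k : tpoly K n) = 'qX ^+ k.
Proof. by move=> n0; rewrite -!rmorphXn tpoly_map_in // map_polyXn. Qed.

Lemma tpoly_map1 n : (0 < n)%N -> tpoly_map io (1 : tpoly K n) = 1.
Proof. by move=> n0; have := tpoly_mapX 0 n0; rewrite !expr0. Qed.

Lemma vmap_vat r i (w : rmod K r i) :
  vmap (vat w) = vat (map_mx (@tpoly_map K E io (mult i)) w).
Proof.
apply: vsp_eq => i'; rewrite /vmap; have [e|ne] := eqVneq i i'.
  by subst i'; rewrite !vat_in.
by rewrite !vat_out //; apply/matrixP => h b; rewrite !mxE tpoly_map0.
Qed.

Lemma map_mx_qXZ n d k (w : 'M[tpoly K n]_(d, 1)) : (0 < n)%N ->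
  map_mx (@tpoly_map K E io n) ('qX ^+ k *: w) = 'qX ^+ k *: map_mx (@tpoly_map K E io n) w.
Proof. by move=> n0; apply/matrixP => h b; rewrite !mxE tpoly_mapM // tpoly_mapX. Qed.

Lemma map_mx_delta n d (j : 'I_d) : (0 < n)%N ->
  map_mx (@tpoly_map K E io n) (delta_mx j 0 : 'cV_d) = delta_mx j 0.
Proof.
move=> n0; apply/matrixP => h b; rewrite !mxE.
by case: andP => _; [exact: tpoly_map1|exact: tpoly_map0].
Qed.

Lemma vmap_bas r i (k : 'I_(mult i)) (j : 'I_(r i)) : vmap (vbas K k j) = vbas E k j.
Proof. by rewrite /vbas vmap_vat map_mx_qXZ ?map_mx_delta ?mult_gt0. Qed.

Lemma mxof_map r (f : vsp K r -> vsp K r) (f' : vsp E r -> vsp E r) :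
    (forall i (k : 'I_(mult i)) (j : 'I_(r i)), f' (vbas E k j) = vmap (f (vbas K k j))) ->
  mxof f' = map_mx io (mxof f).
Proof.
move=> ff; apply/matrixP; apply: vposP => i k j; apply: vposP => i' k' j'.
rewrite [RHS]mxE [LHS]mxE [in RHS]mxE !vuncoord_delta !vcoordE ff mxE.
by rewrite coef_tpoly_map ?mult_gt0.
Qed.

Lemma sum_scale_delta (F : nzRingType) (A : lalgType F) (V : lmodType A) m n
    (G : 'I_m -> 'I_n -> V) k j :
  \sum_(j' < n) \sum_(k' < m) (((k' == k) && (j' == j))%:R : F)%:A *: G k' j' = G k j.
Proof.
rewrite (bigD1 j) //= (bigD1 k) //= !eqxx !scale1r.
rewrite [X in _ + X + _]big1 => [|k' nk]; last by rewrite (negPf nk) !scale0r.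
rewrite addr0 big1 ?addr0 // => j' nj; rewrite big1 // => k' _.
by rewrite (negPf nj) andbF !scale0r.
Qed.

Lemma base_change_basis n1 n2 d1 d2 (f : 'cV[tpoly K n1]_d1 -> 'cV[tpoly K n2]_d2)
    (k : 'I_n1) (j : 'I_d1) : (0 < n1)%N ->
  base_change_map io f ('qX ^+ k *: delta_mx j 0)
  = map_mx (@tpoly_map K E io n2) (f ('qX ^+ k *: delta_mx j 0)).
Proof.
move=> n0; rewrite /base_change_map.
have c (j' : 'I_d1) (k' : 'I_n1) :
    ((('qX ^+ k *: delta_mx j 0 : 'cV[tpoly E n1]_d1) j' 0 : tpoly E n1) : {poly E})`_k'
    = ((k' == k) && (j' == j))%:R.
  rewrite !mxE andbT; case: (j' == j); rewrite ?(mulr1, mulr0) ?coef0 ?andbF //.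
  by rewrite coef_qXn // andbT.
transitivity (\sum_(j' < d1) \sum_(k' < n1) (((k' == k) && (j' == j))%:R : E)%:A *:
    map_mx (@tpoly_map K E io n2) (f ('qX ^+ k' *: delta_mx j' 0))).
  by apply: eq_bigr => j' _; apply: eq_bigr => k' _; rewrite c.
exact: (sum_scale_delta (fun k' j' => map_mx (@tpoly_map K E io n2) (f ('qX ^+ k' *: delta_mx j' 0)))).
Qed.

(** It is enough to compare on the vectors t^k e_j, which are defined over K and form the basis in
    which [base_change_map] is computed. *)
Lemma md_of_base_change r (x : rep K r) : md_of (base_change io x) = mbase io (md_of x).
Proof.
apply/ffunP => -[i|[a|]]; rewrite !ffunE; apply: mxof_map => i' k j; rewrite -vmap_bas.
- by rewrite /opfV vmap_vat.
- rewrite /opfA vmap_vat; congr vat.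
  have [e|ne] := eqVneq i' (src a); last first.
    have map0 i : map_mx (@tpoly_map K E io (mult i)) (0 : rmod K r i) = 0.
      by apply/matrixP => h b; rewrite !mxE tpoly_map0.
    by rewrite /vmap /vbas vat_out // map0 !rep_map0 map0.
  move: k j; rewrite e => k j; rewrite vmap_bas /vbas !vat_in.
  exact: (base_change_basis (x a) k j (mult_gt0 _)).
- by apply: vsp_eq => i; rewrite /opfT /vmap; have := map_mx_qXZ 1 (vbas K k j i) (mult_gt0 i); rewrite expr1.
Qed.

End BaseChangeModel.

Lemma abs_indecomposableE (Q : mquiver) (K : finFieldType) (r : vert Q -> nat) (x : rep K r) :
  abs_indecomposable x <-> mabs (md_of x).
Proof.
by rewrite /abs_indecomposable indecomposableE md_of_base_change; apply: mabs_closedP.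
Qed.

Lemma scale_algD (K : nzRingType) (A : lalgType K) (V : lmodType A) (c a b : K) (w : V) :
  (c * a + b)%:A *: w = c%:A *: (a%:A *: w) + b%:A *: w.
Proof. by rewrite [in RHS]scalerA mulr_algl [in RHS]scalerA -scalerDl -scalerDl. Qed.

Lemma scale_exprD (A : nzRingType) (V : lmodType A) (x : A) a b (w : V) :
  x ^+ a *: (x ^+ b *: w) = x ^+ (a + b) *: w.
Proof. by rewrite scalerA -exprD. Qed.

(** * Free parameters of the map of an arrow *)

Section ArrowHom.
Variables (K : fieldType) (m n1 n2 d1 d2 : nat).
Hypotheses (m0 : (0 < m)%N) (n10 : (0 < n1)%N) (n20 : (0 < n2)%N).
Hypotheses (mn1 : (m %| n1)%N) (mn2 : (m %| n2)%N).
Let p := (n1 %/ m)%N.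
Let q := (n2 %/ m)%N.

Let p0 : (0 < p)%N.
Proof. by rewrite divn_gt0 // dvdn_leq. Qed.

Lemma cV_basis (v : 'cV[tpoly K n1]_d1) :
  v = \sum_j \sum_(l < n1) ((v j 0 : {poly K})`_l)%:A *: ('qX ^+ l *: delta_mx j 0).
Proof.
rewrite {1}[v]matrix_sum_delta; apply: eq_bigr => j _; rewrite big_ord1.
rewrite {1}[v j 0]tpoly_basis // scaler_suml; apply: eq_bigr => l _.
by rewrite scalerA.
Qed.

Lemma hom_linear_ext (f g : 'cV[tpoly K n1]_d1 -> 'cV[tpoly K n2]_d2) :
    hom_linear m f -> hom_linear m g ->
    (forall (k : 'I_p) j, f ('qX ^+ k *: delta_mx j 0) = g ('qX ^+ k *: delta_mx j 0)) ->
  f =1 g.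
Proof.
move=> fL gL fg.
have D (h : 'cV[tpoly K n1]_d1 -> 'cV[tpoly K n2]_d2) : hom_linear m h -> forall u v, h (u + v) = h u + h v.
  by move=> hL u v; have := hL 1 u v; rewrite !tpoly_ext1 !scale1r.
have Z0 (h : 'cV[tpoly K n1]_d1 -> 'cV[tpoly K n2]_d2) : hom_linear m h -> h 0 = 0.
  by move=> hL; apply: (addIr (h 0)); rewrite -(D h hL) !add0r.
have A (h : 'cV[tpoly K n1]_d1 -> 'cV[tpoly K n2]_d2) : hom_linear m h -> forall a u, h (a%:A *: u) = a%:A *: h u.
  move=> hL a u; have := hL a%:A u 0.
  by rewrite (Z0 h hL) !addr0 !tpoly_ext_alg.
have X (h : 'cV[tpoly K n1]_d1 -> 'cV[tpoly K n2]_d2) : hom_linear m h -> forall k u, h (('qX ^+ p) ^+ k *: u) = ('qX ^+ q) ^+ k *: h u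
   .
  move=> hL; elim=> [|k IH] u; first by rewrite !expr0 !scale1r.
  by rewrite !exprS -!scalerA (hom_linearX _ m0 n10 n20 hL) IH.
move=> v; rewrite (cV_basis v) (big_morph f (D f fL) (Z0 f fL)).
rewrite (big_morph g (D g gL) (Z0 g gL)); apply: eq_bigr => j _.
rewrite (big_morph f (D f fL) (Z0 f fL)) (big_morph g (D g gL) (Z0 g gL)).
apply: eq_bigr => l _; rewrite (A f fL) (A g gL); congr (_ *: _).
rewrite [X in 'qX ^+ X](divn_eq l p) mulnC exprD exprM -scalerA.
rewrite (X f fL) (X g gL); congr (_ *: _).
exact: (fg (Ordinal (ltn_pmod l p0)) j).
Qed.

(** K_n1 is free over K_m on t^k, k < p. Writing t^l = (t^p)^(l / p) t^(l mod p), where t^p and t^q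
    are the images of the t of K_m in K_n1 and K_n2, extends arbitrary values [W] on the t^k e_j. *)
Definition arrow_map (W : 'I_p -> 'I_d1 -> 'cV[tpoly K n2]_d2) (v : 'cV[tpoly K n1]_d1) :
    'cV[tpoly K n2]_d2 :=
  \sum_j \sum_(l < n1) ((v j 0 : {poly K})`_l)%:A *:
    ('qX ^+ (q * (l %/ p)) *: W (Ordinal (ltn_pmod l p0)) j).

Lemma shift_sum (A : lalgType K) (V : lmodType A) (a : nat -> K) (G : nat -> V) (s : V -> V) :
    {morph s : u v / u + v} -> s 0 = 0 -> (forall (c : K) u, s (c%:A *: u) = c%:A *: s u) ->
    (forall l, G (l + p)%N = s (G l)) -> (forall l, (n1 <= l)%N -> G l = 0) ->
  \sum_(l < n1) (if (l < p)%N then 0 else a (l - p)%N)%:A *: G l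
  = s (\sum_(l < n1) (a l)%:A *: G l).
Proof.
move=> sD s0 sZ Gp G0; rewrite (big_morph s sD s0).
have le_pn : (p <= n1)%N by rewrite leq_div.
rewrite -(big_mkord xpredT (fun l => (if (l < p)%N then 0 else a (l - p)%N)%:A *: G l)).
rewrite (big_cat_nat (leq0n p) le_pn) /= big_nat big1 ?add0r => [|l lt_lp]; last first.
  by have /andP [_ ->] := lt_lp; rewrite !scale0r.
rewrite -{1}[p]add0n big_addn -(big_mkord xpredT (fun l => s ((a l)%:A *: G l))).
rewrite [RHS](big_cat_nat (n := (n1 - p)%N)) ?leq_subr //=.
rewrite [X in _ + X]big_nat [X in _ + X]big1 => [|l /andP [le_l _]]; last first.
  by rewrite sZ -Gp G0 ?scaler0 // addnC -leq_subLR.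
rewrite addr0; apply: eq_bigr => l _.
by rewrite ltnNge leq_addl /= addnK Gp sZ.
Qed.

Lemma arrow_mapP W : hom_linear m (arrow_map W).
Proof.
apply: hom_linearP => // [c u v|u].
  rewrite /arrow_map scaler_sumr -big_split; apply: eq_bigr => j _.
  rewrite scaler_sumr -big_split; apply: eq_bigr => l _.
  have -> : ((c%:A *: u + v) j 0 : {poly K})`_l
      = c * (u j 0 : {poly K})`_l + (v j 0 : {poly K})`_l.
    by rewrite !mxE coefD coef_tpoly_alg.
  exact: scale_algD.
rewrite /arrow_map scaler_sumr; apply: eq_bigr => j _.
pose G l : 'cV[tpoly K n2]_d2 := 'qX ^+ (q * (l %/ p)) *: W (Ordinal (ltn_pmod l p0)) j.
rewrite -/p -/q.
have Gp l : G (l + p)%N = 'qX ^+ q *: G l.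
  rewrite /G scale_exprD -mulnS divnDr // divnn p0 addn1; congr (_ *: W _ j).
  by apply: val_inj; rewrite /= modnDr.
(* Here l / p >= m, so the power of t is at least q m = n2: the formula is compatible with t^n1 =
   0. *)
have G0 l : (n1 <= l)%N -> G l = 0.
  move=> le_l; have le_m : (m <= l %/ p)%N.
    by rewrite leq_divRL // (leq_trans _ le_l) // mulnC divnK.
  rewrite /G -(subnKC le_m) mulnDr exprD.
  have -> : (q * m = n2)%N by rewrite divnK.
  by rewrite qX_nilp // mul0r scale0r.
rewrite -(shift_sum (fun l => (u j 0 : {poly K})`_l) _ _ _ Gp G0).
- apply: eq_bigr => l _; congr (_%:A *: _); rewrite mxE.
  rewrite -{1}(in_qpoly_tpoly (u j 0) n10) -rmorphXn -rmorphM coef_in_qpolyXn // ltn_ord.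
  by rewrite coefXnM.
- by move=> v w; rewrite scalerDr.
- by rewrite scaler0.
- by move=> c w; rewrite !scalerA mulrC.
Qed.

Lemma arrow_map_basis W (k : 'I_p) j : arrow_map W ('qX ^+ k *: delta_mx j 0) = W k j.
Proof.
have lt_kn : (k < n1)%N by apply: leq_trans (ltn_ord k) _; rewrite leq_div.
have c (j' : 'I_d1) (k' : 'I_n1) :
    ((('qX ^+ k *: delta_mx j 0 : 'cV[tpoly K n1]_d1) j' 0 : tpoly K n1) : {poly K})`_k'
    = ((k' == Ordinal lt_kn) && (j' == j))%:R.
  rewrite !mxE andbT; case: (j' == j); rewrite ?(mulr1, mulr0) ?coef0 ?andbF //.
  by rewrite coef_qXn // andbT.
transitivity (\sum_(j' < d1) \sum_(k' < n1) (((k' == Ordinal lt_kn) && (j' == j))%:R : K)%:A *: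
    ('qX ^+ (q * (k' %/ p)) *: W (Ordinal (ltn_pmod k' p0)) j')).
  by apply: eq_bigr => j' _; apply: eq_bigr => k' _; rewrite c.
rewrite (sum_scale_delta (fun k' j' => ('qX ^+ (q * (k' %/ p)) *: W (Ordinal (ltn_pmod k' p0)) j'))).
rewrite /= divn_small // muln0 expr0 scale1r; congr (W _ j); apply: val_inj.
by rewrite /= modn_small.
Qed.

End ArrowHom.

(** * Point counts *)

Section LinearCoordinates.
Variables (Q : mquiver) (K : fieldType) (r : vert Q -> nat).

(** Index set of a K-basis of R(Q, n; r), as [gidx] is for the Lie algebra; their cardinals are the
    two sums in the Euler form. *)
Definition ridx : finType := {a : arrow Q &
  (('I_(mult (src a) %/ agcd a) * 'I_(r (src a))) * ('I_(mult (tgt a)) * 'I_(r (tgt a))))%type}.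
Definition gidx : finType := {i : vert Q & ('I_(mult i) * ('I_(r i) * 'I_(r i)))%type}.

Lemma card_ridx : #|ridx| = (\sum_(a : arrow Q)
  (mult (src a) * mult (tgt a)) %/ agcd a * r (src a) * r (tgt a))%N.
Proof.
rewrite card_tagged sumnE big_map big_enum; apply: eq_bigr => a _.
by rewrite !card_prod !card_ord -divn_mulAC ?dvdn_gcdl // mulnACA mulnA.
Qed.

Lemma card_gidx : #|gidx| = (\sum_(i : vert Q) mult i * r i * r i)%N.
Proof.
rewrite card_tagged sumnE big_map big_enum; apply: eq_bigr => i _.
by rewrite !card_prod !card_ord mulnA.
Qed.

Definition rcoord (x : rep K r) : 'rV[K]_#|ridx| :=
  \row_b (let d := enum_val b : ridx in
    (x (tag d) ('qX ^+ (tagged d).1.1 *: delta_mx (tagged d).1.2 0) (tagged d).2.2 0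
      : {poly K})`_(tagged d).2.1).

Lemma rcoordE x a (k : 'I_(mult (src a) %/ agcd a)) (j : 'I_(r (src a)))
    (k' : 'I_(mult (tgt a))) (j' : 'I_(r (tgt a))) :
  rcoord x 0 (enum_rank (Tagged _ ((k, j), (k', j')) : ridx))
  = (x a ('qX ^+ k *: delta_mx j 0) j' 0 : {poly K})`_k'.
Proof. by rewrite mxE enum_rankK. Qed.

Lemma rcoord_lin c x y : rcoord (c *: x + y) = c *: rcoord x + rcoord y.
Proof.
apply/rowP => b; rewrite -(enum_valK b); case: (enum_val b) => a [[k j] [k' j']].
rewrite [RHS]mxE [X in _ = X + _]mxE !rcoordE.
rewrite -[(c *: x + y) a _]/(c%:A *: x a _ + y a _).
set v := x a _; set w := y a _.
by rewrite !mxE coefD coef_tpoly_alg.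
Qed.

Let agcd0 (a : arrow Q) : (0 < agcd a)%N. Proof. by rewrite gcdn_gt0 mult_gt0. Qed.
Let agcds (a : arrow Q) : (agcd a %| mult (src a))%N. Proof. exact: dvdn_gcdl. Qed.
Let agcdt (a : arrow Q) : (agcd a %| mult (tgt a))%N. Proof. exact: dvdn_gcdr. Qed.

Definition runcoord (u : 'rV[K]_#|ridx|) : rep K r :=
  @Rep Q K r
    (fun a => arrow_map (agcd0 a) (mult_gt0 (src a)) (agcds a) (fun k j => \col_j' \sum_(k' < mult (tgt a))
       (u 0 (enum_rank (Tagged _ ((k, j), (k', j')) : ridx)))%:A * 'qX ^+ k'))
    (fun a => arrow_mapP (agcd0 a) (mult_gt0 (src a)) (mult_gt0 (tgt a)) (agcds a) (agcdt a) _).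

Lemma runcoordE u a (k : 'I_(mult (src a) %/ agcd a)) (j : 'I_(r (src a))) :
  runcoord u a ('qX ^+ k *: delta_mx j 0) = \col_j' \sum_(k' < mult (tgt a))
    (u 0 (enum_rank (Tagged _ ((k, j), (k', j')) : ridx)))%:A * 'qX ^+ k'.
Proof. exact: (@arrow_map_basis K (agcd a)). Qed.

Lemma rcoordK : cancel rcoord runcoord.
Proof.
move=> x; apply: rep_eq => a.
apply: (hom_linear_ext (agcd0 a)); rewrite ?mult_gt0 ?agcds ?agcdt //; try exact: rep_mapP.
move=> k j; rewrite runcoordE; apply/matrixP => j' b; rewrite mxE ord1.
rewrite [RHS]tpoly_basis ?mult_gt0 //.
by apply: eq_bigr => k' _; rewrite rcoordE.
Qed.

Lemma runcoordK : cancel runcoord rcoord.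
Proof.
move=> u; apply/rowP => b; rewrite -(enum_valK b); case: (enum_val b) => a [[k j] [k' j']].
rewrite rcoordE runcoordE mxE.
by rewrite (coef_poly_qX (fun k' => u 0 _)) // mult_gt0.
Qed.

Definition gcoord (x : gl K r) : 'rV[K]_#|gidx| :=
  \row_b (let d := enum_val b : gidx in
    (x (tag d) (tagged d).2.1 (tagged d).2.2 : {poly K})`_(tagged d).1).

Definition guncoord (u : 'rV[K]_#|gidx|) : gl K r := fun i =>
  \matrix_(h, j) \sum_(k < mult i)
     (u 0 (enum_rank (Tagged _ (k, (h, j)) : gidx)))%:A * 'qX ^+ k.

Lemma gcoord_lin c x y : gcoord (c *: x + y) = c *: gcoord x + gcoord y.
Proof.
apply/rowP => b; rewrite -(enum_valK b); case: (enum_val b) => i [k [h j]].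
rewrite [RHS]mxE [X in _ = X + _]mxE !mxE enum_rankK /=.
rewrite -[(c *: x + y) i]/(c%:A *: x i + y i).
by rewrite !mxE coefD coef_tpoly_alg.
Qed.

Lemma gcoordK : cancel gcoord guncoord.
Proof.
move=> x; apply: functional_extensionality_dep => i; apply/matrixP => h j; rewrite mxE.
rewrite [RHS]tpoly_basis ?mult_gt0 //.
by apply: eq_bigr => k _; rewrite mxE enum_rankK.
Qed.

Lemma guncoordK : cancel guncoord gcoord.
Proof.
move=> u; apply/rowP => b; rewrite -(enum_valK b); case: (enum_val b) => i [k [h j]].
rewrite mxE enum_rankK /= mxE.
by rewrite (coef_poly_qX (fun k => u 0 (enum_rank (Tagged _ (k, (h, j)) : gidx)))) // mult_gt0.
Qed.

End LinearCoordinates.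

Lemma card_ker_row (L : finFieldType) m n (A : 'M[L]_(m, n)) :
  #|[set u : 'rV[L]_m | u *m A == 0]| = (#|L| ^ (m - \rank A))%N.
Proof.
rewrite -mxrank_ker -card_rowg; apply: eq_card => u.
by rewrite !inE sub_kermx.
Qed.

Lemma card_ker_mx (L : finFieldType) m n (A : 'M[L]_(m, n)) :
  (#|[set c : 'cV[L]_n | A *m c == 0%R]| * #|L| ^ m
   = #|L| ^ n * #|[set u : 'rV[L]_m | u *m A == 0%R]|)%N.
Proof.
have -> : #|[set c : 'cV[L]_n | A *m c == 0]| = #|[set u : 'rV[L]_n | u *m A^T == 0]|.
  rewrite -(card_imset _ (@trmx_inj L 1 n)); apply: eq_card => c; rewrite inE.
  apply/idP/imsetP => [Ac|[u]]; last first.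
    by rewrite inE => /eqP uA ->; rewrite -[A]trmxK -trmx_mul uA trmx0.
  by exists c^T; rewrite ?trmxK // inE -trmx_mul (eqP Ac) trmx0.
rewrite !card_ker_row mxrank_tr -!expnD; congr (_ ^ _)%N.
by rewrite addnC addnBA ?rank_leq_col // [RHS]addnBA ?rank_leq_row // addnC.
Qed.

Section PointCounts.
Variables (Q : mquiver) (L : finFieldType) (r : {ffun vert Q -> nat}).
Local Notation D := (dimr r).
Local Notation n := #|ridx r|.
Local Notation m := #|gidx r|.

Lemma guncoord_lin c (u v : 'rV[L]_m) :
  guncoord (c *: u + v) = c *: guncoord u + guncoord v.
Proof. by apply: (can_inj (@gcoordK Q L r)); rewrite gcoord_lin !guncoordK. Qed.

Definition actmx (x : rep L r) : 'M[L]_(m, n) :=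
  \matrix_b rcoord (inf_act x (guncoord (delta_mx 0 b))).

Lemma actmxE x u : u *m actmx x = rcoord (inf_act x (guncoord u)).
Proof.
rewrite -(row_linE (g := fun u => rcoord (inf_act x (guncoord u)))) //.
by move=> c u1 u2; rewrite guncoord_lin linearP rcoord_lin.
Qed.

Lemma rcoord0 : rcoord (0 : rep L r) = 0.
Proof. by have := rcoord_lin (-1) (0 : rep L r) 0; rewrite scaler0 addr0 scaleN1r addNr. Qed.

Lemma card_inf_act_ker x : #|[set u : 'rV[L]_m | u *m actmx x == 0]| = nhom (md_of x) (md_of x).
Proof.
pose f (u : 'rV[L]_m) := mxof (famact (guncoord u)).
have f_inj : injective f.
  by move=> u v /mxof_famact_inj /(can_inj (@guncoordK Q L r)).
rewrite -(card_imset _ f_inj); apply: eq_card => A; rewrite inE.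
have actP u : (u *m actmx x == 0) <-> intertwines x x (guncoord u).
  rewrite actmxE -rcoord0 (can_eq (@rcoordK Q L r)); split=> [/eqP h a v|h].
    have := congr1 (fun y : rep L r => y a v) h.
    by move=> /eqP; rewrite [X in X == _]/= subr_eq0 => /eqP.
  by apply/eqP/rep_eq => a v; apply/eqP; rewrite [X in X == _]/= subr_eq0; apply/eqP/h.
apply/imsetP/idP => [[u]|hA]; first by rewrite inE => /actP hu ->; apply/mhom_famact.
have [g [-> hg]] := mhom_md_of hA.
exists (gcoord g); last by rewrite /f gcoordK.
by rewrite inE; apply/actP; rewrite gcoordK.
Qed.

Definition nmoment := #|[set uc : 'rV[L]_n * 'cV[L]_n | actmx (runcoord uc.1) *m uc.2 == 0]|.

Definition send := (\sum_(u : 'rV[L]_n) nhom (md_of (runcoord u)) (md_of (runcoord u)))%N.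

(** The fibre over x is the right kernel of [actmx x] and End(x) its left kernel; their cardinals
    differ by the factor q^(dim R - dim gl), the inverse of the q^<r,r> of the statement. *)
Lemma nmomentE : (nmoment * #|L| ^ m = #|L| ^ n * send)%N.
Proof.
have -> : nmoment = (\sum_(u : 'rV[L]_n) #|[set c : 'cV[L]_n | actmx (runcoord u) *m c == 0%R]|)%N.
  rewrite /nmoment -sum1_card (eq_bigl (fun uc => true && (actmx (runcoord uc.1) *m uc.2 == 0))).
    rewrite -(pair_big_dep xpredT (fun u c => actmx (runcoord u) *m c == 0) (fun _ _ => 1%N)) /=.
    by apply: eq_bigr => u _; rewrite sum1dep_card.
  by move=> uc; rewrite inE.
rewrite big_distrl big_distrr; apply: eq_bigr => u _ /=.
by rewrite card_ker_mx card_inf_act_ker.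
Qed.

Definition nGLr := #|[set u : 'rV[L]_m | mxof (famact (guncoord u)) \in unitmx]|.

Lemma unit_famactE (g : forall i, 'M[tpoly L (mult i)]_(r i)) :
  mxof (famact g) \in unitmx <-> forall i, g i \in unitmx.
Proof.
split=> [ug i|ug]; last first.
  have E : mxof (famact g) *m mxof (famact (fun i => invmx (g i))) = 1%:M.
    by apply/famact_inv => i; apply: mulVmx (ug i).
  exact: (mulmx1_unit E).1.
have Vg o : mxof (@opfV Q L r o) *m mxof (famact g) = mxof (famact g) *m mxof (@opfV Q L r o).
  rewrite !mxof_comp; try exact: famact_lin; try exact: opfV_lin.
  by apply: eq_mxof => v; rewrite /= /opfV famact_vat.
have Tg : mxof (@opfT Q L r) *m mxof (famact g) = mxof (famact g) *m mxof (@opfT Q L r).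
  rewrite !mxof_comp; try exact: famact_lin; try exact: opfT_lin.
  by apply: eq_mxof => v; apply: vsp_eq => j; rewrite /= /famact /opfT -scalemxAr.
have comm (X A : 'M[L]_D) : A \in unitmx -> X *m A = A *m X -> X *m invmx A = invmx A *m X.
  move=> uA XA; apply: (canRL (mulKmx uA)).
  by rewrite mulmxA -XA mulmxK.
have [h hE] := mhom_is_famact (fun o => comm _ _ ug (Vg o)) (comm _ _ ug Tg).
have : mxof (famact g) *m mxof (famact h) = 1%:M by rewrite -hE mulmxV.
by move=> /famact_inv/(_ i) hg; apply: (mulmx1_unit hg).2.
Qed.

Definition comm_std (A : 'M[L]_D) : bool :=
  [forall i, mxof (@opfV Q L r i) *m A == A *m mxof (@opfV Q L r i)]
  && (mxof (@opfT Q L r) *m A == A *m mxof (@opfT Q L r)).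

Lemma nGLrE : nGLr = #|[set A : 'M[L]_D | (A \in unitmx) && comm_std A]|.
Proof.
pose f (u : 'rV[L]_m) := mxof (famact (guncoord u)).
have f_inj : injective f.
  by move=> u v /mxof_famact_inj /(can_inj (@guncoordK Q L r)).
rewrite /nGLr -(card_imset _ f_inj); apply: eq_card => A; rewrite inE.
apply/imsetP/andP => [[u]|[uA /andP [/forallP hV /eqP hT]]].
  rewrite inE => uu ->; split=> //; apply/andP; split.
    apply/forallP => i; apply/eqP; rewrite !mxof_comp; try exact: famact_lin; try exact: opfV_lin.
    by apply: eq_mxof => v; rewrite /= /opfV famact_vat.
  apply/eqP; rewrite !mxof_comp; try exact: famact_lin; try exact: opfT_lin.
  by apply: eq_mxof => v; apply: vsp_eq => j; rewrite /= /famact /opfT -scalemxAr.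
have [g gE] := mhom_is_famact (fun i => eqP (hV i)) hT.
exists (gcoord g); last by rewrite /f gcoordK.
by rewrite inE gcoordK -gE.
Qed.

Definition stdmd (X : md (op Q) L D) : bool := [exists u : 'rV[L]_n, X == md_of (runcoord u)].

Lemma stdmdP X : stdmd X <-> [/\ mrel X, forall i, X (opV i) = mxof (@opfV Q L r i) &
  X (opT Q) = mxof (@opfT Q L r)].
Proof.
split=> [/existsP [u /eqP ->]|[rX VX TX]].
  by split=> [|i|]; rewrite ?ffunE //; apply: mrel_md_of.
have [x ->] := md_of_surj rX VX TX.
by apply/existsP; exists (rcoord x); rewrite rcoordK.
Qed.

Lemma sendE : send = (\sum_(X : md (op Q) L D | stdmd X) nhom X X)%N.
Proof.
have inj : injective (fun u : 'rV[L]_n => md_of (runcoord u)).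
  by move=> u v /md_of_inj /(can_inj (@runcoordK Q L r)).
rewrite /send -(big_imset (fun X => nhom X X) (in2W inj)) /=; apply: eq_bigl => X.
apply/imsetP/existsP => [[u _ ->]|[u /eqP ->]]; first by exists u.
by exists u.
Qed.

Lemma lf_stdmd X : stdmd X -> lf X && (mrk X == r).
Proof.
move=> /existsP [u /eqP ->]; have [-> ->] := lf_md_of (runcoord u).
by apply/eqP/ffunP => i; rewrite ffunE.
Qed.

Lemma stdmd_conj (A : 'M[L]_D) X : stdmd X -> A \in unitmx -> stdmd (mconj A X) = comm_std A.
Proof.
move=> sX uA; have /stdmdP [rX VX TX] := sX.
have E (Y : 'M[L]_D) : (invmx A *m Y *m A == Y) = (Y *m A == A *m Y).
  apply/eqP/eqP => [YE|YA]; first by rewrite -{2}YE !mulmxA mulmxV // mul1mx.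
  by rewrite -mulmxA YA mulKmx.
apply/idP/andP => [/stdmdP [_ VA TA]|[/forallP VA TA]].
  split; last by rewrite -E -{2}TA ffunE TX.
  by apply/forallP => i; rewrite -E -{2}VA ffunE VX.
apply/stdmdP; split=> [|i|]; last 2 first.
- by rewrite ffunE VX; apply/eqP; rewrite E VA.
- by rewrite ffunE TX; apply/eqP; rewrite E TA.
have lX := lf_stdmd sX; have /andP [lfX _] := lX.
have iX : miso X (mconj A X) by apply/misoP; exists A => //; rewrite -mconj_hom.
by have /asboolP [] := lf_iso iX lfX.
Qed.

Lemma mconjM (A B : 'M[L]_D) (X : md (op Q) L D) : A \in unitmx -> B \in unitmx ->
  mconj B (mconj A X) = mconj (A *m B) X.
Proof.
move=> uA uB; have uAB : A *m B \in unitmx by rewrite unitmx_mul uA.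
apply/esym/eqP; rewrite mconj_hom //; apply: (@mhomM _ _ _ _ _ _ (mconj A X)).
  by rewrite -mconj_hom.
by rewrite -mconj_hom.
Qed.

Lemma mconj1 (X : md (op Q) L D) : mconj 1%:M X = X.
Proof. by apply/ffunP => g; rewrite ffunE invmx1 mul1mx mulmx1. Qed.

Lemma nhom_conj (A : 'M[L]_D) (X : md (op Q) L D) : A \in unitmx ->
  nhom (mconj A X) (mconj A X) = nhom X X.
Proof.
move=> uA; have iX : miso X (mconj A X) by apply/misoP; exists A => //; rewrite -mconj_hom.
by rewrite -(nhom_isol _ iX) -(nhom_isor _ iX).
Qed.

(** Two changes of basis that put [T] on the standard module differ by an automorphism of that
    module; one exists by [lf_md_of_iso]. *)
Lemma card_std_conj T : lf T && (mrk T == r) ->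
  #|[set A : 'M[L]_D | (A \in unitmx) && stdmd (mconj A T)]| = nGLr.
Proof.
move=> /andP [lfT /eqP rk].
have [x iT] := lf_md_of_iso lfT (fun i => congr1 (fun f : {ffun _ -> _} => f i) rk).
have [B uB hB] := (misoP _ _).1 iT.
have sx : stdmd (md_of x) by apply/existsP; exists (rcoord x); rewrite rcoordK.
have TE : mconj B T = md_of x by apply/eqP; rewrite mconj_hom.
apply/esym; rewrite nGLrE -(card_imset _ (can_inj (mulKmx uB))).
apply: eq_card => A; rewrite [RHS]inE; apply/imsetP/idP => [[C]|/andP [uA sA]].
  rewrite inE => /andP [uC sC] ->.
  by rewrite unitmx_mul uB uC -mconjM // TE stdmd_conj.
exists (invmx B *m A); last by rewrite mulKVmx.
have uC : invmx B *m A \in unitmx by rewrite unitmx_mul unitmx_inv uB.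
by rewrite inE uC -(stdmd_conj sx) // -TE mconjM // mulKVmx.
Qed.

(** Double count of the pairs (T, A) such that A puts [T] in standard form: each [T] admits [nGLr]
    of them, and for each A the conjugates run once through the points of R(Q, n; r). The total
    #GL_D of the A cancels the denominator of [mwt]. *)
Lemma wcoef_send : wcoef L r = send%:R / nGLr%:R.
Proof.
have g0 : nGLr%:R != 0 :> rat.
  rewrite pnatr_eq0 -lt0n nGLrE; apply/card_gt0P; exists 1%:M.
  by rewrite inE unitmx1 /comm_std mulmx1 mul1mx eqxx andbT; apply/forallP => i; rewrite mulmx1 mul1mx.
apply: (canRL (mulfK g0)); rewrite /wcoef mulr_suml.
transitivity (\sum_(T : md (op Q) L D | lf T && (mrk T == r))
    \sum_(A : 'M[L]_D | (A \in unitmx) && stdmd (mconj A T)) mwt T).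
  apply: eq_bigr => T hT; rewrite sumr_const -(card_std_conj hT) mulr_natr.
  by congr (_ *+ _); apply: eq_card => A; rewrite inE.
rewrite (exchange_big_dep (fun A => A \in unitmx)) /=; last by move=> T A _ /andP [].
have E (A : 'M[L]_D) : A \in unitmx ->
    \sum_(T : md (op Q) L D | lf T && (mrk T == r) && ((A \in unitmx) && stdmd (mconj A T))) mwt T
    = send%:R / (nGL L D)%:R.
  move=> uA; rewrite sendE natr_sum mulr_suml.
  have uV : invmx A \in unitmx by rewrite unitmx_inv.
  rewrite [RHS](reindex_onto (mconj A) (mconj (invmx A))) => [|X _]; last first.
    by rewrite mconjM // mulVmx // mconj1.
  apply: eq_big => [T|T _]; last by rewrite /mwt nhom_conj.
  rewrite mconjM // mulmxV // mconj1 eqxx andbT uA /=.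
  apply/andP/idP => [[]//|sT]; split=> //; move: (lf_stdmd sT) => /andP [lT /eqP rT].
  have iT : miso T (mconj A T) by apply/misoP; exists A => //; rewrite -mconj_hom.
  by rewrite (lf_isoE iT) lT (mrk_iso iT) rT eqxx.
rewrite (eq_bigr _ E) sumr_const.
have -> : #|[pred A : 'M[L]_D | A \in unitmx]| = nGL L D by rewrite /nGL cardsE.
rewrite -[LHS]mulr_natr divfK // pnatr_eq0 -lt0n; exact: nGL_gt0.
Qed.

End PointCounts.

Lemma wcoef0 (Q : mquiver) (L : finFieldType) (r : {ffun vert Q -> nat}) : tdeg r = 0%N -> wcoef L r = 1.
Proof.
move=> r0; have rz i : r i = 0%N.
  by apply/eqP; rewrite -leqn0 -r0 /tdeg (bigD1 i) //= leq_addr.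
have D0 : dimr r = 0%N by rewrite /dimr big1 // => i _; rewrite rz muln0.
have mx1 (A B : 'M[L]_(dimr r)) : A = B.
  by apply/matrixP => i; have := ltn_ord i; rewrite {2}D0.
have c1 (P : pred 'M[L]_(dimr r)) : P 1%:M -> #|[set A | P A]| = 1%N.
  by move=> P1; apply/eqP/cards1P; exists 1%:M; apply/setP => A; rewrite !inE (mx1 A 1%:M) P1 eqxx.
have [lx rx] := lf_md_of (0 : rep L r).
rewrite /wcoef (big_pred1 (md_of 0)) => [|T].
  by rewrite /mwt /nhom /nGL !c1 ?unitmx1 ?mhom1 ?divr1.
have -> : T = md_of 0 by apply/ffunP => g; apply: mx1.
by rewrite /= eqxx lx rx; apply/eqP/ffunP => i; rewrite ffunE.
Qed.


(** * The plethystic exponential *)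

Section SeriesTheory.
Variable Q : mquiver.
Local Notation rank := {ffun vert Q -> nat}.
Implicit Types (r s u v : rank) (F G H : series (vert Q)).

Definition rval B (u : {ffun vert Q -> 'I_B}) : rank := [ffun i => u i : nat].

(** The index type in [series_mul] depends on the exponent; a fixed box of bounded functions,
    filtered by [rle], allows double sums to be exchanged. *)
Lemma sum_below (V : nmodType) r (f : rank -> V) B : (forall i, r i < B.+1)%N ->
  \sum_(s : {dffun forall i, 'I_(r i).+1}) f [ffun i => s i : nat]
  = \sum_(u : {ffun vert Q -> 'I_B.+1} | rle (rval u) r) f (rval u).
Proof.
move=> ltB.
pose h (s : {dffun forall i, 'I_(r i).+1}) : {ffun vert Q -> 'I_B.+1} := [ffun i => inord (s i)].
pose h' (u : {ffun vert Q -> 'I_B.+1}) : {dffun forall i, 'I_(r i).+1} :=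
  [ffun i => inord (u i) : 'I_(r i).+1].
have hv (s : {dffun forall i, 'I_(r i).+1}) : rval (h s) = [ffun i => s i : nat].
  apply/ffunP => i; rewrite !ffunE inordK //.
  exact: leq_trans (ltn_ord _) (ltB i).
rewrite [RHS](reindex_onto h h') => [|u /forallP ur]; last first.
  apply/ffunP => i; rewrite !ffunE; apply: val_inj => /=.
  have := ur i; rewrite ffunE => ur_i.
  have e : (inord (u i) : 'I_(r i).+1) = u i :> nat by rewrite inordK ?ltnS.
  by rewrite e inordK.
apply: eq_big => [s|s _]; last by rewrite hv.
apply/esym/andP; split; first by apply/forallP => i; rewrite hv ffunE -ltnS.
apply/eqP/ffunP => i; rewrite !ffunE; apply: val_inj => /=.
have e : (inord (s i) : 'I_B.+1) = s i :> nat by rewrite inordK ?(leq_trans (ltn_ord _) (ltB i)).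
by rewrite e inordK.
Qed.

Lemma ltn_tdeg r i : (r i < (tdeg r).+1)%N.
Proof. by rewrite ltnS /tdeg (bigD1 i) //= leq_addr. Qed.

Lemma ltn_tdeg_sub r v i : (rsub r v i < (tdeg r).+1)%N.
Proof. by rewrite ffunE ltnS (leq_trans (leq_subr _ _)) // -ltnS ltn_tdeg. Qed.

Lemma series_mulE F G r B : (forall i, r i < B.+1)%N ->
  series_mul F G r = \sum_(u : {ffun vert Q -> 'I_B.+1} | rle (rval u) r)
    F (rval u) * G (rsub r (rval u)).
Proof.
move=> ltB; rewrite -(sum_below (fun u => F u * G (rsub r u)) ltB).
apply: eq_bigr => s _; congr (_ * G _).
by apply/ffunP => i; rewrite !ffunE.
Qed.

Lemma series_mulCA F G H r :
  series_mul F (series_mul G H) r = series_mul G (series_mul F H) r.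
Proof.
set B := tdeg r; have ltB := ltn_tdeg r.
have E F' G' : series_mul F' (series_mul G' H) r =
    \sum_(u : {ffun vert Q -> 'I_B.+1}) \sum_(v : {ffun vert Q -> 'I_B.+1})
      if rle (rval u) r && rle (rval v) (rsub r (rval u)) then
        F' (rval u) * (G' (rval v) * H (rsub (rsub r (rval u)) (rval v))) else 0.
  rewrite (series_mulE _ _ ltB) big_mkcond; apply: eq_bigr => u _.
  case: ifP => hu; last by rewrite big1.
  rewrite (series_mulE _ _ (ltn_tdeg_sub r (rval u))) big_distrr big_mkcond.
  by apply: eq_bigr => v _.
rewrite !E exchange_big; apply: eq_bigr => v _; apply: eq_bigr => u _.
have -> : rle (rval u) r && rle (rval v) (rsub r (rval u))
    = rle (rval v) r && rle (rval u) (rsub r (rval v)).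
  apply/andP/andP => -[/forallP h1 /forallP h2]; split; apply/forallP => i.
  - by have := h2 i; rewrite !ffunE => h; apply: leq_trans h (leq_subr _ _).
  - by have := h1 i; have := h2 i; rewrite !ffunE => h h'; rewrite leq_subRL ?(leq_trans h) ?leq_subr // addnC -leq_subRL.
  - by have := h2 i; rewrite !ffunE => h; apply: leq_trans h (leq_subr _ _).
  - by have := h1 i; have := h2 i; rewrite !ffunE => h h'; rewrite leq_subRL ?(leq_trans h) ?leq_subr // addnC -leq_subRL.
case: ifP => // _; rewrite mulrCA; congr (_ * (_ * H _)).
by apply/ffunP => i; rewrite !ffunE subnAC.
Qed.

(** The Euler derivation sum_i t_i d/dt_i. *)
Definition series_der F : series (vert Q) := fun r => (tdeg r)%:R * F r.

Lemma tdeg_split r u : rle u r -> tdeg r = (tdeg u + tdeg (rsub r u))%N.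
Proof.
move=> /forallP ur; rewrite /tdeg -big_split; apply: eq_bigr => i _.
by rewrite ffunE /= subnKC.
Qed.

Lemma series_derM F G r :
  series_der (series_mul F G) r
  = series_mul (series_der F) G r + series_mul F (series_der G) r.
Proof.
have ltB := ltn_tdeg r.
rewrite /series_der !(series_mulE _ _ ltB) big_distrr -big_split; apply: eq_bigr => u hu /=.
rewrite [X in X%:R * _](tdeg_split hu) natrD mulrDl mulrA; congr (_ + _).
by rewrite mulrCA.
Qed.

Lemma eq_series_mulr F G H r : (forall s, G s = H s) -> series_mul F G r = series_mul F H r.
Proof. by move=> e; apply: eq_bigr => s _; rewrite e. Qed.

Lemma series_mul_natr F G k r :
  series_mul F (fun s => k%:R * G s) r = k%:R * series_mul F G r.
Proof. by rewrite big_distrr; apply: eq_bigr => s _; rewrite mulrCA. Qed.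

Lemma series_der_exp G k r :
  series_der (series_exp G k.+1) r = k.+1%:R * series_mul (series_der G) (series_exp G k) r.
Proof.
elim: k r => [|k IH] r.
  rewrite [series_exp G 1]/(series_mul G (series_exp G 0)) series_derM mul1r.
  rewrite [X in _ + X]big1 ?addr0 // => s _.
  rewrite /series_der /= /series1; case: eqP => [->|]; last by rewrite !mulr0.
  by rewrite /tdeg big1 ?mul0r ?mulr0 // => i _; rewrite ffunE.
rewrite [series_exp G k.+2]/(series_mul G (series_exp G k.+1)) series_derM.
rewrite (eq_series_mulr _ _ IH) series_mul_natr series_mulCA.
by rewrite -[X in X + _]mul1r -mulrDl nat1r.
Qed.

Lemma unitr_volume_nat k : (0 < k)%N -> (k%:R : volume) \is a GRing.unit.
Proof.
move=> k0; apply/asboolP => l; suff -> : (k%:R : volume) l = k%:R by rewrite pnatr_eq0 -lt0n.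
by elim: (k) => // j; rewrite -!natr1 => <-.
Qed.

(** D(exp G) = D(G) exp G, read at t^r. Terms with u = 0 carry the factor 0, so in positive degree
    it determines the coefficient from those of smaller degree. *)
Lemma exp_series_rec G r : G [ffun=> 0%N] = 0 ->
  (tdeg r)%:R * exp_series G r
  = \sum_(u : {ffun vert Q -> 'I_(tdeg r).+1} | rle (rval u) r)
      (tdeg (rval u))%:R * G (rval u) * exp_series G (rsub r (rval u)).
Proof.
move=> G0; have ltB := ltn_tdeg r.
have [r0|r_gt0] := posnP (tdeg r).
  rewrite r0 mul0r big1 // => u /tdeg_split; rewrite r0 => /esym/eqP.
  by rewrite addn_eq0 => /andP [/eqP -> _]; rewrite !mul0r.
transitivity (\sum_(0 <= k < (tdeg r).+1) (k`!%:R)^-1 * series_der (series_exp G k) r).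
  by rewrite /exp_series big_distrr; apply: eq_bigr => k _; rewrite mulrCA.
rewrite big_nat_recl // [X in X + _](_ : _ = 0) ?add0r; last first.
  rewrite /series_der /= /series1; case: eqP => [e|_]; last by rewrite !mulr0.
  by move: r_gt0; rewrite e /tdeg big1 // => i _; rewrite ffunE.
transitivity (\sum_(0 <= k < tdeg r) (k`!%:R)^-1 * series_mul (series_der G) (series_exp G k) r).
  apply: eq_bigr => k _; rewrite series_der_exp mulrA; congr (_ * _).
  rewrite factS natrM invrM ?unitr_volume_nat ?fact_gt0 // mulrVK ?unitr_volume_nat //.
rewrite (eq_bigr _ (fun k _ => congr1 _ (series_mulE _ _ ltB))).
under eq_bigr => k _ do rewrite big_distrr.
rewrite exchange_big; apply: eq_bigr => u hu /=; rewrite /series_der /exp_series.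
have [u0|u_gt0] := posnP (tdeg (rval u)).
  by rewrite u0 !mul0r big1 // => k _; rewrite !mul0r mulr0.
have lt_u : (tdeg (rsub r (rval u)) < tdeg r)%N.
  by rewrite [X in (_ < X)%N](tdeg_split hu) -[X in (X < _)%N]add0n ltn_add2r.
(* The two exponentials are truncated at different degrees; the surplus powers of [G] do not reach
   this coefficient. *)
rewrite [RHS]mulr_sumr (big_cat_nat (n := (tdeg (rsub r (rval u))).+1)) //=.
rewrite [X in _ + X]big_nat [X in _ + X]big1 ?addr0 => [|k /andP [lt_k _]]; last first.
  by rewrite series_exp_small ?mulr0.
by apply: eq_bigr => k _; rewrite mulrCA.
Qed.

End SeriesTheory.

(* Cardinals of the sets in the statement *)
From mathcomp Require Import classical_sets functions cardinality.

Lemma ncard_image (T : Type) (I : finType) (P : pred I) (f : I -> T) (A : set T) :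
    {in P &, injective f} -> (forall a, A a <-> exists2 i, P i & f i = a) -> ncard A = #|P|.
Proof.
move=> f_inj AE; apply: ncardE.
pose g (k : 'I_#|P|) := f (enum_val k).
have g_inj : {in [set: 'I_#|P|]%classic &, injective g}.
  move=> k l _ _ /f_inj e; apply: enum_val_inj; apply: e; exact: enum_valP.
have -> : A = (g @` setT)%classic.
  apply/funext => a; apply/propext; rewrite AE; split=> [[i Pi <-]|[k _ <-]].
    by exists (enum_rank_in Pi i); rewrite // /g enum_rankK_in.
  by exists (enum_val k) => //; apply: enum_valP.
apply: card_eq_trans (inj_card_eq g_inj) _.
by rewrite card_eq_sym; apply: card_II.
Qed.

Section LinearForm.
Variables (K : fieldType) (V : lmodType K) (n : nat) (co : V -> 'rV[K]_n).
Hypothesis co_lin : forall c x y, co (c *: x + y) = c *: co x + co y.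

Definition form_of (c : 'cV[K]_n) (x : V) : K^o := (co x *m c) 0 0.

Fact form_of_linear c : linear (form_of c).
Proof. by move=> k x y; rewrite /form_of co_lin mulmxDl -scalemxAl !mxE. Qed.

Lemma form_of_ex c : exists f : {linear V -> K^o}, forall x, f x = form_of c x.
Proof.
pose f : {linear V -> K^o} := HB.pack (form_of c)
  (GRing.isLinear.Build K V K^o _ (form_of c) (form_of_linear c)).
by exists f.
Qed.

End LinearForm.

Section Points.
Variables (Q : mquiver) (L : finFieldType) (r : {ffun vert Q -> nat}).

Lemma eq_dual (V : lmodType L) (f g : dual V) : (forall x, f x = g x) -> f = g.
Proof.
case: f g => f [[fA] [fB]] [g [[gA] [gB]]] /= fg; have {fg} e : f = g by apply/funext.
case: g / e gA gB => gA gB; congr (GRing.Linear.Pack (GRing.Linear.Class _ _)).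
  by congr GRing.isNmodMorphism.Axioms_; apply: Prop_irrelevance.
by congr GRing.isScalable.Axioms_; apply: Prop_irrelevance.
Qed.

Lemma ncard_moment_zero : ncard (@moment_zero Q L r) = nmoment L r.
Proof.
have [F FE] := choice (form_of_ex (@rcoord_lin Q L r)).
pose f (uc : 'rV[L]_#|ridx r| * 'cV[L]_#|ridx r|) : rep L r * dual (rep L r) :=
  (runcoord uc.1, F uc.2).
rewrite /nmoment cardsE; apply: (ncard_image (f := f)) => [[u c] [u' c'] _ _|[x y]].
  move=> e; have e1 : runcoord u = runcoord u' := congr1 fst e.
  have Fcc : F c = F c' := congr1 snd e.
  congr (_, _); first exact: (can_inj (@runcoordK Q L r) e1).
  apply/colP => b; have := FE c (runcoord (delta_mx 0 b)).
  by rewrite Fcc FE /form_of runcoordK -!rowE !mxE.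
split=> [h|[[u c]]]; last first.
  move=> Puc e xi; have uc : actmx (runcoord u) *m c = 0 by apply/eqP.
  have <- : runcoord u = x := congr1 fst e.
  have <- : F c = y := congr1 snd e.
  rewrite /moment_map /= FE /form_of.
  by rewrite -(gcoordK xi) -actmxE -mulmxA uc mulmx0 mxE.
pose c : 'cV[L]_#|ridx r| := \col_b y (runcoord (delta_mx 0 b)).
have yE z : y z = (rcoord z *m c) 0 0.
  have gL k (u v : 'rV[L]_#|ridx r|) :
      \row_(_ < 1) y (runcoord (k *: u + v)) = k *: \row_(_ < 1) y (runcoord u) + \row_(_ < 1) y (runcoord v).
    have -> : runcoord (k *: u + v) = k *: runcoord u + runcoord v.
      by apply: (can_inj (@rcoordK Q L r)); rewrite rcoord_lin !runcoordK.
    by apply/rowP => b; rewrite !mxE linearP.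
  have := row_linE gL (rcoord z); rewrite rcoordK => /rowP/(_ 0); rewrite mxE => ->.
  by rewrite !mxE; apply: eq_bigr => b _; rewrite !mxE.
have Fy : F c = y by apply: eq_dual => z; rewrite FE yE.
exists (rcoord x, c); last by rewrite /f Fy; congr (_, _); apply: rcoordK.
suff E : actmx (runcoord (rcoord x)) *m c = 0 by exact: introT eqP E.
rewrite rcoordK; apply/row_matrixP => b; rewrite rowE mulmxA actmxE row0; apply/matrixP => i j; rewrite !ord1.
by rewrite -yE mxE; apply: h.
Qed.

Lemma ncard_GL : ncard (@GL Q L r) = nGLr L r.
Proof.
rewrite /nGLr cardsE; apply: (ncard_image (f := @guncoord Q L r)) => [|g].
  by move=> u v _ _ /(can_inj (@guncoordK Q L r)).
split=> [gu|[u]]; last by move=> /= /unit_famactE uu <-.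
by exists (gcoord g); rewrite ?gcoordK //=; apply/unit_famactE.
Qed.

Lemma ncard_abs_indec_classes : ncard (@abs_indec_classes Q L r) = nabs L r.
Proof.
pose f (Y : md (op Q) L (dimr r)) : set (rep L r) := fun y => miso (md_of y) Y.
rewrite /nabs cardsE; apply: (ncard_image (f := f)) => [Y Z|A].
  move=> /= /andP [/andP [cY _] rY] /andP [/andP [cZ _] _] fYZ.
  have /indclassP [lY _ cY'] := cY; have /indclassP [_ _ cZ'] := cZ.
  have [x ix] := lf_md_of_iso lY (fun i => congr1 (fun f : {ffun _ -> _} => f i) (eqP rY)).
  have iZ : f Z x by rewrite -fYZ; apply: miso_sym.
  by rewrite -cY' -cZ'; apply: mcanon_eq; apply: miso_trans ix iZ.
split=> [[x ax <-]|[Y]].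
  exists (mcanon (md_of x)); last first.
    apply/funext => y; apply/propext; rewrite /f /= rep_isoE; split=> h.
      exact: miso_trans (mcanon_iso (md_of x)) (miso_sym h).
    exact: miso_trans (miso_sym h) (mcanon_iso (md_of x)).
  have [lx rx] := lf_md_of x; have ic := mcanon_iso (md_of x).
  move: ax => /abs_indecomposableE ax; rewrite /=; apply/andP; split; last first.
    by rewrite -(mrk_iso ic) rx; apply/eqP/ffunP => i; rewrite ffunE.
  apply/andP; split; last exact/asboolP/(mabs_iso ic).
  apply/indclassP; split; first exact: lf_iso ic lx.
    exact: mindec_iso ic (mabs_indec ax).
  by apply: mcanon_eq; apply: miso_sym.
move=> /= /andP [/andP [cY /asboolP aY] rY] <-; have /indclassP [lY _ _] := cY.
have [x ix] := lf_md_of_iso lY (fun i => congr1 (fun f : {ffun _ -> _} => f i) (eqP rY)).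
exists x; first by apply/abs_indecomposableE; apply: mabs_iso aY.
apply/funext => y; apply/propext; rewrite /f /= rep_isoE; split=> h.
  exact: miso_sym (miso_trans ix h).
exact: miso_sym (miso_trans h ix).
Qed.

End Points.

Section Volume.

Lemma vol_inv (a : volume) k : a \is a GRing.unit -> a^-1 k = (a k)^-1.
Proof. by move=> ua; rewrite /GRing.inv /= /volume_inv ua. Qed.

Lemma vol_nat n k : (n%:R : volume) k = n%:R.
Proof. by elim: n => // n IH; rewrite -!natr1 -IH. Qed.

Lemma vol_sum (J : Type) (s : seq J) (P : pred J) (f : J -> volume) k :
  (\sum_(j <- s | P j) f j) k = \sum_(j <- s | P j) f j k.
Proof. exact: (big_morph (fun a : volume => a k)). Qed.

Lemma vol_exp (a : volume) n k : (a ^+ n) k = a k ^+ n.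
Proof. by elim: n => // n IH; rewrite !exprS -IH. Qed.

Lemma vol_exprz (a : volume) (z : int) k : a \is a GRing.unit -> (a ^ z) k = a k ^ z.
Proof.
move=> ua; case: z => n; first exact: vol_exp.
by rewrite -[a ^ _]/(a ^- n.+1) vol_inv ?unitrX // vol_exp.
Qed.

Lemma vol_unitP (a : volume) : (forall k, a k != 0) -> a \is a GRing.unit.
Proof. by move=> h; apply/asboolP. Qed.

End Volume.

(** * Matching the two recursions *)

Section Comparison.
Variables (Q : mquiver) (K : finFieldType) (F : posnat -> finFieldType).
Hypothesis card_F : forall k : posnat, #|F k| = (#|K| ^ val k)%N.
Local Notation rank := {ffun vert Q -> nat}.

Let q_gt1 : (1 < #|K|)%N. Proof. exact: finNzRing_gt1. Qed.

Lemma volq_neq0 k : volq #|K| k != 0.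
Proof. by rewrite pnatr_eq0 expn_eq0 negb_and -lt0n (ltn_trans _ q_gt1). Qed.

Lemma volq_unit : volq #|K| \is a GRing.unit.
Proof. by apply: vol_unitP => k; apply: volq_neq0. Qed.

Lemma one_sub_volq_unit : (1 - (volq #|K|)^-1 : volume) \is a GRing.unit.
Proof.
apply: vol_unitP => k; rewrite -[X in X != 0]/(1 - (volq #|K|)^-1 k) vol_inv ?volq_unit //.
rewrite subr_eq0 eq_sym invr_eq1 pnatr_eq1; apply/eqP => e.
by have := valP k; rewrite -(ltn_exp2l 0 _ q_gt1) e.
Qed.

Lemma volq_subE k : (1 - (volq #|K|)^-1 : volume) k = 1 - (#|F k|%:R)^-1.
Proof.
by rewrite -[LHS]/(1 - (volq #|K|)^-1 k) vol_inv ?volq_unit // card_F.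
Qed.

Lemma euler_coords (r : rank) : @euler Q r r = #|gidx r|%:Z - #|ridx r|%:Z.
Proof.
rewrite /euler card_gidx card_ridx; congr (_ - _).
  by rewrite (big_morph Posz PoszD (erefl _)).
by rewrite (big_morph Posz PoszD (erefl _)).
Qed.

Lemma nGLr_gt0 (L : finFieldType) (r : rank) : (0 < nGLr L r)%N.
Proof.
rewrite nGLrE; apply/card_gt0P; exists 1%:M.
rewrite inE unitmx1 /comm_std mulmx1 mul1mx eqxx andbT.
by apply/forallP => i; rewrite mulmx1 mul1mx.
Qed.

Lemma point_coef (r : rank) k :
  (volume_of F (fun L => ncard (@moment_zero Q L r))
    / volume_of F (fun L => ncard (@GL Q L r)) * volq #|K| ^ @euler Q r r) k
  = wcoef (F k) r.
Proof.
set x := volume_of F _; set y := volume_of F _.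
have uy : y \is a GRing.unit.
  by apply: vol_unitP => l; rewrite /y /volume_of ncard_GL pnatr_eq0 -lt0n nGLr_gt0.
rewrite -[LHS]/(x k * y^-1 k * (volq #|K| ^ @euler Q r r) k) vol_inv // vol_exprz ?volq_unit //.
rewrite /x /y /volume_of ncard_GL ncard_moment_zero wcoef_send.
rewrite mulrAC; congr (_ / _); have := nmomentE (F k) r.
have -> : volq #|K| k = #|F k|%:R by rewrite card_F.
have F0 : #|F k|%:R != 0 :> rat.
  by rewrite pnatr_eq0 -lt0n; apply/card_gt0P; exists 0.
move=> /(congr1 (fun n => n%:R : rat)); rewrite !natrM !natrX => E.
rewrite euler_coords expfzDr // mulrA -[X in _ * X * _]/(#|F k|%:R ^+ _) E.
by rewrite -exprnN mulrAC mulfV ?mul1r // expf_neq0.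
Qed.

Lemma sum_one_match S M (C : pred 'I_S) (D : pred 'I_M) (f : 'I_S -> rat) (g : 'I_M -> rat) :
    (forall n, C n -> exists2 m, D m & f n = g m) ->
    (forall m, D m -> exists n, C n) ->
    (forall n n', C n -> C n' -> n = n') -> (forall m m', D m -> D m' -> m = m') ->
  \sum_(n | C n) f n = \sum_(m | D m) g m.
Proof.
move=> CD DC uC uD; case: (pickP C) => [n Cn|C0].
  have [m Dm fg] := CD n Cn; rewrite (big_pred1 n) => [|n']; last first.
    by apply/idP/eqP => [/uC/(_ Cn)|->].
  by rewrite (big_pred1 m) // => m'; apply/idP/eqP => [/uD/(_ Dm)|->].
rewrite !big_pred0 // => m; apply/negP => /DC [n].
by rewrite C0.
Qed.

Definition udiv (u : rank) n : rank := [ffun i => (u i %/ n)%N].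

Variable k : posnat.
Local Notation L := (F k).
Local Notation Fn n := (F (posM (posS n) k)).

Lemma card_Fn n : #|Fn n| = (#|L| ^ n.+1)%N.
Proof. by rewrite !card_F /= mulnC expnM. Qed.

(** An indecomposable [X] contributes on the left for the extension of degree N = n + 1 and on the
    right for the multiple m + 1, related by N = (m + 1) [rdeg X]. Then |F_N| = Q^(m+1) and tdeg(u /
    N) times [rdeg X] is tdeg(rk X), so the terms agree; for given [X] and u at most one occurs on
    each side. *)
Lemma nabs_match (u : rank) B M : (dimr u < B)%N -> (tdeg u < M)%N -> (0 < tdeg u)%N ->
  \sum_(n < tdeg u | [forall i, (n.+1 %| u i)%N])
     (tdeg (udiv u n.+1))%:R * ((nabs (Fn n) (udiv u n.+1))%:R / (1 - (#|Fn n|%:R)^-1))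
  = \sum_(d < B) \sum_(X : md (op Q) L d | indclass X) \sum_(m < M | rmul m.+1 (mrk X) == u)
      (tdeg (mrk X))%:R / (1 - (qres X)%:R^-1 ^+ m.+1) :> rat.
Proof.
move=> ltB ltM u0.
pose C d (X : md (op Q) L d) n :=
  (rdeg X %| n.+1)%N && (mrk X == [ffun i => rdeg X * udiv u n.+1 i]%N).
transitivity (\sum_(d < B) \sum_(X : md (op Q) L d | indclass X)
   \sum_(n < tdeg u | [forall i, (n.+1 %| u i)%N] && C d X n)
      (tdeg (udiv u n.+1) * rdeg X)%:R / (1 - (#|Fn n|%:R)^-1) : rat).
  rewrite big_mkcond /=.
  transitivity (\sum_(n < tdeg u) \sum_(d < B) \sum_(X : md (op Q) L d | indclass X)
    if [forall i, (n.+1 %| u i)%N] && C d X n then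
      (tdeg (udiv u n.+1) * rdeg X)%:R / (1 - (#|Fn n|%:R)^-1) else 0 : rat).
    apply: eq_bigr => n _; case: ifP => [/forallP nu|_]; last first.
      by rewrite big1 // => d _; rewrite big1.
    have [io _] := finfield_embed (ltn0Sn n) (card_Fn n).
    rewrite (nabs_sum io (ltn0Sn n) (card_Fn n) (B := B)); last first.
      apply: leq_ltn_trans ltB; rewrite /dimr big_distrl leq_sum // => i _.
      by rewrite ffunE /= -mulnA divnK.
    move: (tdeg (udiv u n.+1)) => t.
    rewrite natr_sum mulr_suml mulr_sumr; apply: eq_bigr => d _.
    rewrite natr_sum mulr_suml mulr_sumr; apply: eq_bigr => X _ /=.
    by rewrite /C; case: ifP => _; rewrite ?mul0r ?mulr0 // natrM mulrA.
  rewrite exchange_big; apply: eq_bigr => d _ /=; rewrite exchange_big; apply: eq_bigr => X _ /=.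
  by rewrite [RHS]big_mkcond.
apply: eq_bigr => d _; apply: eq_bigr => X /indclassP [lX indX _].
have [qX rd0] := rdeg_spec indX.
have X0 : (0 < tdeg (mrk X))%N by apply: tdeg_mrk_gt0 => //; case: indX.
have tdegM c (v w : rank) : (forall i, v i = c * w i)%N -> tdeg v = (c * tdeg w)%N.
  by move=> e; rewrite /tdeg big_distrr; apply: eq_bigr => i _.
have Cn n : [forall i, (n.+1 %| u i)%N] -> C d X n -> [/\ n.+1 = (rdeg X * (n.+1 %/ rdeg X))%N,
    (0 < n.+1 %/ rdeg X)%N, rmul (n.+1 %/ rdeg X) (mrk X) = u &
    tdeg (mrk X) = (tdeg (udiv u n.+1) * rdeg X)%N].
  move=> /forallP nu /andP [dn /eqP rX].
  have en : n.+1 = (rdeg X * (n.+1 %/ rdeg X))%N by rewrite mulnC divnK.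
  split=> //.
  - by rewrite divn_gt0 // dvdn_leq.
  - apply/ffunP => i; rewrite rX !ffunE mulnA [(_ * rdeg X)%N]mulnC -en mulnC.
    by rewrite divnK.
  - by rewrite [RHS]mulnC; apply: tdegM => i; rewrite {1}rX ffunE.
have rmul_inj a b : rmul a (mrk X) = u -> rmul b (mrk X) = u -> a = b.
  move=> au bu; apply/eqP; rewrite -(eqn_pmul2r X0).
  have E c : tdeg (rmul c (mrk X)) = (c * tdeg (mrk X))%N.
    by apply: tdegM => i; rewrite ffunE.
  by rewrite -!E au bu.
apply: sum_one_match => [n /andP [nu cX]|m /eqP mu|n n' /andP [nu cX] /andP [nu' cX']|m m' /eqP mu /eqP mu'].
- have [en m0 mu tX] := Cn n nu cX.
  have lt_m : ((n.+1 %/ rdeg X).-1 < M)%N.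
    apply: leq_ltn_trans ltM.
    exact: leq_trans (leq_pred _) (leq_trans (leq_div _ _) (ltn_ord n)).
  exists (Ordinal lt_m); first by rewrite /= prednK // mu.
  rewrite /= prednK // -tX; congr (_ / (1 - _)).
  by rewrite qX exprVn -natrX -expnM -en card_Fn.
(* That N divides u requires [rdeg X] to divide rk X, which is seen over the extension of degree
   exactly [rdeg X]. *)
- have cE : #|F (posM (posS (rdeg X).-1) k)| = (#|L| ^ rdeg X)%N by rewrite card_Fn prednK.
  have [io _] := finfield_embed rd0 cE.
  have [w wX] := rdeg_dvd io cE lX indX erefl; pose s : rank := [ffun i => w i].
  have sX i : mrk X i = (rdeg X * s i)%N by rewrite wX !ffunE.
  pose n := (rdeg X * m.+1).-1.
  have nE : n.+1 = (rdeg X * m.+1)%N by rewrite prednK // muln_gt0 rd0.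
  have tu : tdeg u = (n.+1 * tdeg s)%N.
    by apply: tdegM => i; rewrite -mu ffunE sX nE mulnA [(m.+1 * _)%N]mulnC.
  have s0 : (0 < tdeg s)%N by move: u0; rewrite tu muln_gt0 => /andP [].
  have lt_n : (n < tdeg u)%N by rewrite tu leq_pmulr.
  exists (Ordinal lt_n); apply/andP => /=.
  have ui i : u i = (s i * n.+1)%N.
    by rewrite -mu ffunE sX nE mulnA [(m.+1 * _)%N]mulnC mulnC.
  split; first by apply/forallP => i; rewrite ui dvdn_mull.
  rewrite /C nE dvdn_mulr //=; apply/eqP/ffunP => i; rewrite sX [RHS]ffunE [udiv _ _ _]ffunE.
  by rewrite ui nE mulnK // -nE.
- have [en _ mu _] := Cn n nu cX; have [en' _ mu' _] := Cn n' nu' cX'.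
  apply: val_inj; apply: succn_inj; rewrite en en'; congr (_ * _)%N.
  exact: rmul_inj mu mu'.
by apply: val_inj; apply: succn_inj; apply: rmul_inj mu mu'.
Qed.

End Comparison.

Section Final.
Variables (Q : mquiver) (K : finFieldType) (F : posnat -> finFieldType).
Hypothesis card_F : forall k : posnat, #|F k| = (#|K| ^ val k)%N.
Local Notation rank := {ffun vert Q -> nat}.

Definition abs_series : series (vert Q) := fun r =>
  if r == [ffun=> 0%N] then 0
  else volume_of F (fun L => ncard (@abs_indec_classes Q L r)) / (1 - (volq #|K|)^-1).

Definition log_series : series (vert Q) := fun r =>
  \sum_(0 <= m < tdeg r) (m.+1%:R)^-1 * series_adams (posS m) abs_series r.

Lemma tdeg0P (r : rank) : (tdeg r == 0%N) = (r == [ffun=> 0%N]).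
Proof.
rewrite /tdeg sum_nat_eq0; apply/forallP/eqP => [r0|-> i]; last by rewrite ffunE.
by apply/ffunP => i; rewrite ffunE; apply/eqP/r0.
Qed.

Lemma abs_series_coef (r : rank) k : (0 < tdeg r)%N ->
  abs_series r k = (nabs (F k) r)%:R / (1 - (#|F k|%:R)^-1).
Proof.
move=> r0; rewrite /abs_series -tdeg0P gtn_eqF //.
rewrite -[LHS]/(volume_of F _ k * (1 - (volq #|K|)^-1)^-1 k) vol_inv; last exact: one_sub_volq_unit.
by rewrite (volq_subE card_F) /volume_of ncard_abs_indec_classes.
Qed.

Lemma tdeg_udiv (u : rank) n : [forall i, (n.+1 %| u i)%N] -> tdeg u = (tdeg (udiv u n.+1) * n.+1)%N.
Proof.
move=> /forallP nu; rewrite /tdeg big_distrl; apply: eq_bigr => i _.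
by rewrite ffunE /= divnK.
Qed.

(** The factor 1/m in front of the m-th Adams operator cancels against tdeg u = m tdeg(u / m). *)
Lemma log_series_coef (u : rank) k : (0 < tdeg u)%N ->
  (tdeg u)%:R * log_series u k
  = \sum_(n < tdeg u | [forall i, (n.+1 %| u i)%N]) (tdeg (udiv u n.+1))%:R *
     ((nabs (F (posM (posS n) k)) (udiv u n.+1))%:R / (1 - (#|F (posM (posS n) k)|%:R)^-1)).
Proof.
move=> u0; rewrite /log_series big_mkord vol_sum mulr_sumr [RHS]big_mkcond.
apply: eq_bigr => n _; rewrite -[X in _ * X]/((n.+1%:R : volume)^-1 k * series_adams (posS n) abs_series u k).
rewrite vol_inv ?unitr_volume_nat // vol_nat /series_adams -[val (posS n)]/(n.+1).
case: ifP => [nu|_]; last by rewrite -[X in _ * (_ * X)]/(0 : rat) !mulr0.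
have tu := tdeg_udiv nu.
(* The Adams operator of index n + 1 reads component (n + 1) k: the field of degree n + 1 over
   [F k]. *)
rewrite -[X in _ * (_ * X)]/(abs_series (udiv u n.+1) (posM (posS n) k)).
rewrite abs_series_coef; last by move: u0; rewrite {1}tu muln_gt0 => /andP [].
by rewrite mulrA [X in X%:R * _ * _]tu natrM mulfK // pnatr_eq0.
Qed.

(** Induction on the degree: [exp_series_rec] and [wcoef_rec] express both coefficients through
    those at r - u with u nonzero, and [nabs_match] identifies the multipliers. *)
Lemma Exp_coef (r : rank) k : exp_series log_series r k = wcoef (F k) r.
Proof.
have [N] := ubnP (tdeg r); elim: N r => // N IH r; rewrite ltnS => ltN.
have [r0|r_gt0] := posnP (tdeg r).
  rewrite wcoef0 // /exp_series r0 big_nat1 /= /series1 -tdeg0P r0 eqxx.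
  by rewrite fact0 invr1 mulr1.
have tr0 : (tdeg r)%:R != 0 :> rat by rewrite pnatr_eq0 -lt0n.
apply: (mulfI tr0); rewrite -[X in X * _ = _](vol_nat (tdeg r) k).
have G0 : log_series [ffun=> 0%N] = 0.
  by rewrite /log_series big_geq // leqn0 tdeg0P.
rewrite -[LHS]/(((tdeg r)%:R * exp_series log_series r) k) (exp_series_rec r G0) vol_sum.
rewrite (wcoef_rec (F k) (ltnSn (dimr r)) (ltnSn (tdeg r))).
set B := (dimr r).+1; set M := (tdeg r).+1.
pose T d (X : md (op Q) (F k) d) m : rat := (tdeg (mrk X))%:R / (1 - (qres X)%:R^-1 ^+ m.+1).
(* Both recursions become sums over triples (X, m, u) with (m + 1) rk X = u, where u is determined
   by X and m. *)
transitivity (\sum_(u : {ffun vert Q -> 'I_M} | rle (rval u) r)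
  \sum_(d < B) \sum_(X : md (op Q) (F k) d | indclass X) \sum_(m < M)
     if rmul m.+1 (mrk X) == rval u then T d X m * wcoef (F k) (rsub r (rval u)) else 0).
  apply: eq_bigr => u hu.
  rewrite -[LHS]/(((tdeg (rval u))%:R : volume) k * log_series (rval u) k
    * exp_series log_series (rsub r (rval u)) k) vol_nat.
  have [u0|u_gt0] := posnP (tdeg (rval u)).
    rewrite u0 !mul0r big1 // => d _; rewrite big1 // => X /indclassP [lX indX _].
    rewrite big1 // => m _; case: eqP => // e; move: u0; rewrite -e => /eqP.
    rewrite tdeg0P => /eqP/ffunP e0.
    have : (0 < tdeg (mrk X))%N by apply: tdeg_mrk_gt0 => //; case: indX.
    rewrite lt0n tdeg0P => /negP []; apply/eqP/ffunP => i.
    by have := e0 i; rewrite !ffunE => /eqP; rewrite muln_eq0 => /eqP.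
  have lt_u : (tdeg (rsub r (rval u)) < tdeg r)%N.
    by rewrite [X in (_ < X)%N](tdeg_split hu) -[X in (X < _)%N]add0n ltn_add2r.
  rewrite IH ?(leq_trans lt_u) // log_series_coef //.
  rewrite (@nabs_match Q K F card_F k (rval u) B M) //; last first.
  - by rewrite ltnS [X in (_ <= X)%N](tdeg_split hu) leq_addr.
  - by rewrite ltnS leq_sum // => i _; rewrite leq_mul2l; move/forallP: hu => ->; rewrite orbT.
  rewrite mulr_suml; apply: eq_bigr => d _; rewrite mulr_suml; apply: eq_bigr => X _.
  by rewrite mulr_suml big_mkcond; apply: eq_bigr => m _.
rewrite exchange_big; apply: eq_bigr => d _; rewrite exchange_big; apply: eq_bigr => X _.
rewrite exchange_big; apply: eq_bigr => m _ /=.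
case: ifP => [le_r|not_le]; last first.
  rewrite big1 // => u hu; case: eqP => // e.
  by rewrite e hu in not_le.
pose u0 : {ffun vert Q -> 'I_M} := [ffun i => inord (rmul m.+1 (mrk X) i)].
have u0E : rval u0 = rmul m.+1 (mrk X).
  apply/ffunP => i; rewrite ffunE ffunE inordK //.
  by apply: leq_ltn_trans (ltn_tdeg r i); apply: (forallP le_r).
rewrite (bigD1 u0) ?u0E //= eqxx big1 ?addr0 => [|u /andP [_ nu]].
  by rewrite /T mulrAC mulrA.
case: eqP => // e; case/eqP: nu; apply/ffunP => i; apply: val_inj.
have rE (v : {ffun vert Q -> 'I_M}) : rval v i = v i by rewrite ffunE.
by rewrite /= -!rE u0E e.
Qed.

End Final.

Theorem theorem1 (Q : mquiver) (K : finFieldType) (F : posnat -> finFieldType)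
    (card_F : forall k : posnat, #|F k| = (#|K| ^ val k)%N) :
  (fun r : {ffun vert Q -> nat} =>
     volume_of F (fun L => ncard (@moment_zero Q L r))
       / volume_of F (fun L => ncard (@GL Q L r))
       * volq #|K| ^ @euler Q r r) =
  Exp_series (fun r : {ffun vert Q -> nat} =>
     if r == [ffun=> 0%N] then 0
     else volume_of F (fun L => ncard (@abs_indec_classes Q L r))
            / (1 - (volq #|K|)^-1)) :> series (vert Q).
Proof.
apply/funext => r; apply/funext => k.
by rewrite (point_coef card_F) -(Exp_coef card_F).
Qed.
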